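(* Let $h:[0,1]^2\to\mathbb{R}$, $h(x,y)=(x+y-xy)^2$. For every $f\in C([0,1]^2)$, $$\lim_{T\to\infty}\frac{\sum_{\omega\in Q_F(T)}h(\omega,\tilde{\omega})f(\omega,\tilde{\omega})}{\sum_{\omega\in Q_F(T)}h(\omega,\tilde{\omega})}=\int_0^1\int_0^1f(x,y)\,dx\,dy .$$ That is, the probability measures $\tilde m_T$ on $[0,1]^2$ defined by $\int_{[0,1]^2} f\,d\tilde m_T:=\dfrac{\sum_{\omega\in Q_F(T)}h(\omega,\tilde{\omega})f(\omega,\tilde{\omega})}{\sum_{\omega\in Q_F(T)}h(\omega,\tilde{\omega})}$ satisfy $\lim_{T\to\infty}\int_{[0,1]^2} f\,d\tilde m_T=\int_0^1\int_0^1 f(x,y)\,dx\,dy$; i.e. the weighted periodic points of $\tilde F$ given by $\tilde m_T$ equidistribute with respect to Lebesgue measure on $[0,1]^2$.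
   Context: Continued fractions: for positive integers $a_j$, $[a_1,a_2,\ldots]=\cfrac{1}{a_1+\cfrac{1}{a_2+\cdots}}$; an overline denotes periodic repetition, e.g. $[\overline{a_1,\ldots,a_n}]=[a_1,\ldots,a_n,a_1,\ldots,a_n,\ldots]$. The Gauss map $G:[0,1]\to[0,1]$ is $G(x)=\{1/x\}$ (fractional part) for $x\neq0$, $G(0)=0$. The Farey map $F:[0,1]\to[0,1]$ is $F(x)=\frac{x}{1-x}$ for $0\le x\le \frac12$ and $F(x)=\frac{1-x}{x}$ for $\frac12<x\le1$. Its natural extension $\tilde F:[0,1]^2\to[0,1]^2$ is $\tilde F(x,y)=\left(\frac{x}{1-x},\frac{y}{1+y}\right)$ if $0\le x\le\frac12$ and $\tilde F(x,y)=\left(\frac{1-x}{x},\frac{1}{1+y}\right)$ if $\frac12<x\le1$. $Q_G$ is the set of nonzero periodic points of $G$; these are exactly the numbers $[\overline{a_1,\ldots,a_n}]$ with $a_j\in\mathbb{N}$ ($\mathbb N$ = positive integers). $Q_F$ is the set of nonzero periodic points of $F$; these are exactly the numbers $F^k(\omega)$ with $\omega\in Q_G$, $k\ge0$, equivalently the numbers $[a_1-k,\overline{a_2,\ldots,a_n,a_1}]$ with $a_j\in\mathbb{N}$ and $k\in\{0,\ldots,a_1-1\}$. For $\omega=[a_1-k,\overline{a_2,\ldots,a_n,a_1}]\in Q_F$ one sets $\tilde\omega=[1+k,\overline{a_n,\ldots,a_1}]$, so that $(\omega,\tilde\omega)$ is the periodic point of $\tilde F$ corresponding to $\omega$. Length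 function: for $\omega\in Q_G$ with minimal even periodic expansion $\omega=[\overline{a_1,\ldots,a_{2n}}]$ (i.e. $2n$ is the smallest even period of the continued fraction expansion), $\ell(\omega):=-2\sum_{j=1}^{2n}\log(G^j(\omega))$. This is extended to $Q_F$ by $\ell(F^k(\omega)):=\ell(\omega)$ for $\omega\in Q_G$, $k\in\mathbb{N}$. For $T>0$, $Q_F(T):=\{\omega\in Q_F:\ell(\omega)\le T\}$ (nonempty for all sufficiently large $T$). *)

(* Defs.v *)
From HB Require Import structures.
From mathcomp Require Import all_boot all_order all_algebra.
From mathcomp Require Import all_classical all_reals all_analysis.

Set Implicit Arguments.
Unset Strict Implicit.
Unset Printing Implicit Defensive.

Import Order.TTheory GRing.Theory Num.Theory.
Import numFieldNormedType.Exports.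

Local Open Scope classical_set_scope.
Local Open Scope ring_scope.

(* The value of [a_1, ..., a_n]; every list of digits below is positive. *)
Definition cf_fin (R : realType) (s : seq nat) : R :=
  foldr (fun d x => (d%:R + x)^-1) 0 s.

(* The digits are numbered from 0: cf a = [a 0, a 1, a 2, ...]. *)
Definition cf (R : realType) (a : nat -> nat) : R :=
  lim (cf_fin R (mkseq a n) @[n --> \oo]).

Definition preperiodic (p s : seq nat) (n : nat) : nat :=
  if (n < size p)%N then nth 0%N p n
  else nth 0%N s ((n - size p) %% size s)%N.

(* [p, \overline{s}] *)
Definition cf_pre (R : realType) (p s : seq nat) : R := cf R (preperiodic p s).

(* [\overline{s}] *)
Definition cf_per (R : realType) (s : seq nat) : R := cf_pre R [::] s.

Definition gauss (R : realType) (x : R) : R :=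
  if x == 0 then 0 else x^-1 - (Num.floor x^-1)%:~R.

Definition farey (R : realType) (x : R) : R :=
  if x <= 2^-1 then x / (1 - x) else (1 - x) / x.

(* The nonzero periodic points in [0, 1] of a self-map g of [0, 1]. *)
Definition periodic_points (R : realType) (g : R -> R) : set R :=
  [set x | [/\ 0 <= x <= 1, x != 0 & exists2 n, (0 < n)%N & iter n g x = x]].

Definition QG (R : realType) : set R := periodic_points (@gauss R).

Definition QF (R : realType) : set R := periodic_points (@farey R).

Definition even_period (R : realType) (x : R) (m : nat) : Prop :=
  [/\ (0 < m)%N, ~~ odd m &
      exists s : seq nat,
        [/\ size s = m, all (fun d => 0 < d)%N s & x = cf_per R s]].

(* Junk value 0 when x has no purely periodic expansion, i.e. off QG. *)
Definition min_even_period (R : realType) (x : R) : nat :=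
  xget 0%N [set m | even_period x m /\
                    forall m', even_period x m' -> (m <= m')%N].

Definition lengthG (R : realType) (x : R) : R :=
  - 2 * \sum_(1 <= j < (min_even_period x).+1) ln (iter j (@gauss R) x).

(* The extension of lengthG along Farey orbits: all w in QG whose Farey orbit
   contains x lie on one Gauss orbit, on which lengthG is constant, so for x in
   QF the set below is a singleton. *)
Definition length (R : realType) (x : R) : R :=
  xget 0 [set l | exists w k,
    [/\ QG w, x = iter k (@farey R) w & l = lengthG w]].

Definition QFT (R : realType) (T : R) : set R :=
  [set x | QF x /\ length x <= T].

(* x = [a_1 - k, \overline{a_2, ..., a_n, a_1}] and
   y = [1 + k, \overline{a_n, ..., a_1}], with s = a_2, ..., a_n. *)
Definition is_dual (R : realType) (x y : R) : Prop :=
  exists (a1 : nat) (s : seq nat) (k : nat),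
    [/\ all (fun d => 0 < d)%N (a1 :: s), (k < a1)%N,
        x = cf_pre R [:: (a1 - k)%N] (rcons s a1) &
        y = cf_pre R [:: (1 + k)%N] (rev (a1 :: s))].

(* For x in QF there is exactly one y with is_dual x y, since x determines the
   two-sided periodic sequence of the a_j and hence k. *)
Definition dual (R : realType) (x : R) : R := xget 0 [set y | is_dual x y].

Definition hweight (R : realType) (p : R * R) : R :=
  (p.1 + p.2 - p.1 * p.2) ^+ 2.

(* Main.v *)
Require Import Defs.
From HB Require Import structures.
From mathcomp Require Import all_boot all_order all_algebra.
From mathcomp Require Import all_classical all_reals all_analysis.
From mathcomp Require Import complex ring lra zify.

(* The points (x, y) of the periodic orbits are the pairs of fixed points (one
   of them in the dual chart) of the matrices (a, b; c, d) in SL_2(Z) with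
   positive entries and a <= c: such a matrix is a word in the two inverse
   branches of the Farey map, and length x = 2 ln l for the least eigenvalue
   l > 1 of the matrices fixing x.  Hence length x <= T bounds the trace a + d
   by N = floor (e^(T/2) + e^(-T/2)), and the sum over Q_F(T) becomes a sum over
   triples (a, c, d) with a d = 1 mod c and a + d <= N, up to the o(N^2)
   matrices that are proper powers.

   Here x is close to a/c and y to d/(c + d).  On average over c the pairs
   (a, d) of inverses mod c are equidistributed in boxes: this follows from a
   fourth moment bound for Kloosterman sums mod c, which is nontrivial except
   for the rare c with many solutions of 2 u v x = 0 mod c.  The number of
   matrices in a cell is thus asymptotic to a constant times N^2 times its area
   in the measure dx dy / (x + y - x y)^2, a density that the weight h cancels;
   Riemann sums turn the weighted count of cells into the integral of f. *)

Set Implicit Arguments.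
Unset Strict Implicit.
Unset Printing Implicit Defensive.

Import Order.TTheory GRing.Theory Num.Theory.
Import numFieldNormedType.Exports.

Local Open Scope ring_scope.

(** * Kloosterman sums over finite rings *)

(** The density has infinite mass at the corner (0, 0), where [c] is much larger than the trace; a
    count without weight would diverge there. The weight, at most ((a + d) / c)^2, makes the corner
    negligible. Hence three scales, each chosen after the preceding ones: K cuts off the corner and
    the edges y near 0 and y near 1, then q refines the cells, then N grows. In a cell a/c and d/c
    are nearly constant, so the bound on the trace becomes a bound on c alone, and what remains is
    the number of pairs of inverses in a box, summed over c up to a multiple of N. Trigonometric
    majorants give only an upper bound for it. The lower bound is free: the boxes partition the
    units, so the sum of totients turns upper bounds for all boxes into asymptotics. The Kloosterman
    bound rests on one symmetry: K(m u, n / u) is the same for all units u, so a single large sum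
    would be repeated many times in the complete fourth moment, which is an additive energy. The
    density rho of the totient sum enters only as a positive number, since it cancels in the
    quotient. *)

Section FiniteRingKloosterman.
Variables (C : numClosedFieldType) (A : finComUnitRingType) (psi : A -> C).
Hypothesis psi0 : psi 0 = 1.
Hypothesis psiD : forall x y, psi (x + y) = psi x * psi y.
Hypothesis psiN : forall x, psi (- x) = (psi x)^*.
Hypothesis psi_sum : forall y, y != 0 -> \sum_x psi (x * y) = 0.

Definition kloosterman (m n : A) : C :=
  \sum_(x | x \is a GRing.unit) psi (m * x + n * x^-1).

Lemma psi_sumE y : \sum_x psi (x * y) = (#|A| * (y == 0))%:R.
Proof.
case: eqVneq => [->|/psi_sum ->]; last by rewrite muln0.
rewrite muln1 (eq_bigr (fun=> 1)); first by rewrite sumr_const.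
by move=> x _; rewrite mulr0 psi0.
Qed.

(** Parseval: once the square is expanded, summation over m and n keeps only the pairs (i, j) on
    which s and t agree. With I the pairs of units, a fourth moment becomes an additive energy. *)
Lemma sum_norm_psi (I : finType) (P : {pred I}) (s t : I -> A) :
  \sum_m \sum_n `|\sum_(i in P) psi (m * s i + n * t i)| ^+ 2 =
  (#|A| ^ 2 * #|[set ij : I * I | [&& ij.1 \in P, ij.2 \in P,
     s ij.1 == s ij.2 & t ij.1 == t ij.2]]|)%:R.
Proof.
have -> : \sum_m \sum_n `|\sum_(i in P) psi (m * s i + n * t i)| ^+ 2 =
  \sum_(i in P) \sum_(j in P)
    (\sum_m psi (m * (s i - s j))) * (\sum_n psi (n * (t i - t j))).
  have E m n : `|\sum_(i in P) psi (m * s i + n * t i)| ^+ 2 =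
      \sum_(i in P) \sum_(j in P)
        psi (m * (s i - s j)) * psi (n * (t i - t j)).
    rewrite normCK rmorph_sum big_distrlr /=.
    apply: eq_bigr => i _; apply: eq_bigr => j _.
    by rewrite -psiN -!psiD; congr psi; ring.
  under eq_bigr => m _ do under eq_bigr => n _ do rewrite E.
  under eq_bigr => m _ do rewrite exchange_big /=.
  rewrite exchange_big /=; apply: eq_bigr => i _.
  under eq_bigr => m _ do rewrite exchange_big /=.
  rewrite exchange_big /=; apply: eq_bigr => j _.
  by rewrite big_distrlr.
rewrite pair_big_dep /= natrM.
rewrite (eq_bigr (fun ij : I * I => (#|A| ^ 2)%:R *
  ((s ij.1 == s ij.2) && (t ij.1 == t ij.2))%:R)); last first.
  move=> ij _; rewrite !psi_sumE !subr_eq0 -!natrM; congr (_%:R).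
  by case: (_ == _); case: (_ == _); rewrite ?muln1 ?muln0 // mulnn.
rewrite -mulr_sumr; congr (_ * _).
rewrite -natr_sum -sum1_card; congr (_%:R).
rewrite big_mkcond [RHS]big_mkcond /=; apply: eq_bigr => ij _.
by rewrite inE !andbA; case: (_ && _) => //=; case: (_ && _).
Qed.

Let prodU : {pred A * A} :=
  [pred x | (x.1 \is a GRing.unit) && (x.2 \is a GRing.unit)].

Lemma kloosterman_sqr m n : kloosterman m n ^+ 2 =
  \sum_(x in prodU) psi (m * (x.1 + x.2) + n * (x.1^-1 + x.2^-1)).
Proof.
rewrite expr2 big_distrlr /= pair_big /=.
apply: eq_bigr => -[x y] _ /=; rewrite -psiD; congr psi; ring.
Qed.

Definition triple_annihilators : {set A * A * A} :=
  [set t | 2%:R * t.1.1 * t.1.2 * t.2 == 0].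

Lemma card_prod_fiber (B : finType) (Z : {set B * A}) :
  #|Z| = (\sum_u #|[set x | (u, x) \in Z]|)%N.
Proof.
rewrite -sum1_card big_mkcond.
under [RHS]eq_bigr => u _ do rewrite -sum1_card big_mkcond.
rewrite pair_big /=; apply: eq_bigr => -[u x] _.
by rewrite inE.
Qed.

Lemma card_scale_fiber (a b : A) :
  (#|[set x | (a * x == b)%R]| <= #|[set x | (a * x == 0)%R]|)%N.
Proof.
case: (set_0Vmem [set x | (a * x == b)%R]) => [->|[y]]; first by rewrite cards0.
rewrite inE => /eqP ay.
rewrite -(card_imset _ (addIr (- y))); apply/subset_leq_card/fintype.subsetP => z.
by case/imsetP => x; rewrite !inE => /eqP ax ->; rewrite mulrBr ax ay subrr.
Qed.

(* With u = x1 - x3 and v = x1 - x4, the two equations of the additive energy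
   force (x1 + x2) u v = 0, where x1 + x2 = 2 x1 - u - v. *)
Lemma card_energy_le :
  (#|[set ij : (A * A) * (A * A) | [&& ij.1 \in prodU, ij.2 \in prodU,
      (ij.1.1 + ij.1.2 == ij.2.1 + ij.2.2)%R &
      (ij.1.1^-1 + ij.1.2^-1 == ij.2.1^-1 + ij.2.2^-1)%R]]|
    <= #|triple_annihilators|)%N.
Proof.
set E := [set ij | _].
pose g (ij : (A * A) * (A * A)) : A * A * A :=
  (ij.1.1 - ij.2.1, ij.1.1 - ij.2.2, ij.1.1).
have g_inj : {in E &, injective g}.
  move=> [[x1 x2] [x3 x4]] [[y1 y2] [y3 y4]]; rewrite !inE /=.
  move=> /and4P[_ _ /eqP xE _] /and4P[_ _ /eqP yE _] [e1 e2 e3]; subst y1.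
  have e4 : x3 = y3 by apply: oppr_inj; apply: (addrI x1).
  have e5 : x4 = y4 by apply: oppr_inj; apply: (addrI x1).
  by subst y3 y4; congr (_, _, _); apply: (addrI x1); rewrite xE yE.
rewrite -(card_in_imset g_inj).
(* For fixed (u, v) the energy equation is affine in x1, so it has at most as many solutions as its
   homogeneous part; [Z] keeps the inhomogeneous form. *)
pose Z := [set t : A * A * A |
  2%:R * t.1.1 * t.1.2 * t.2 == t.1.1 * t.1.2 * (t.1.1 + t.1.2)].
apply: (@leq_trans #|Z|).
  apply/subset_leq_card/fintype.subsetP => z /imsetP[[[x1 x2] [x3 x4]]].
  rewrite !inE /= => /and4P[/andP[u1 u2] /andP[u3 u4] /eqP sE /eqP tE] -> /=.
  have Ex2 : x2 = x3 + x4 - x1 by rewrite -sE; ring.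
  have : (x1 + x2) * (x3 * x4) = (x3 + x4) * (x1 * x2).
    have inv_sum (x y w : A) : x \is a GRing.unit -> y \is a GRing.unit ->
        (x + y) * w = (x^-1 + y^-1) * (x * y * w).
      move=> xU yU; transitivity ((x^-1 * x) * y * w + (y^-1 * y) * x * w).
        by rewrite !mulVr //; ring.
      by ring.
    rewrite (inv_sum x1) // tE (inv_sum x3) //; ring.
  move=> /eqP; rewrite -subr_eq0 => /eqP h.
  by apply/eqP/eqP; rewrite -subr_eq0 -h Ex2; apply/eqP; ring.
rewrite (card_prod_fiber Z) (card_prod_fiber triple_annihilators).
apply: leq_sum => -[u v] _.
have := card_scale_fiber (2%:R * u * v) (u * v * (u + v)).
by congr (_ <= _)%N; apply: eq_card => x; rewrite !inE.
Qed.

(** The substitution x -> u x. It places a copy of one sum at every frequency pair (m u, n / u). *)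
Lemma kloosterman_unit (m n u : A) : u \is a GRing.unit ->
  kloosterman (m * u) (n * u^-1) = kloosterman m n.
Proof.
move=> uU; rewrite [RHS](reindex_inj (mulrI uU)) /=.
apply: eq_big => [x|x xU]; first by rewrite unitrMr.
by rewrite invrM //; congr psi; ring.
Qed.

(** |K(m, n)|^4 occurs in the complete fourth moment at (m u, n / u) for each unit u. Two units can
    share such a pair only if m u agrees, so each copy is counted at most #{u : m u = 0} times; the
    moment itself is controlled by [card_energy_le]. *)
Lemma kloosterman_pow4_le (m n : A) :
  #|[pred u : A | u \is a GRing.unit]|%:R * `|kloosterman m n| ^+ 4 <=
  (#|[set u : A | (m * u == 0)%R]| * (#|A| ^ 2 * #|triple_annihilators|))%:R :> C.
Proof.
have total : \sum_a \sum_b `|kloosterman a b| ^+ 4 <=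
    (#|A| ^ 2 * #|triple_annihilators|)%:R.
  rewrite (eq_bigr (fun a => \sum_b
    `|\sum_(x in prodU) psi (a * (x.1 + x.2) + b * (x.1^-1 + x.2^-1))| ^+ 2)).
    by rewrite sum_norm_psi ler_nat leq_mul2l card_energy_le orbT.
  move=> a _; apply: eq_bigr => b _.
  by rewrite -kloosterman_sqr normrX -exprM.
rewrite natrM; apply: le_trans (ler_wpM2l (ler0n _ _) total).
rewrite mulr_natl -sumr_const.
rewrite (eq_bigr (fun u => `|kloosterman (m * u) (n * u^-1)| ^+ 4)); last first.
  by move=> u uU; rewrite kloosterman_unit.
rewrite (partition_big (fun u => m * u) predT) //= mulr_sumr.
apply: ler_sum => a _.
apply: (@le_trans _ _ (\sum_(u | (u \is a GRing.unit) && (m * u == a))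
   \sum_b `|kloosterman a b| ^+ 4)).
  apply: ler_sum => u /andP[_ /eqP ->].
  rewrite (bigD1 (n * u^-1)) //= lerDl.
  by apply: sumr_ge0 => b _; rewrite exprn_ge0.
rewrite sumr_const -[leLHS]mulr_natl ler_wpM2r //.
  by apply: sumr_ge0 => b _; rewrite exprn_ge0.
rewrite ler_nat; apply: leq_trans (card_scale_fiber m a).
by apply/subset_leq_card/fintype.subsetP => u; rewrite !inE => /andP[].
Qed.

Lemma kloostermanC m n : kloosterman m n = kloosterman n m.
Proof.
rewrite /kloosterman [RHS](reindex_inj invr_inj) /=.
by apply: eq_big => [x|x _]; rewrite ?unitrV // invrK addrC.
Qed.

End FiniteRingKloosterman.

(** * A trigonometric majorant *)

Section UnitCircle.
Local Open Scope complex_scope.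
Variable R : realType.
Implicit Types x y : R.

Definition expi x : R[i] := cos (pi *+ 2 * x) +i* sin (pi *+ 2 * x).

Lemma expiD x y : expi (x + y) = expi x * expi y.
Proof.
rewrite /expi mulrDr cosD sinD; apply/eqP; rewrite eq_complex /= eqxx /=.
by apply/eqP; ring.
Qed.

Lemma expi0 : expi 0 = 1.
Proof. by rewrite /expi mulr0 cos0 sin0. Qed.

Lemma expiN x : expi (- x) = Num.conj (expi x).
Proof.
rewrite [RHS](_ : _ = (expi x)^*%C) //.
rewrite /expi mulrN cosN sinN; apply/eqP; rewrite eq_complex /=.
by rewrite !eqxx.
Qed.

Lemma norm_expi x : `|expi x| = 1.
Proof. by rewrite normc_def /= cos2Dsin2 sqrtr1. Qed.

Lemma expiMn x n : expi (x *+ n) = expi x ^+ n.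
Proof. by elim: n => [|n IH]; rewrite ?mulr0n ?expi0 // mulrS exprS expiD IH. Qed.

Lemma expi_nat n : expi n%:R = 1.
Proof.
rewrite -[n%:R]/(1 *+ n) expiMn.
suff -> : expi 1 = 1 by rewrite expr1n.
by rewrite /expi mulr1 cos2pi sin2pi.
Qed.

Lemma sqr_norm_expiB1 x : `|1 - expi x| ^+ 2 = (2 - 2 * cos (pi *+ 2 * x))%:C.
Proof.
rewrite -add_Re2_Im2 /=; congr (_%:C).
have := cos2Dsin2 (pi *+ 2 * x) => h.
rewrite [RHS](_ : _ = (cos (pi *+ 2 * x) ^+ 2 + sin (pi *+ 2 * x) ^+ 2)
   + 1 - 2 * cos (pi *+ 2 * x)); last by rewrite h; ring.
ring.
Qed.

Lemma cos_gap (h x : R) : 0 <= h -> h <= x <= 1 - h ->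
  cos (pi *+ 2 * x) <= cos (pi *+ 2 * h).
Proof.
move=> h0 /andP[hx xh]; have p0 := pi_gt0 R.
wlog x2 : x hx xh / x <= 2^-1.
  move=> W; have [|x2] := leP x 2^-1; first exact: W.
  rewrite -[leLHS]cosN -(cosD2pi (- _)) (_ : _ + _ = pi *+ 2 * (1 - x)); last by ring.
  by apply: W; lra.
have m y : 0 <= y -> y <= 2^-1 -> pi *+ 2 * y \in `[0, pi].
  move=> y0 y2; rewrite in_itv /=; apply/andP; split; first by nra.
  rewrite mulr2n; nra.
have [->//|nx] := eqVneq x h.
have hx' : h < x by rewrite lt_def nx.
have pp : 0 < (pi : R) *+ 2 by rewrite mulr2n; lra.
have h2 : h <= 2^-1 by lra.
have x0 : 0 <= x by lra.
by apply: ltW; rewrite ltr_cos ?m // ltr_pM2l.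
Qed.

Lemma cos_lt1 (x : R) : 0 < x < 1 -> cos (pi *+ 2 * x) < 1.
Proof.
move=> /andP[x0 x1]; have p0 := pi_gt0 R.
pose h := Num.min x (1 - x) / 2.
have h1 : 0 < h by rewrite /h divr_gt0 // lt_min x0 subr_gt0.
have h2 : h * 2 <= x by rewrite /h divfK ?ge_min ?lexx.
have h3 : h * 2 <= 1 - x by rewrite /h divfK ?ge_min ?lexx ?orbT.
apply: (@le_lt_trans _ _ (cos (pi *+ 2 * h))).
  by apply: cos_gap; [exact: ltW|apply/andP; split; lra].
have pp : 0 < (pi : R) *+ 2 by rewrite mulr2n; lra.
have m0 : (0 : R) \in `[0, pi] by rewrite in_itv /= lexx ltW.
have mh : pi *+ 2 * h \in `[0, pi].
  by rewrite in_itv /= mulr2n; apply/andP; split; nra.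
by rewrite -[ltRHS]cos0 ltr_cos // mulr_gt0.
Qed.

Lemma expi_neq1 (x : R) : 0 < x < 1 -> expi x != 1.
Proof.
move=> /cos_lt1 h; apply/eqP => -[h' _].
by rewrite h' ltxx in h.
Qed.

Lemma expi_root_sum (Q j l : nat) : (j < Q)%N -> (l < Q)%N ->
  \sum_(k < Q) expi ((j%:R - l%:R) * (k%:R / Q%:R)) = (Q * (j == l))%:R.
Proof.
move=> jQ lQ; have Q0 : (0 < Q)%N by apply: leq_ltn_trans jQ.
have Q0' : (Q%:R : R) != 0 by rewrite pnatr_eq0 -lt0n.
have main (a b : nat) : (b < a)%N -> (a < Q)%N ->
    \sum_(k < Q) expi ((a%:R - b%:R) * (k%:R / Q%:R)) = 0.
  move=> ba aQ; set w := expi ((a%:R - b%:R) / Q%:R).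
  have w1 : w - 1 != 0.
    rewrite subr_eq0; apply: expi_neq1.
    rewrite -natrB ?(ltnW ba) // divr_gt0 ?ltr0n ?subn_gt0 //=.
    by rewrite ltr_pdivrMr ?ltr0n // mul1r ltr_nat (leq_ltn_trans (leq_subr _ _)).
  rewrite (eq_bigr (fun k : 'I_Q => w ^+ k)); last first.
    by move=> k _; rewrite -expiMn; congr expi; rewrite -mulr_natr; ring.
  apply: (mulfI w1); rewrite mulr0 -subrX1 -expiMn -[_ *+ Q]mulr_natr.
  rewrite divfK //.
  by rewrite -natrB ?(ltnW ba) // expi_nat subrr.
have [e|lj|jl] := ltngtP j l.
- rewrite muln0 -[LHS]conjCK rmorph_sum /=.
  rewrite (eq_bigr (fun k : 'I_Q => expi ((l%:R - j%:R) * (k%:R / Q%:R)))).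
    by rewrite main // conjC0.
  by move=> k _; rewrite -expiN; congr expi; ring.
- by rewrite muln0 main.
rewrite jl muln1 (eq_bigr (fun=> 1)) ?sumr_const ?card_ord //.
by move=> k _; rewrite subrr mul0r expi0.
Qed.

(** Q times the usual Fejer kernel: nonnegative, with frequencies j - l of absolute value below
    Q. *)
Definition fejer (Q : nat) x : R[i] :=
  `|\sum_(j < Q) expi (x *+ j)| ^+ 2.

Lemma fejerE Q x :
  fejer Q x = \sum_(j < Q) \sum_(l < Q) expi (x * (j%:R - l%:R)).
Proof.
rewrite /fejer normCK rmorph_sum big_distrlr /=.
apply: eq_bigr => j _; apply: eq_bigr => l _.
by rewrite -expiN -expiD -mulr_natr -[x *+ l]mulr_natr; congr expi; ring.
Qed.

Lemma fejer_ge0 Q x : 0 <= fejer Q x.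
Proof. exact: exprn_ge0. Qed.

(** Summing over the grid k/Q annihilates every frequency j - l other than 0, because |j - l| < Q.
    Divided by Q^2, the translates form a partition of unity. *)
Lemma fejer_total Q x : (0 < Q)%N ->
  \sum_(k < Q) fejer Q (x - k%:R / Q%:R) = (Q ^ 2)%:R.
Proof.
move=> Q0; under eq_bigr => k _ do rewrite fejerE.
rewrite exchange_big /=; under eq_bigr => j _ do rewrite exchange_big /=.
rewrite (eq_bigr (fun j : 'I_Q => \sum_(l < Q) (if l == j then Q%:R else 0))).
  rewrite (eq_bigr (fun=> Q%:R)) ?sumr_const ?card_ord.
    by rewrite -[_ *+ Q]mulr_natr -natrM mulnn.
  by move=> j _; rewrite -big_mkcond /= big_pred1_eq.
move=> j _; apply: eq_bigr => l _.
rewrite (eq_bigr (fun k : 'I_Q => expi (x * (j%:R - l%:R)) *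
   expi ((l%:R - j%:R) * (k%:R / Q%:R)))); last first.
  by move=> k _; rewrite -expiD; congr expi; ring.
rewrite -mulr_sumr expi_root_sum //.
rewrite -val_eqE /=; case: eqVneq => [->|]; last by rewrite muln0 mulr0.
by rewrite subrr mulr0 expi0 mul1r muln1.
Qed.

(** The geometric sum is |w^Q - 1| / |w - 1| with numerator at most 2, so the bound does not grow
    with Q. *)
Lemma fejer_tail Q (h x : R) : 0 < h -> h <= x <= 1 - h ->
  fejer Q x <= (4 / (2 - 2 * cos (pi *+ 2 * h)))%:C.
Proof.
move=> h0 hx; have k0 : 0 < 2 - 2 * cos (pi *+ 2 * h).
  have := @cos_lt1 h; rewrite h0 /= => /(_ _) H; rewrite subr_gt0.
  by rewrite -[ltRHS]mulr1 ltr_pM2l // H //; lra.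
set w := expi x.
have Ew : `|1 - w| ^+ 2 = (2 - 2 * cos (pi *+ 2 * x))%:C by exact: sqr_norm_expiB1.
have low : (2 - 2 * cos (pi *+ 2 * h))%:C <= `|1 - w| ^+ 2.
  by rewrite Ew lecR; have := cos_gap (ltW h0) hx; lra.
have w0 : 0 < `|1 - w| ^+ 2 by apply: lt_le_trans low; rewrite ltcR.
rewrite rmorphM /= fmorphV ler_pdivlMr ?ltcR //.
apply: le_trans (ler_wpM2l (fejer_ge0 Q x) low) _.
rewrite /fejer -exprMn -normrM mulrC.
rewrite (eq_bigr (fun j : 'I_Q => w ^+ j)); last by move=> j _; rewrite expiMn.
rewrite -opprB mulNr normrN -subrX1.
have : `|w ^+ Q - 1| <= 2.
  apply: le_trans (ler_normB _ _) _; rewrite normrX norm_expi expr1n normr1.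
  exact: lexx.
move=> le2; rewrite (_ : 4%:C = 2 ^+ 2); last by rewrite -[4]/(4%:R) rmorph_nat -natrX.
by rewrite lerXn2r // nnegrE.
Qed.

Lemma count_small (Q : nat) (r : R) : 0 <= r ->
  (\sum_(k < Q) (k%:R < r :> R)%R)%:R <= r + 1.
Proof.
move=> r0; pose m := (Num.truncn r).+1.
have rm : r < m%:R by exact: truncnS_gt.
have mr : m%:R <= r + 1 by rewrite -natr1 lerD2r truncn_le.
apply: le_trans mr; rewrite ler_nat.
rewrite -(big_mkord predT (fun k => (k%:R < r :> R)%R : nat)).
apply: (@leq_trans (\sum_(0 <= k < Q) (k < m)%N)).
  apply: leq_sum => k _; have [kr|] := ltP (k%:R : R) r; last by [].
  by rewrite -(ltr_nat R) (lt_trans kr rm).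
elim: Q => [|Q IH]; first by rewrite big_geq.
have [mQ|Qm] := leqP m Q.
  by rewrite big_nat_recr //= ltnNge mQ addn0.
apply: leq_trans Qm; rewrite -[leqRHS]subn0 -[leqRHS]muln1 -sum_nat_const_nat.
by apply: leq_sum => k _; case: (k < m)%N.
Qed.

Lemma count_large (Q : nat) (r : R) : 0 <= r ->
  (\sum_(k < Q) (Q%:R - r < k%:R :> R)%R)%:R <= r + 1.
Proof.
move=> r0; rewrite (reindex_inj rev_ord_inj) /=.
apply: le_trans (count_small Q r0); rewrite ler_nat.
apply: leq_sum => k _; case: ltP => // h; case: ltP => // k'.
have : (Q - k.+1)%:R <= Q%:R - (k%:R + 1) :> R by rewrite natrB // -natr1.
by lra.
Qed.

(* The trigonometric polynomial
   (1/Q^2) \sum_(k in A) fejer Q (x - k/Q), where the grid points k/Q left out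
   are at distance at least h from [0, 1/q] on the circle: it equals the total
   mass 1 minus a small tail. *)
Lemma trig_majorant (q : nat) (e : R) : (0 < q)%N -> 0 < e ->
  exists (Q : nat) (p : nat -> nat -> R[i]),
  let F x := \sum_(j < Q) \sum_(l < Q) p j l * expi (x * (j%:R - l%:R)) in
  [/\ forall x, 0 <= F x <= 1,
      forall x, 0 < x <= q%:R^-1 -> (1 - e)%:C <= F x,
      forall j l, `|p j l| <= 1 &
      0 <= \sum_(j < Q) p j j <= (q%:R^-1 + e)%:C].
Proof.
move=> q0 e0; pose h := Num.min (e / 4) 4^-1.
have h0 : 0 < h by rewrite lt_min divr_gt0 //= invr_gt0.
have he : h <= e / 4 by rewrite ge_min lexx.
have h4 : h <= 4^-1 by rewrite ge_min lexx orbT.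
pose kap := 2 - 2 * cos (pi *+ 2 * h).
have kap0 : 0 < kap.
  by have := @cos_lt1 h; rewrite /kap h0 /= => /(_ _) H; have := H ltac:(lra); lra.
(* The term 4 / (kap e) makes the discarded mass 4 / (kap Q) at most e; the term 4 / e absorbs the
   two rounding errors in the count of kept grid points. *)
pose Q := (Num.truncn (4 / (kap * e) + 4 / e)).+1.
have Qgt : 4 / (kap * e) + 4 / e < Q%:R by exact: truncnS_gt.
have Q0 : 0 < Q%:R :> R by rewrite ltr0n.
have Qe : 4 / Q%:R <= e.
  rewrite ler_pdivrMr // mulrC -ler_pdivrMr //; apply: ltW; apply: le_lt_trans Qgt.
  by rewrite lerDr divr_ge0 // mulr_ge0 // ltW.
have Qk : (4 / kap) / Q%:R <= e.
  rewrite ler_pdivrMr // -ler_pdivrMl //; apply: ltW; apply: le_lt_trans Qgt.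
  have -> : e^-1 * (4 / kap) = 4 / (kap * e) by rewrite invfM; ring.
  by rewrite lerDl divr_ge0 // ltW.
pose far (k : nat) : bool := (q%:R^-1 : R) + h <= k%:R / Q%:R <= 1 - h.
pose z : R[i] := (Q ^ 2)%:R^-1.
have z0 : 0 <= z by rewrite invr_ge0 ler0n.
pose p (j l : nat) := z * \sum_(k < Q | ~~ far k) expi (- (k%:R / Q%:R) * (j%:R - l%:R)).
exists Q, p => F.
have FE x : F x = z * \sum_(k < Q | ~~ far k) fejer Q (x - k%:R / Q%:R).
  rewrite /F /p; under eq_bigr => j _ do under eq_bigr => l _ do rewrite -mulrA.
  under eq_bigr => j _ do rewrite -mulr_sumr.
  rewrite -mulr_sumr; congr (_ * _).
  under [RHS]eq_bigr => k _ do rewrite fejerE.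
  rewrite [RHS]exchange_big /=; apply: eq_bigr => j _.
  rewrite [RHS]exchange_big /=; apply: eq_bigr => l _.
  rewrite mulr_suml; apply: eq_bigr => k _.
  by rewrite -expiD; congr expi; ring.
have Z1 : z * (Q ^ 2)%:R = 1 by rewrite mulVf // pnatr_eq0 expn_eq0.
have total x : F x + z * \sum_(k < Q | far k) fejer Q (x - k%:R / Q%:R) = 1.
  rewrite FE -mulrDr -[RHS]Z1 -(@fejer_total Q x) //.
  by rewrite [in RHS](bigID (fun k : 'I_Q => far k)) /= addrC.
have pos P x : 0 <= z * \sum_(k < Q | P k) fejer Q (x - k%:R / Q%:R).
  by rewrite mulr_ge0 // sumr_ge0 // => k _; exact: fejer_ge0.
have cz : (Q%:R / (Q ^ 2)%:R)%:C = z * Q%:R.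
  by rewrite rmorphM fmorphV !rmorph_nat mulrC.
have cz' : (Q%:R^-1)%:C = z * Q%:R.
  rewrite -cz; congr (_%:C); rewrite natrX expr2 invfM mulrA mulfV ?mul1r //.
  by rewrite gt_eqF.
split.
- move=> x; rewrite -(total x) lerDl pos andbT FE; exact: pos.
- move=> x /andP[x0 xq]; rewrite rmorphB rmorph1 -(total x) lerBlDr lerD2l.
  apply: (@le_trans _ _ (z * (\sum_(k < Q) (4 / kap)%:C))); last first.
    rewrite sumr_const card_ord -[_ *+ _]mulr_natl mulrA -cz' -rmorphM lecR.
    by rewrite mulrC.
  rewrite ler_wpM2l // [leLHS]big_mkcond; apply: ler_sum => k _.
  case: ifP => [/andP[k1 k2]|_]; last first.
    by rewrite lecR divr_ge0 // ltW.
  (* A discarded k/Q lies to the right of x; one period further, x - k/Q + 1 falls into [h, 1 - h],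
     where [fejer_tail] applies. *)
  have -> : fejer Q (x - k%:R / Q%:R) = fejer Q (x - k%:R / Q%:R + 1).
    rewrite !fejerE; apply: eq_bigr => j _; apply: eq_bigr => l _.
    rewrite [RHS](_ : _ = expi ((x - k%:R / Q%:R) * (j%:R - l%:R)) *
      (expi j%:R * expi (- l%:R))); last by rewrite -!expiD; congr expi; ring.
    by rewrite expiN !expi_nat conjC1 !mulr1.
  by apply: fejer_tail => //; apply/andP; split; lra.
- move=> j l; rewrite /p normrM (ger0_norm z0).
  apply: (@le_trans _ _ (z * Q%:R)); last first.
    rewrite -cz' lecR invf_le1 // ler1n //.
  rewrite ler_wpM2l //; apply: le_trans (ler_norm_sum _ _ _) _.
  rewrite big_mkcond; apply: (@le_trans _ _ (\sum_(k < Q) 1)).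
    by apply: ler_sum => k _; case: ifP => // _; rewrite norm_expi.
  by rewrite sumr_const card_ord.
(* Every p j j is the number of kept points over Q^2, so the diagonal sum is the proportion of kept
   points, at most 1/q + 2 h + 2/Q. *)
- rewrite (eq_bigr (fun=> z * (\sum_(k < Q) ~~ far k)%:R)); last first.
    move=> j _; rewrite /p; congr (_ * _).
    rewrite big_mkcond natr_sum; apply: eq_bigr => k _.
    by rewrite subrr mulr0 expi0; case: (far k).
  rewrite sumr_const card_ord -[_ *+ _]mulr_natr mulrAC -cz'.
  apply/andP; split; first by rewrite mulr_ge0 // lecR invr_ge0 ler0n.
  rewrite -(rmorph_nat (real_complex R) (\sum_(k < Q) ~~ far k)%N) -rmorphM lecR.
  rewrite ler_pdivrMl // mulrDr.
  set N := (X in X%:R <= _).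
  have : (N <= \sum_(k < Q) ((k%:R < Q%:R * (q%:R^-1 + h) :> R)%R : nat) +
       \sum_(k < Q) ((Q%:R - Q%:R * h < k%:R :> R)%R : nat))%N.
    rewrite -big_split /=; apply: leq_sum => k _.
    rewrite /far negb_and -!ltNge ltr_pdivrMr // ltr_pdivlMr // ![_ * Q%:R]mulrC.
    rewrite mulrBr mulr1; by do 2 case: (_ < _).
  rewrite -(ler_nat R) natrD => /le_trans; apply.
  have c1 := @count_small Q (Q%:R * (q%:R^-1 + h)).
  have c2 := @count_large Q (Q%:R * h).
  have q1 : 0 <= q%:R^-1 :> R by rewrite invr_ge0.
  have p1 : 0 <= Q%:R * (q%:R^-1 + h) by rewrite mulr_ge0 ?addr_ge0 // ltW.
  have p2 : 0 <= Q%:R * h by rewrite mulr_ge0 // ltW.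
  have := c1 p1; have := c2 p2.
  move: Qe; rewrite ler_pdivrMr // => Qe.
  have : Q%:R * h * 4 <= Q%:R * e by nra.
  by rewrite mulrDr; lra.
Qed.

End UnitCircle.

(** * Modular inverses in boxes *)

Section KloostermanBoxes.
Local Open Scope complex_scope.

(** Residues are represented by 1, ..., c and boxes are half open on the left, so that the q^2 boxes
    split the pairs of inverses exactly, also for c = 1. *)
Definition box_count (q c i j : nat) : nat :=
  (\sum_(1 <= a < c.+1) \sum_(1 <= d < c.+1)
    [&& a * d == 1 %[mod c], i * c < q * a <= i.+1 * c &
        j * c < q * d <= j.+1 * c])%N.

(** The cardinal of [triple_annihilators] for the integers mod c. Positive representatives keep 2 u
    v x nonzero, so that the moduli c dividing it can be counted by a divisor function. *)
Definition triple_count (c : nat) : nat :=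
  (\sum_(1 <= u < c.+1) \sum_(1 <= v < c.+1) \sum_(1 <= x < c.+1)
    (c %| 2 * u * v * x))%N.

Lemma sum_residues (c : nat) (G : nat -> nat) : G 0%N = G c ->
  (\sum_(1 <= u < c.+1) G u = \sum_(u < c) G u)%N.
Proof.
move=> G0; case: c G0 => [|c] G0; first by rewrite big_ord0 big_geq.
by rewrite big_nat_recr //= -G0 addnC -big_ltn // big_mkord.
Qed.

Section ResidueCharacter.
Variables (R : realType) (c : nat).
Let A := 'Z_c.+2.

(** The additive character e(x / n) of the integers mod n = c + 2; the shift is there because ['Z_n]
    has n elements only for n > 1. *)
Definition zchar (x : A) : R[i] := expi (x%:R / c.+2%:R : R).

Lemma zchar_nat (n : nat) : zchar n%:R = expi (n%:R / c.+2%:R : R).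
Proof.
rewrite /zchar val_Zp_nat //= [in RHS](divn_eq n c.+2) natrD natrM mulrDl.
by rewrite mulfK ?pnatr_eq0 // expiD expi_nat mul1r.
Qed.

Lemma zchar0 : zchar 0 = 1.
Proof. by rewrite /zchar mul0r expi0. Qed.

Lemma zcharD x y : zchar (x + y) = zchar x * zchar y.
Proof.
rewrite -(natr_Zp x) -(natr_Zp y) -natrD !zchar_nat natrD mulrDl.
exact: expiD.
Qed.

Lemma zcharN x : zchar (- x) = Num.conj (zchar x).
Proof.
have h : zchar (- x) * zchar x = 1 by rewrite -zcharD addNr zchar0.
have n1 : `|zchar x| = 1 by exact: norm_expi.
have n0 : zchar x != 0 by rewrite -normr_eq0 n1 oner_neq0.
apply: (mulIf n0); rewrite h mulrC -normCK n1 expr1n //.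
Qed.

Lemma zchar_sum y : y != 0 -> \sum_x zchar (x * y) = 0.
Proof.
move=> y0; have w1 : zchar y - 1 != 0.
  rewrite subr_eq0; apply: expi_neq1; rewrite divr_gt0 ?ltr0n ?lt0n //=.
  by rewrite ltr_pdivrMr ?ltr0n // mul1r ltr_nat ltn_ord.
apply: (mulfI w1); rewrite mulr0 mulrBl mul1r.
rewrite [X in _ - X](reindex_inj (addrI 1)) /= mulr_sumr -sumrB big1 // => x _.
by rewrite mulrDl mul1r zcharD subrr.
Qed.

Lemma card_triple : #|triple_annihilators A| = triple_count c.+2.
Proof.
rewrite -sum1_card big_mkcond /= /triple_count sum_residues; last first.
  apply: eq_bigr => v _; apply: eq_bigr => x _.
  by rewrite muln0 !mul0n dvdn0 -!mulnA mulnCA dvdn_mulr.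
transitivity (\sum_(u : A) \sum_(v : A) \sum_(x : A) (c.+2 %| 2 * u * v * x) : nat)%N.
  rewrite pair_big pair_big /=; apply: eq_bigr => -[[u v] x] _ /=.
  rewrite inE /=.
  have -> : (2%:R * u * v * x == 0) = (c.+2 %| 2 * u * v * x)%N.
    rewrite -[in LHS](natr_Zp u) -[in LHS](natr_Zp v) -[in LHS](natr_Zp x).
    by rewrite -!natrM -val_eqE /= val_Zp_nat.
  by case: (_ %| _)%N.
apply: eq_bigr => u _; rewrite sum_residues; last first.
  apply: eq_bigr => x _.
  by rewrite muln0 mul0n dvdn0 -mulnA [(c.+2 * x)%N]mulnC mulnA dvdn_mull.
apply: eq_bigr => v _; rewrite sum_residues // muln0 dvdn0.
by rewrite dvdn_mull.
Qed.

Lemma card_unit_Zp : #|[pred u : A | u \is a GRing.unit]| = totient c.+2.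
Proof.
rewrite totient_count_coprime big_mkord -sum1_card big_mkcond /=.
apply: eq_bigr => u _; rewrite -[in LHS](natr_Zp u) inE unitZpE //.
Qed.

(** For 0 <= u < c + 2 with c + 2 dividing n u, the quotient is below n and determines u. *)
Lemma card_annihilator (n : nat) : (0 < n)%N ->
  (#|[set u : A | (n%:R * u == 0)%R]| <= n)%N.
Proof.
move=> n0; pose f (u : A) : 'I_n.-1.+1 := inord (n * u %/ c.+2).
have E (u : A) : (n%:R * u == 0) = (c.+2 %| n * u)%N.
  by rewrite -[in LHS](natr_Zp u) -natrM -val_eqE /= val_Zp_nat.
rewrite -(@card_in_imset _ _ f); last first.
  move=> u v; rewrite !inE !E => du dv /(congr1 val) /=.
  have b (w : A) : (n * w %/ c.+2 < n.-1.+1)%N.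
    by rewrite prednK // ltn_divLR // ltn_pmul2l.
  rewrite !inordK // => e; apply/val_inj/eqP.
  by rewrite /= -(eqn_pmul2l n0) -(divnK du) e divnK.
by rewrite -[leqRHS](prednK n0) -[leqRHS]card_ord max_card.
Qed.

Definition kloos (m n : A) : R := complex.Re `|kloosterman zchar m n|.

Lemma kloosE m n : (kloos m n)%:C = `|kloosterman zchar m n|.
Proof. by rewrite /kloos normc_def. Qed.

Lemma kloos_ge0 m n : 0 <= kloos m n.
Proof. by rewrite /kloos normc_def; exact: sqrtr_ge0. Qed.

Lemma kloos_le_totient m n : kloos m n <= (totient c.+2)%:R.
Proof.
rewrite -lecR kloosE -card_unit_Zp rmorph_nat.
apply: le_trans (ler_norm_sum _ _ _) _.
rewrite (eq_bigr (fun=> 1)) ?sumr_const // => x _; exact: norm_expi.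
Qed.

Lemma kloos_pow4_le (m k : nat) n : (k < m)%N ->
  (totient c.+2)%:R * kloos (m%:R - k%:R) n ^+ 4 <=
  (m * (c.+2 ^ 2 * triple_count c.+2))%:R.
Proof.
move=> km; rewrite -lecR rmorphM rmorphXn /= kloosE !rmorph_nat.
rewrite -card_unit_Zp -card_triple.
apply: le_trans (kloosterman_pow4_le zchar0 zcharD zcharN zchar_sum _ _) _.
rewrite ler_nat leq_mul ?card_ord //.
rewrite -natrB; last exact: ltnW.
apply: (@leq_trans (m - k)%N); last exact: leq_subr.
by apply: card_annihilator; rewrite subn_gt0.
Qed.

Lemma kloos_opp m n : kloos (- m) (- n) = kloos m n.
Proof.
rewrite /kloos; congr complex.Re; rewrite -[RHS]norm_conjC; congr `|_|.
rewrite /kloosterman rmorph_sum; apply: eq_bigr => x _.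
rewrite [RHS](_ : _ = zchar (- (m * x + n / x))); last by rewrite zcharN.
by congr zchar; ring.
Qed.

(* If |K| > h c then (|K|/(h c))^3 and totient/(h c) both exceed 1. *)
Lemma kloos_bound (Q j l j' l' : nat) (h : R) : 0 < h ->
  (j < Q)%N -> (l < Q)%N -> (j' < Q)%N -> (l' < Q)%N ->
  ~~ ((j == l) && (j' == l')) ->
  kloos (j%:R - l%:R) (j'%:R - l'%:R) <=
  h * c.+2%:R + Q%:R * (triple_count c.+2)%:R / (h ^+ 4 * c.+2%:R ^+ 2).
Proof.
move=> h0 jQ lQ j'Q l'Q nd.
set K := kloos _ _; set Z := (triple_count _)%:R.
have K0 : 0 <= K by exact: kloos_ge0.
have c0 : 0 < c.+2%:R :> R by rewrite ltr0n.
have pow4 : (totient c.+2)%:R * K ^+ 4 <= Q%:R * (c.+2%:R ^+ 2 * Z).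
  (* The moment bound needs a nonzero first frequency; negating or exchanging the two frequencies
     reduces the other cases to it. *)
  have main (m k : nat) n : (k < m)%N -> (m < Q)%N ->
      (totient c.+2)%:R * kloos (m%:R - k%:R) n ^+ 4 <= Q%:R * (c.+2%:R ^+ 2 * Z).
    move=> km mQ; apply: le_trans (kloos_pow4_le n km) _.
    by rewrite -natrX -!natrM ler_nat leq_mul2r (ltnW mQ) orbT.
  have sym (a b : nat) n : a != b -> (a < Q)%N -> (b < Q)%N ->
      (totient c.+2)%:R * kloos (a%:R - b%:R) n ^+ 4 <= Q%:R * (c.+2%:R ^+ 2 * Z).
    case: (ltngtP a b) => // ab _ aQ bQ; last exact: main.
    by rewrite -kloos_opp opprB; apply: main.
  move: nd; rewrite negb_and => /orP[jl|jl]; first exact: sym.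
  by rewrite /K /kloos kloostermanC; apply: sym.
have Kphi : K <= (totient c.+2)%:R by exact: kloos_le_totient.
have hc0 : 0 < h * c.+2%:R by rewrite mulr_gt0.
have rest0 : 0 <= Q%:R * Z / (h ^+ 4 * c.+2%:R ^+ 2).
  by rewrite divr_ge0 ?mulr_ge0 ?exprn_ge0 // ltW.
have [Kle|Kgt] := leP K (h * c.+2%:R); first by rewrite ler_wpDr.
apply: ler_wpDl; first exact: ltW.
rewrite ler_pdivlMr ?mulr_gt0 ?exprn_gt0 //.
have c20 : 0 < c.+2%:R ^+ 2 :> R by rewrite exprn_gt0.
rewrite -(ler_pM2l c20); apply: le_trans (_ : _ <= (totient c.+2)%:R * K ^+ 4) _.
  have -> : c.+2%:R ^+ 2 * (K * (h ^+ 4 * c.+2%:R ^+ 2)) =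
     (h * c.+2%:R) * ((h * c.+2%:R) ^+ 3 * K) by ring.
  apply: ler_pM; [exact: ltW| |exact/ltW/(lt_le_trans Kgt)|].
    by apply: mulr_ge0 => //; apply: exprn_ge0; exact: ltW.
  rewrite [leRHS]exprSr; apply: ler_wpM2r => //.
  by apply: lerXn2r; rewrite ?nnegrE // ltW.
by rewrite [leRHS]mulrCA.
Qed.

Lemma zchar_scale (y : A) (j l : nat) :
  zchar ((j%:R - l%:R) * y) = expi ((y%:R / c.+2%:R : R) * (j%:R - l%:R)).
Proof.
rewrite mulrBl zcharD zcharN mulrBr expiD expiN.
have E (n : nat) : zchar (n%:R * y) = expi ((y%:R / c.+2%:R : R) * n%:R).
  rewrite -[in LHS](natr_Zp y) -natrM zchar_nat natrM.
  by congr expi; ring.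
by rewrite !E.
Qed.

Lemma box_count_units (q i j : nat) : box_count q c.+2 i j =
  (\sum_(x : A | x \is a GRing.unit)
    ((i * c.+2 < q * x^-1%R <= i.+1 * c.+2) &&
     (j * c.+2 < q * x <= j.+1 * c.+2)))%N.
Proof.
rewrite /box_count sum_residues; last first.
  apply: eq_bigr => d _.
  by rewrite mul0n mod0n modnMr.
transitivity (\sum_(a : A) \sum_(x : A) [&& (a * x == 1)%R,
   i * c.+2 < q * a <= i.+1 * c.+2 & j * c.+2 < q * x <= j.+1 * c.+2] : nat)%N.
  apply: eq_bigr => a _; rewrite sum_residues; last first.
    by rewrite muln0 mod0n modnMl.
  by apply: eq_bigr => x _; congr (nat_of_bool (_ && _)).
rewrite exchange_big /= [RHS]big_mkcond /=; apply: eq_bigr => x _.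
case: ifPn => [xU|xU].
  rewrite (bigD1 x^-1) //= mulVr // eqxx big1 ?addn0 // => a ax.
  case: eqP => // e; case/eqP: ax.
  by rewrite -[a]mulr1 -(mulrV xU) mulrA e mul1r.
rewrite big1 // => a _; case: eqP => // e.
by case/negP: xU; apply/unitrPr; exists a; rewrite mulrC.
Qed.

End ResidueCharacter.

(** (1 - e)^2 times the indicator of the box is at most the product of two translated majorants, one
    in x^-1 and one in x. The diagonal frequencies contribute the main term with the totient; each
    of the at most Q^4 others is a Kloosterman sum with a coefficient of modulus at most 1. *)
Lemma box_count_le (R : realType) (q : nat) (e : R) : (0 < q)%N -> 0 < e < 1 ->
  exists Q : nat, forall (h : R) (c i j : nat), 0 < h -> (i < q)%N -> (j < q)%N ->
  (1 - e) ^+ 2 * (box_count q c.+2 i j)%:R <=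
  (q%:R^-1 + e) ^+ 2 * (totient c.+2)%:R +
  (Q ^ 4)%:R * (h * c.+2%:R + Q%:R * (triple_count c.+2)%:R / (h ^+ 4 * c.+2%:R ^+ 2)).
Proof.
move=> q0 /andP[e0 e1]; have [Q [p]] := trig_majorant q0 e0.
set F := fun x => _; move=> [F01 Flow p1 psum]; exists Q => h c i j h0 iq jq.
pose A := 'Z_c.+2; set B := h * _ + _.
have c0 : 0 < c.+2%:R :> R by rewrite ltr0n.
have q0' : 0 < q%:R :> R by rewrite ltr0n.
pose X (x : A) k : R := x%:R / c.+2%:R - k%:R / q%:R.
have step1 : ((1 - e) ^+ 2 * (box_count q c.+2 i j)%:R)%:C <=
    \sum_(x : A | x \is a GRing.unit) F (X x^-1 i) * F (X x j).
  rewrite box_count_units natr_sum mulr_sumr rmorph_sum /=.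
  apply: ler_sum => x xU.
  have F0 y : 0 <= F y by case/andP: (F01 y).
  case: andP => [[/andP[b1 b2] /andP[b3 b4]]|_]; last by rewrite mulr0 mulr_ge0.
  rewrite mulr1 expr2 rmorphM.
  have e1' : 0 <= (1 - e)%:C by rewrite lecR subr_ge0 ltW.
  have inbox (y : A) k : (k * c.+2 < q * y)%N -> (q * y <= k.+1 * c.+2)%N ->
      0 < X y k <= q%:R^-1.
    move=> k1 k2; rewrite subr_gt0 lerBlDr.
    have -> : q%:R^-1 + k%:R / q%:R = k.+1%:R / q%:R :> R.
      by rewrite -natr1 mulrDl mul1r addrC.
    rewrite ltr_pdivrMr // mulrAC ltr_pdivlMr // ler_pdivrMr // mulrAC ler_pdivlMr //.
    rewrite -!natrM ltr_nat ler_nat [(y * q)%N]mulnC k1 /=.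
    by [].
  by apply: ler_pM => //; apply: Flow; exact: inbox.
pose T : finType := (('I_Q * 'I_Q) * ('I_Q * 'I_Q))%type.
pose P (t : T) : R[i] := p t.1.1 t.1.2 * p t.2.1 t.2.2 *
  (expi (- (i%:R / q%:R) * (t.1.1%:R - t.1.2%:R)) *
   expi (- (j%:R / q%:R) * (t.2.1%:R - t.2.2%:R))).
pose K (t : T) : R[i] :=
  kloosterman (@zchar R c) (t.2.1%:R - t.2.2%:R) (t.1.1%:R - t.1.2%:R).
have step2 : \sum_(x : A | x \is a GRing.unit) F (X x^-1 i) * F (X x j) =
    \sum_(t : T) P t * K t.
  under [RHS]eq_bigr => t _ do rewrite mulr_sumr.
  rewrite [RHS]exchange_big /=; apply: eq_bigr => x _.
  rewrite /F pair_big /= [X in _ * X]pair_big /= big_distrlr pair_big /=.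
  apply: eq_bigr => -[[j1 l1] [j2 l2]] _ /=.
  rewrite zcharD !zchar_scale /P /= /X !mulrBl !expiD !mulNr.
  ring.
pose D (t : T) := (t.1.1 == t.1.2) && (t.2.1 == t.2.2).
have diag : \sum_(t | D t) P t * K t <= ((q%:R^-1 + e) ^+ 2 * (totient c.+2)%:R)%:C.
  have -> : \sum_(t | D t) P t * K t =
      (\sum_(k < Q) p k k) ^+ 2 * (totient c.+2)%:R.
    rewrite (reindex_onto (fun k : 'I_Q * 'I_Q => ((k.1, k.1), (k.2, k.2)))
      (fun t => (t.1.1, t.2.1))) /=; last first.
      by move=> [[a b] [a' b']] /andP[/eqP /= -> /eqP /= ->].
    rewrite expr2 big_distrlr pair_big /= mulr_suml; apply: eq_big => [[k l]|[k l] _].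
      by rewrite /D /= !eqxx.
    rewrite /P /K /= !subrr !mulr0 expi0 !mulr1; congr (_ * _).
    rewrite /kloosterman (eq_bigr (fun=> 1)); last first.
      by move=> x _; rewrite !mul0r addr0 zchar0.
    by rewrite sumr_const card_unit_Zp.
  case/andP: psum => s0 s1.
  rewrite rmorphM rmorphXn rmorph_nat /= ler_wpM2r // lerXn2r // nnegrE.
  exact: le_trans s1.
have off : `|\sum_(t | ~~ D t) P t * K t| <= ((Q ^ 4)%:R * B)%:C.
  apply: le_trans (ler_norm_sum _ _ _) _.
  apply: (@le_trans _ _ (\sum_(t : T) B%:C)); last first.
    have cT : #|T| = (Q ^ 4)%N by rewrite !card_prod !card_ord !mulnn -expnM.
    by rewrite sumr_const rmorphM rmorph_nat mulr_natl -cT.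
  have B0 : 0 <= B%:C.
    rewrite lecR addr_ge0 ?divr_ge0 ?mulr_ge0 ?exprn_ge0 // ltW //.
  rewrite big_mkcond; apply: ler_sum => t _; case: ifP => // Dt.
  rewrite normrM -[leRHS]mul1r; apply: ler_pM => //.
    rewrite /P !normrM !norm_expi !mulr1 -[leRHS]mulr1; exact: ler_pM.
  rewrite /K -kloosE lecR; apply: kloos_bound => //.
  by rewrite andbC.
rewrite -lecR; apply: le_trans step1 _; rewrite step2 (bigID D) /= rmorphD.
(* The off-diagonal part may be bounded by its modulus only once it is known to be real; it is a
   difference of two reals. *)
have tot : \sum_(t : T) P t * K t \is Num.real.
  rewrite -step2; apply: ger0_real; apply: sumr_ge0 => x _.
  by rewrite mulr_ge0 //; [case/andP: (F01 (X x^-1 i))|case/andP: (F01 (X x j))].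
have dr : \sum_(t | D t) P t * K t \is Num.real.
  by rewrite (ler_real diag) complex_real.
apply: lerD => //; apply: le_trans off; apply: real_ler_norm.
have -> : \sum_(t | ~~ D t) P t * K t =
    \sum_(t : T) P t * K t - \sum_(t | D t) P t * K t.
  by rewrite [X in _ = X - _](bigID D) /= addrAC subrr add0r.
exact: rpredB.
Qed.

End KloostermanBoxes.

Local Open Scope classical_set_scope.
Local Open Scope ring_scope.

(** * Divisor sums and a sieve *)

Lemma sum_dvdn (g X : nat) : (0 < g)%N ->
  (\sum_(1 <= c < X.+1) (g %| c) = X %/ g)%N.
Proof.
move=> g0; elim: X => [|X IH]; first by rewrite big_geq // div0n.
by rewrite big_nat_recr //= IH divnS // addnC.
Qed.

Definition num_divisors (n : nat) := size (divisors n).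

(** A divisor d of m n is the product of gcd(d, m) and d / gcd(d, m), which divide m and n. *)
Lemma num_divisorsM (m n : nat) : (0 < m)%N -> (0 < n)%N ->
  (num_divisors (m * n) <= num_divisors m * num_divisors n)%N.
Proof.
move=> m0 n0; rewrite /num_divisors -(size_allpairs muln).
apply: uniq_leq_size (divisors_uniq _) _ => d.
rewrite -dvdn_divisors ?muln_gt0 ?m0 // => dmn.
have d0 : (0 < d)%N by apply: dvdn_gt0 dmn; rewrite muln_gt0 m0.
apply/allpairsP; exists (gcdn d m, d %/ gcdn d m)%N; split => /=.
- by rewrite -dvdn_divisors // dvdn_gcdr.
- rewrite -dvdn_divisors //.
  have g0 : (0 < gcdn d m)%N by rewrite gcdn_gt0 d0.
  rewrite -(@Gauss_dvdr _ (m %/ gcdn d m)).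
    rewrite -(dvdn_pmul2l g0) mulnA [(gcdn d m * (m %/ _))%N]mulnC.
    by rewrite divnK ?dvdn_gcdr // [(gcdn d m * _)%N]mulnC divnK ?dvdn_gcdl.
  rewrite /coprime -(eqn_pmul2l g0) muln_gcdr muln1.
  by rewrite ![(gcdn d m * _)%N]mulnC !divnK ?dvdn_gcdl ?dvdn_gcdr.
- by rewrite mulnC divnK // dvdn_gcdl.
Qed.

Lemma sum_dvdn_le (n X : nat) : (0 < n)%N ->
  (\sum_(1 <= c < X.+1) (c %| n) <= num_divisors n)%N.
Proof.
move=> n0; rewrite -big_mkcond /= sum1_count -size_filter.
apply: uniq_leq_size; first by rewrite filter_uniq // iota_uniq.
by move=> d; rewrite mem_filter -dvdn_divisors // => /andP[].
Qed.

Lemma sum_num_divisors (X : nat) :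
  (\sum_(1 <= k < X.+1) num_divisors k = \sum_(1 <= g < X.+1) X %/ g)%N.
Proof.
transitivity (\sum_(1 <= k < X.+1) \sum_(1 <= g < X.+1) (g %| k))%N.
  apply: eq_big_nat => k /andP[k0 kX].
  rewrite -big_mkcond /= sum1_count -size_filter; apply: perm_size.
  apply: uniq_perm; rewrite ?divisors_uniq ?filter_uniq ?iota_uniq // => d.
  rewrite -dvdn_divisors // mem_filter mem_index_iota.
  case dk: (d %| k)%N => //=.
  by rewrite (dvdn_gt0 k0 dk) ltnS (leq_trans (dvdn_leq k0 dk)).
rewrite exchange_big_nat /=; apply: eq_big_nat => g /andP[g0 _].
exact: sum_dvdn.
Qed.

(** For fixed u, v, x the moduli c are divisors of 2 u v x, so there are at most 2 d(u) d(v) d(x) of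
    them by submultiplicativity, the factor 2 being the number of divisors of 2. *)
Lemma sum_triple_count_le (X : nat) :
  (\sum_(1 <= c < X.+1) triple_count c <=
   2 * (\sum_(1 <= k < X.+1) num_divisors k) ^ 3)%N.
Proof.
pose S := (\sum_(1 <= k < X.+1) num_divisors k)%N.
have widen (c : nat) (G : nat -> nat) : (c <= X)%N ->
    (\sum_(1 <= u < c.+1) G u <= \sum_(1 <= u < X.+1) G u)%N.
  move=> cX; rewrite [leqRHS](@big_cat_nat _ _ _ c.+1) //=; exact: leq_addr.
apply: (@leq_trans (\sum_(1 <= c < X.+1) \sum_(1 <= u < X.+1)
   \sum_(1 <= v < X.+1) \sum_(1 <= x < X.+1) (c %| 2 * u * v * x))%N).
  rewrite [leqLHS]big_nat_cond [leqRHS]big_nat_cond.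
  apply: leq_sum => c; rewrite andbT ltnS => /andP[_ cX].
  apply: leq_trans (widen c _ cX) _; apply: leq_sum => u _.
  apply: leq_trans (widen c _ cX) _; apply: leq_sum => v _.
  exact: widen.
rewrite exchange_big_nat /=.
apply: (@leq_trans (\sum_(1 <= u < X.+1) \sum_(1 <= v < X.+1) \sum_(1 <= x < X.+1)
  2 * num_divisors u * num_divisors v * num_divisors x)%N).
  rewrite [leqLHS]big_nat_cond [leqRHS]big_nat_cond.
  apply: leq_sum => u; rewrite andbT => /andP[u0 _]; rewrite exchange_big_nat /=.
  rewrite [leqLHS]big_nat_cond [leqRHS]big_nat_cond.
  apply: leq_sum => v; rewrite andbT => /andP[v0 _]; rewrite exchange_big_nat /=.
  rewrite [leqLHS]big_nat_cond [leqRHS]big_nat_cond.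
  apply: leq_sum => x; rewrite andbT => /andP[x0 _].
  apply: leq_trans (sum_dvdn_le _ _) _; first by rewrite !muln_gt0 u0 v0 x0.
  have h2 : num_divisors 2 = 2%N by [].
  have u2 : (0 < 2 * u)%N by rewrite muln_gt0.
  have v2 : (0 < 2 * u * v)%N by rewrite muln_gt0 u2.
  apply: leq_trans (num_divisorsM v2 x0) _; rewrite leq_mul //.
  apply: leq_trans (num_divisorsM u2 v0) _; rewrite leq_mul //.
  by apply: leq_trans (num_divisorsM _ u0) _; rewrite ?h2.
rewrite -/S; under eq_bigr => u _.
  under eq_bigr => v _ do rewrite -big_distrr /= -/S.
  rewrite -big_distrl -big_distrr /= -/S; over.
rewrite -!big_distrl -big_distrr /= -/S.
by rewrite !expnS expn0 muln1 !mulnA.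
Qed.

Section RealEstimates.
Variable R : realType.

Lemma harmonic_le (X : nat) : (0 < X)%N ->
  \sum_(1 <= g < X.+1) (g%:R^-1 : R) <= 1 + ln X%:R.
Proof.
case: X => // X _; elim: X => [|X IH]; first by rewrite big_nat1 invr1 ln1 addr0.
rewrite big_nat_recr //=.
have x0 : 0 < X.+1%:R :> R by [].
have y0 : 0 < X.+2%:R :> R by [].
have h : ln (1 + - X.+2%:R^-1 : R) <= - X.+2%:R^-1.
  apply: le_ln1Dx; rewrite ltrN2 invf_lt1 // ltr1n //.
have e : 1 + - X.+2%:R^-1 = X.+1%:R / X.+2%:R :> R.
  have -> : X.+2%:R = X.+1%:R + 1 :> R by rewrite natr1.
  have z : X.+1%:R + 1 != 0 :> R by rewrite natr1 pnatr_eq0.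
  by field.
rewrite e ln_div ?posrE // in h.
move: IH h; set s := \sum_(_ <= _ < _) _; set u := _^-1.
set l1 := ln X.+1%:R; set l2 := ln X.+2%:R => IH h; lra.
Qed.

(** The divisor sum is O(X log X), so the triple counts sum to O(X^3 log^3 X). The trivial bound c^3
    for each c gives X^4, and any saving over it makes the moduli with many solutions rare. *)
Lemma sum_triple_count_small (e : R) : 0 < e -> exists X0 : nat,
  forall X, (X0 <= X)%N ->
  (\sum_(1 <= c < X.+1) triple_count c)%:R <= e * X%:R ^+ 4.
Proof.
(* With y = X^(1/4) one has 1 + ln X <= 5 y, and 250 = 2 * 5^3; the requirement is then 250 <= e
   y. *)
move=> e0; exists (Num.truncn ((250 / e) ^+ 4)).+1 => X XX.
have Xe : (250 / e) ^+ 4 < X%:R :> R.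
  by apply: lt_le_trans (truncnS_gt _) _; rewrite ler_nat.
have X0 : (0 < X)%N by apply: leq_ltn_trans XX.
have X1 : 1 <= X%:R :> R by rewrite ler1n.
pose y : R := Num.sqrt (Num.sqrt X%:R).
have y4 : y ^+ 4 = X%:R.
  by rewrite (exprM y 2 2) sqr_sqrtr ?sqrtr_ge0 // sqr_sqrtr.
have y1 : 1 <= y by rewrite /y -[leLHS]sqrtr1 ler_wsqrtr // -[leLHS]sqrtr1 ler_wsqrtr.
have y0 : 0 < y by lra.
have ye : 250 / e <= y.
  have d0 : 0 <= 250 / e by rewrite divr_ge0 ?ler0n ?(ltW e0).
  by rewrite -(@ler_pXn2r _ 4) ?nnegrE ?(ltW y0) // y4 ltW.
have S : (\sum_(1 <= k < X.+1) num_divisors k)%:R <= X%:R * (5 * y) :> R.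
  rewrite sum_num_divisors natr_sum.
  apply: (@le_trans _ _ (\sum_(1 <= g < X.+1) X%:R * g%:R^-1)).
    rewrite [leLHS]big_nat_cond [leRHS]big_nat_cond.
    apply: ler_sum => g; rewrite andbT => /andP[g0 _].
    by rewrite ler_pdivlMr ?ltr0n // -natrM ler_nat leq_divM.
  rewrite -mulr_sumr ler_pM2l ?ltr0n //; apply: le_trans (harmonic_le X0) _.
  have : ln (X%:R : R) <= 4 * y.
    have := ln_sublinear y0; rewrite -y4 lnXn // -[_ *+ 4]mulr_natl; lra.
  by lra.
apply: (@le_trans _ _ (2 * (X%:R * (5 * y)) ^+ 3)).
  apply: (@le_trans _ _ (2 * (\sum_(1 <= k < X.+1) num_divisors k)%:R ^+ 3)).
    by rewrite -natrX -natrM ler_nat sum_triple_count_le.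
  by rewrite ler_pM2l // lerXn2r ?nnegrE // ?mulr_ge0 // ?mulr_ge0 // ltW.
have -> : 2 * (X%:R * (5 * y)) ^+ 3 = X%:R ^+ 3 * (250 * y ^+ 3) by ring.
have -> : e * X%:R ^+ 4 = X%:R ^+ 3 * (e * y * y ^+ 3) by rewrite -y4; ring.
rewrite ler_pM2l ?exprn_gt0 ?ltr0n // ler_pM2r ?exprn_gt0 //.
by rewrite -ler_pdivrMl // mulrC.
Qed.

(** * Density of coprime pairs *)

Definition totient_sum (X : nat) : nat := (\sum_(1 <= c < X.+1) totient c)%N.

Definition coprime_pairs (X : nat) : nat :=
  (\sum_(1 <= c < X.+1) \sum_(1 <= d < X.+1) coprime c d)%N.

(** Coprime pairs are symmetric, and the only one on the diagonal is (1, 1), which twice the totient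
    sum counts twice. *)
Lemma coprime_pairsE (X : nat) : (0 < X)%N ->
  (coprime_pairs X).+1 = (2 * totient_sum X)%N.
Proof.
case: X => // X _; elim: X => [|X IH].
  by rewrite /coprime_pairs /totient_sum !big_nat1.
rewrite /totient_sum big_nat_recr //= -/(totient_sum X.+1) mulnDr -IH.
have T : (\sum_(1 <= d < X.+2) coprime X.+2 d = totient X.+2)%N.
  by rewrite totient_count_coprime [RHS]big_ltn.

rewrite /coprime_pairs big_nat_recr //=.
under eq_bigr => c _ do rewrite big_nat_recr //=.
rewrite big_split /= -/(coprime_pairs X.+1).
rewrite [in X in (_ + X)%N]big_nat_recr //= T.
rewrite (eq_bigr (fun c => coprime X.+2 c : nat)) => [|c _]; last first.
  by rewrite coprime_sym.
rewrite T [coprime X.+2 X.+2]/coprime gcdnn /=; lia.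
Qed.

Lemma sum_periodic (L Y : nat) (f : nat -> nat) :
  (forall c, f (c + L)%N = f c) ->
  (\sum_(1 <= c < (L * Y).+1) f c = Y * \sum_(1 <= c < L.+1) f c)%N.
Proof.
move=> fL; elim: Y => [|Y IH]; first by rewrite muln0 big_geq.
have fLY Z c : f (c + L * Z)%N = f c.
  elim: Z => [|Z IHZ]; first by rewrite muln0 addn0.
  by rewrite mulnS addnCA addnC fL IHZ.
rewrite (@big_cat_nat _ _ _ (L * Y).+1) //=; last by rewrite ltnS leq_mul2l leqnSn orbT.
rewrite IH mulSn addnC; congr addn.
rewrite -{1}[(L * Y).+1]add1n big_addn.
have -> : ((L * Y.+1).+1 - L * Y = L.+1)%N by rewrite mulnS; lia.
by apply: eq_bigr => c _; rewrite fLY.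
Qed.

(** [iota 2 k.-1] is the list 2, ..., k. The condition has period k! in c and in d and tightens to
    coprimality as k grows. *)
Definition sieved (k c d : nat) : bool :=
  all (fun g => ~~ ((g %| c) && (g %| d)))%N (iota 2 k.-1).

Definition sieved_pairs (k X : nat) : nat :=
  (\sum_(1 <= c < X.+1) \sum_(1 <= d < X.+1) sieved k c d)%N.

Lemma sievedP (k c d : nat) : reflect
  (forall g, (2 <= g <= k)%N -> (g %| c)%N -> (g %| d)%N -> False) (sieved k c d).
Proof.
apply: (iffP allP) => [H g gk gc gd|H g].
  have := H g; rewrite mem_iota gc gd => /(_ _)/negP; apply=> //; lia.
rewrite mem_iota => gk; apply/negP => /andP[gc gd].
by apply: (H g) gc gd; lia.
Qed.

Lemma coprime_sieved (k c d : nat) : coprime c d -> sieved k c d.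
Proof.
move=> /eqP cd; apply/sievedP => g /andP[g2 _] gc gd.
have : (g %| gcdn c d)%N by rewrite dvdn_gcd gc.
by rewrite cd dvdn1 => /eqP e; rewrite e in g2.
Qed.

Lemma coprime_pairs_le (k X : nat) : (coprime_pairs X <= sieved_pairs k X)%N.
Proof.
apply: leq_sum => c _; apply: leq_sum => d _.
by case cd: (coprime c d) => //; rewrite coprime_sieved.
Qed.

(** A pair that passes the sieve without being coprime has a gcd g with k < g <= X, and (X %/ g)^2
    pairs consist of multiples of g. *)
Lemma sieved_pairs_le (k X : nat) :
  (sieved_pairs k X <= coprime_pairs X + \sum_(k.+1 <= g < X.+1) (X %/ g) ^ 2)%N.
Proof.
have -> : (\sum_(k.+1 <= g < X.+1) (X %/ g) ^ 2 = \sum_(1 <= c < X.+1)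
    \sum_(1 <= d < X.+1) \sum_(k.+1 <= g < X.+1) ((g %| c) && (g %| d)))%N.
  under [RHS]eq_bigr => c _ do rewrite exchange_big_nat /=.
  rewrite [RHS]exchange_big_nat /=; apply: eq_big_nat => g /andP[g0 _].
  have g1 : (0 < g)%N by apply: leq_ltn_trans g0.
  rewrite -mulnn -sum_dvdn // big_distrlr /=; apply: eq_bigr => c _.
  by apply: eq_bigr => d _; rewrite mulnb.
rewrite -big_split /= [leqLHS]big_nat_cond [leqRHS]big_nat_cond.
apply: leq_sum => c; rewrite andbT => /andP[c1 cX].
rewrite -big_split /= [leqLHS]big_nat_cond [leqRHS]big_nat_cond.
apply: leq_sum => d; rewrite andbT => /andP[d1 dX].
case: sievedP => // S; case cd: (coprime c d) => //=.
pose g := gcdn c d.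
have gd : (0 < g)%N by rewrite gcdn_gt0 c1.
have g2 : (1 < g)%N by rewrite ltn_neqAle eq_sym gd andbT; move/negbT: cd.
have gX : (g < X.+1)%N.
  by apply: leq_ltn_trans cX; apply: dvdn_leq => //; exact: dvdn_gcdl.
have gk : (k < g)%N.
  rewrite ltnNge; apply/negP => gk; apply: (S g); rewrite ?g2 ?dvdn_gcdl ?dvdn_gcdr //.
rewrite (bigD1_seq g) ?mem_index_iota ?gk ?iota_uniq //=.
by rewrite dvdn_gcdl dvdn_gcdr.
Qed.

Lemma sieved_pairs_periodic (k Y : nat) :
  sieved_pairs k (k`! * Y) = (Y ^ 2 * sieved_pairs k k`!)%N.
Proof.
have gL g c : (2 <= g <= k)%N -> (g %| c + k`!)%N = (g %| c)%N.
  by move=> /andP[g2 gk]; rewrite dvdn_addl // dvdn_fact // gk ltnW.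
have s1 c d : sieved k (c + k`!) d = sieved k c d.
  by apply/sievedP/sievedP => H g gk; have := H g gk; rewrite gL.
have s2 c d : sieved k c (d + k`!) = sieved k c d.
  by apply/sievedP/sievedP => H g gk; have := H g gk; rewrite gL.
rewrite /sieved_pairs sum_periodic; last by move=> c; under eq_bigr do rewrite s1.
rewrite -mulnn -mulnA; congr muln; rewrite big_distrr /=.
apply: eq_bigr => c _; rewrite sum_periodic // => d; by rewrite s2.
Qed.

(** Comparison with the telescoping terms 1/(g - 1) - 1/g; the induction carries the sharper bound
    1/k - 1/X. *)
Lemma sum_inv_sqr_le (k X : nat) : (0 < k)%N ->
  \sum_(k.+1 <= g < X.+1) (g%:R ^- 2 : R) <= k%:R^-1.
Proof.
move=> k0; have [Xk|kX] := leqP X k; first by rewrite big_geq // invr_ge0.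
apply: (@le_trans _ _ (k%:R^-1 - X%:R^-1)); last by rewrite gerBl invr_ge0.
elim: X kX => // X IH; rewrite ltnS leq_eqVlt => /orP[/eqP <-|kX].
  have p : 0 < k%:R :> R by rewrite ltr0n.
  rewrite big_nat1 -natr1; set x := k%:R in p *.
  rewrite -subr_ge0; have -> : x^-1 - (x + 1)^-1 - (x + 1) ^- 2 =
    (x * (x + 1) ^+ 2)^-1 by field; lra.
  by rewrite invr_ge0 mulr_ge0 ?exprn_ge0; lra.
rewrite big_nat_recr /=; last by rewrite ltnW.
apply: le_trans (lerD (IH kX) (lexx _)) _.
have p : 0 < X%:R :> R by rewrite ltr0n; apply: leq_ltn_trans kX.
rewrite -[X.+1%:R]natr1; set x := X%:R in p *; rewrite -addrA lerD2l.
rewrite -subr_ge0; have -> : - (x + 1)^-1 - (- x^-1 + (x + 1) ^- 2) =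
    (x * (x + 1) ^+ 2)^-1 by field; lra.
by rewrite invr_ge0 mulr_ge0 ?exprn_ge0; lra.
Qed.

Lemma sieved_coprime_real (k X : nat) : (0 < k)%N ->
  (sieved_pairs k X)%:R - X%:R ^+ 2 / k%:R <= (coprime_pairs X)%:R :> R.
Proof.
move=> k0; rewrite lerBlDr.
apply: (@le_trans _ _ ((coprime_pairs X)%:R +
   (\sum_(k.+1 <= g < X.+1) (X %/ g) ^ 2)%:R)).
  by rewrite -natrD ler_nat sieved_pairs_le.
rewrite lerD2l natr_sum; apply: le_trans (ler_wpM2l (exprn_ge0 2 (ler0n R X)) (sum_inv_sqr_le X k0)).
rewrite mulr_sumr [leLHS]big_nat_cond [leRHS]big_nat_cond.
apply: ler_sum => g; rewrite andbT => /andP[kg _].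
have g0 : 0 < g%:R :> R by rewrite ltr0n; apply: leq_ltn_trans kg.
rewrite natrX -exprVn -exprMn lerXn2r ?nnegrE ?mulr_ge0 ?invr_ge0 //.
by rewrite ler_pdivlMr // -natrM ler_nat leq_divM.
Qed.

(** On multiples of L = k! the count is exactly u X^2 by periodicity; any X lies between two
    consecutive multiples, at a cost linear in X. *)
Lemma sieved_density (k : nat) : (0 < k)%N -> exists u C : R, forall X, (0 < X)%N ->
  `|(sieved_pairs k X)%:R - u * X%:R ^+ 2| <= C * X%:R.
Proof.
move=> k0; pose L := k`!; have L0 : (0 < L)%N := fact_gt0 k.
have L1 : 1 <= L%:R :> R by rewrite ler1n.
pose u : R := (sieved_pairs k L)%:R / L%:R ^+ 2.
have u0 : 0 <= u by rewrite divr_ge0 // exprn_ge0.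
have uL Y : (sieved_pairs k (L * Y))%:R = u * (L%:R * Y%:R) ^+ 2.
  rewrite sieved_pairs_periodic natrM natrX /u -/L; field; lra.
have u1 : u <= 1.
  rewrite ler_pdivrMr; last by apply: exprn_gt0; lra.
  rewrite mul1r.
  rewrite -natrX ler_nat -mulnn.
  apply: (@leq_trans (\sum_(1 <= c < L.+1) \sum_(1 <= d < L.+1) 1)%N).
    by apply: leq_sum => c _; apply: leq_sum => d _; case: sieved.
  by rewrite !sum_nat_const_nat !subn1 /= muln1.
have mono X X' : (X <= X')%N -> (sieved_pairs k X <= sieved_pairs k X')%N.
  move=> XX; rewrite /sieved_pairs [leqRHS](@big_cat_nat _ _ _ X.+1) //=.
  apply: leq_trans (leq_addr _ _); apply: leq_sum => c _.
  rewrite [leqRHS](@big_cat_nat _ _ _ X.+1) //=; exact: leq_addr.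
exists u, (3 * L%:R ^+ 2) => X X0.
have X1 : 1 <= X%:R :> R by rewrite ler1n.
pose Y := (X %/ L)%N.
have lo : (L * Y <= X)%N by rewrite mulnC leq_divM.
have hi : (X <= L * Y.+1)%N by rewrite mulnC ltnW // ltn_ceil.
have := mono _ _ lo; have := mono _ _ hi.
rewrite -(ler_nat R) uL => h2; rewrite -(ler_nat R) uL => h1.
move: lo hi; rewrite -!(ler_nat R) !natrM -[Y.+1%:R]natr1 mulrDr mulr1.
rewrite -[Y.+1%:R]natr1 mulrDr mulr1 in h2.
move: h1 h2; set z := L%:R * Y%:R; set l := L%:R in L1 *; set x := X%:R in X1 *.
set s := (sieved_pairs k X)%:R => h1 h2 lo hi.
have z0 : 0 <= z by rewrite mulr_ge0.
have e1 : u * (x ^+ 2 - z ^+ 2) <= x ^+ 2 - z ^+ 2.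
  by rewrite -[leRHS]mul1r ler_wpM2r // subr_ge0 lerXn2r ?nnegrE //; lra.
have e2 : u * ((z + l) ^+ 2 - x ^+ 2) <= (z + l) ^+ 2 - x ^+ 2.
  by rewrite -[leRHS]mul1r ler_wpM2r // subr_ge0 lerXn2r ?nnegrE //; lra.
rewrite mulrBr in e1; rewrite mulrBr in e2.
have f1 : (z + l) ^+ 2 - x ^+ 2 <= l * (2 * x + l).
  have -> : (z + l) ^+ 2 - x ^+ 2 = (z + l - x) * (z + l + x) by ring.
  by apply: ler_pM; lra.
have f2 : x ^+ 2 - z ^+ 2 <= l * (2 * x).
  have -> : x ^+ 2 - z ^+ 2 = (x - z) * (x + z) by ring.
  by apply: ler_pM; lra.
have f3 : l * (2 * x + l) <= 3 * l ^+ 2 * x.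
  have l2 : l <= l ^+ 2 by rewrite expr2 ler_peMr; lra.
  have f4 : l * x <= l ^+ 2 * x by apply: ler_wpM2r; lra.
  have f5 : l ^+ 2 <= l ^+ 2 * x by rewrite ler_peMr ?exprn_ge0; lra.
  by rewrite mulrDr -expr2; lra.
have f6 : 0 <= l * l by rewrite mulr_ge0; lra.
rewrite mulrDr in f1 f3; rewrite ler_norml; apply/andP; split; lra.
Qed.

End RealEstimates.

(** * Averages over the modulus *)

Lemma sum_itv_index (q c y : nat) : (0 < q)%N -> (0 < y <= c)%N ->
  (\sum_(i < q) (i * c < q * y <= i.+1 * c) = 1)%N.
Proof.
move=> q0 /andP[y0 yc]; have c0 : (0 < c)%N by apply: leq_trans yc.
pose i := ((q * y).-1 %/ c)%N.
have iq : (i < q)%N.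
  by rewrite ltn_divLR // prednK ?muln_gt0 ?q0 // leq_mul2l yc orbT.
rewrite (bigD1 (Ordinal iq)) //= big1 => [|k ki].
  have := divn_eq (q * y).-1 c; have := ltn_pmod (q * y).-1 c0.
  rewrite -/i mulSn; have : (0 < q * y)%N by rewrite muln_gt0 q0.
  by move=> *; rewrite addn0; case: andP => // -[]; split; lia.
apply/eqP; rewrite eqb0; apply/negP => /andP[k1 k2].
case/eqP: ki; apply: val_inj => /=.
have p : (0 < q * y)%N by rewrite muln_gt0 q0.
apply/eqP; rewrite eqn_leq; apply/andP; split.
  by rewrite /i leq_divRL //; lia.
by rewrite -ltnS /i ltn_divLR //; lia.
Qed.

Section BoxDensity.
Variable R : realType.

Lemma box_count_partition (q c : nat) : (0 < q)%N ->
  (\sum_(i < q) \sum_(j < q) box_count q c.+1 i j = totient c.+1)%N.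
Proof.
move=> q0; case: c => [|c].
  under eq_bigr => i _ do under eq_bigr => j _ do
    rewrite /box_count !big_nat1 [_ == _ %[mod 1]]eqxx /= -mulnb.
  under eq_bigr => i _ do rewrite -big_distrr /= sum_itv_index // muln1.
  by rewrite sum_itv_index.
under eq_bigr => i _ do under eq_bigr => j _ do rewrite box_count_units.
under eq_bigr => i _ do rewrite exchange_big /=.
rewrite exchange_big /= -(card_unit_Zp c) -sum1_card; apply: eq_bigr => x xU.
have itv (y : 'Z_c.+2) : y \is a GRing.unit -> (0 < y <= c.+2)%N.
  move=> yU; rewrite (ltnW (ltn_ord y)) andbT lt0n.
  by apply/eqP => y0; move: yU; have -> : y = 0 :> 'Z_c.+2 by [exact: val_inj]; rewrite unitr0.
under eq_bigr => i _ do under eq_bigr => j _ do rewrite -mulnb.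
under eq_bigr => i _ do rewrite -big_distrr /= sum_itv_index ?itv // muln1.
by rewrite sum_itv_index // itv ?unitrV.
Qed.

Lemma box_count_le_totient (q c i j : nat) : (i < q)%N -> (j < q)%N ->
  (box_count q c.+1 i j <= totient c.+1)%N.
Proof.
move=> iq jq; have q0 : (0 < q)%N by apply: leq_ltn_trans iq.
rewrite -(box_count_partition c q0) (bigD1 (Ordinal iq)) //=.
by rewrite (bigD1 (Ordinal jq)) //= -addnA leq_addr.
Qed.

Lemma totient_le (n : nat) : (0 < n)%N -> (totient n <= n)%N.
Proof.
move=> n0; rewrite totient_count_coprime big_mkord.
apply: (@leq_trans (\sum_(d < n) 1)%N); last by rewrite sum1_card card_ord.
by apply: leq_sum => d _; case: coprime.
Qed.

Lemma totient_sum_le (X : nat) : (totient_sum X <= X ^ 2)%N.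
Proof.
apply: (@leq_trans (\sum_(1 <= c < X.+1) X)%N).
  rewrite /totient_sum [leqLHS]big_nat_cond [leqRHS]big_nat_cond.
  apply: leq_sum => c; rewrite andbT ltnS => /andP[c0 cX].
  exact: leq_trans (totient_le c0) cX.
by rewrite sum_nat_const_nat subn1 /= mulnn.
Qed.

(** [coprime_pairs X] over X^2 is Cauchy: it is within 1/k of the sieved proportion, which has a
    limit for each k. The value rho is half the limit because coprime pairs count totients twice,
    and it is positive by a uniform lower bound 1/4. *)
Lemma totient_density : exists2 rho : R, 0 < rho & forall e, 0 < e ->
  exists X0 : nat, forall X, (X0 <= X)%N ->
  `|(totient_sum X)%:R - rho * X%:R ^+ 2| <= e * X%:R ^+ 2.
Proof.
pose v (X : nat) : R := (coprime_pairs X)%:R / X%:R ^+ 2.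
have vC : cvg (v @ \oo).
  apply: cauchy_cvg; apply: cauchy_exP => e e0.
  pose k := (Num.truncn (2 / e)).+1.
  have ke : 2 / e < k%:R by exact: truncnS_gt.
  have k0 : 0 < k%:R :> R by rewrite ltr0n.
  have [u [C uC]] := @sieved_density R k isT; exists u.
  exists (Num.truncn (2 * `|C| / e)).+1 => //= X XX.
  have X0 : (0 < X)%N by apply: leq_ltn_trans XX.
  have x0 : 0 < X%:R :> R by rewrite ltr0n.
  have Xe : 2 * `|C| / e < X%:R.
    by apply: lt_le_trans (truncnS_gt _) _; rewrite ler_nat.
  rewrite /ball /= /v.
  have := uC X X0; have := @sieved_coprime_real R k X isT.
  have : (coprime_pairs X)%:R <= (sieved_pairs k X)%:R :> R.
    by rewrite ler_nat coprime_pairs_le.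
  set B := (coprime_pairs X)%:R; set S := (sieved_pairs k X)%:R.
  set x := X%:R in x0 Xe * => BS SB SU.
  have x2 : 0 < x ^+ 2 by rewrite exprn_gt0.
  have -> : u - B / x ^+ 2 = (u * x ^+ 2 - B) / x ^+ 2 by field; lra.
  rewrite normrM [`|_^-1|]gtr0_norm ?invr_gt0 // ltr_pdivrMr //.
  have h1 : x ^+ 2 / k%:R < e / 2 * x ^+ 2.
    rewrite mulrC ltr_pM2r // -ltf_pV2 ?posrE ?invr_gt0 ?divr_gt0 //.
    by rewrite invrK invf_div.
  have h2 : C * x < e / 2 * x ^+ 2.
    rewrite expr2 mulrA ltr_pM2r //; apply: le_lt_trans (ler_norm C) _.
    by move: Xe; rewrite ltr_pdivrMr // mulrC; lra.
  have -> : u * x ^+ 2 - B = (S - B) - (S - u * x ^+ 2) by ring.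
  apply: le_lt_trans (ler_normB _ _) _.
  rewrite (ger0_norm (_ : 0 <= S - B)) ?subr_ge0 //; lra.
(* For k = 2 the sieve removes only the pairs of even numbers, at most X^2 / 4, and coprimality
   removes at most X^2 / 2 more. *)
have vlow (X : nat) : (0 < X)%N -> 4^-1 <= v X.
  move=> X0; have x0 : 0 < X%:R :> R by rewrite ltr0n.
  rewrite /v ler_pdivlMr ?exprn_gt0 //.
  apply: le_trans (@sieved_coprime_real R 2 X isT).
  have : (X ^ 2 <= sieved_pairs 2 X + (X %/ 2) ^ 2)%N.
    have -> : (X ^ 2 = \sum_(1 <= c < X.+1) \sum_(1 <= d < X.+1) 1)%N.
      by under eq_bigr => c _ do rewrite sum_nat_const_nat subn1 /= muln1;
         rewrite sum_nat_const_nat subn1 mulnn.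
    rewrite -mulnn -sum_dvdn // big_distrlr /= -big_split /=.
    apply: leq_sum => c _; rewrite -big_split /=; apply: leq_sum => d _.
    by rewrite /sieved /= andbT mulnb; case: (_ && _).
  rewrite -(ler_nat R) natrD !natrX => h.
  have : (X %/ 2)%:R <= X%:R / 2 :> R.
    by rewrite ler_pdivlMr // -natrM ler_nat leq_divM.
  have := ler0n R (X %/ 2); move: h; set y := (X %/ 2)%:R; set x := X%:R.
  set S := (sieved_pairs 2 X)%:R => h y0 yx.
  have : y ^+ 2 <= (x / 2) ^+ 2 by rewrite lerXn2r // nnegrE; lra.
  by rewrite expr_div_n; lra.
pose l := lim (v @ \oo).
have l0 : 4^-1 <= l.
  by apply: limr_ge => //; exists 1%N => //= X X0; exact: vlow.
exists (l / 2) => [|e e0]; first by lra.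
have /cvgrPdist_le /(_ _ e0) [X1 _ H] := vC.
exists (maxn X1 (Num.truncn e^-1).+1) => X; rewrite geq_max => /andP[XX Xe].
have X0 : (0 < X)%N by apply: leq_ltn_trans Xe.
have x0 : 0 < X%:R :> R by rewrite ltr0n.
have {}Xe : e^-1 < X%:R by apply: lt_le_trans (truncnS_gt _) _; rewrite ler_nat.
have := H X XX; rewrite -/l /v.
have : ((coprime_pairs X)%:R + 1 = 2 * (totient_sum X)%:R :> R).
  by rewrite -natrM -coprime_pairsE // -natr1.
set B := (coprime_pairs X)%:R; set F := (totient_sum X)%:R.
have x1 : 1 <= X%:R :> R by rewrite ler1n.
set x := X%:R in x0 Xe x1 * => BF h.
have x2 : 0 < x ^+ 2 by rewrite exprn_gt0.
have -> : F - l / 2 * x ^+ 2 = ((B / x ^+ 2 - l) * x ^+ 2 + 1) / 2.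
  have -> : F = (B + 1) / 2 by rewrite BF; field.
  by field; lra.
rewrite normrM [`|2^-1|]gtr0_norm // ler_pdivrMr //.
apply: le_trans (ler_normD _ _) _; rewrite normr1 normrM (gtr0_norm x2) distrC.
have : `|l - B / x ^+ 2| * x ^+ 2 <= e * x ^+ 2 by rewrite ler_pM2r.
have : 1 <= e * x ^+ 2.
  have ex : 1 < e * x by rewrite -ltr_pdivrMl // mulr1.
  have : e * x <= e * x ^+ 2 by rewrite ler_pM2l // expr2 ler_peMr // ltW.
  lra.
lra.
Qed.

Lemma sum_box_le (q i j X : nat) : (i < q)%N -> (j < q)%N ->
  (\sum_(1 <= c < X.+1) box_count q c i j <= X ^ 2)%N.
Proof.
move=> iq jq; apply: leq_trans (totient_sum_le X).
rewrite /totient_sum [leqLHS]big_nat_cond [leqRHS]big_nat_cond.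
apply: leq_sum => -[|c]; rewrite andbT //= => _; exact: box_count_le_totient.
Qed.

(** Summation of [box_count_le] over c. Moduli below m, about t X, are bounded trivially; beyond it
    1 / c^2 <= 1 / (t X)^2, so the averaged [triple_count], an o(X^4), contributes o(X^2). *)
Lemma sum_box_upper (q i j : nat) (e : R) : (i < q)%N -> (j < q)%N -> 0 < e ->
  exists X0 : nat, forall X, (X0 <= X)%N ->
  (\sum_(1 <= c < X.+1) box_count q c i j)%:R <=
  (totient_sum X)%:R / q%:R ^+ 2 + e * X%:R ^+ 2.
Proof.
wlog e1 : e / e <= 1.
  move=> W iq jq e0; have [le1|gt1] := leP e 1; first exact: W.
  have [X0 H] := W 1 (lexx _) iq jq ltr01; exists X0 => X XX.
  by apply: le_trans (H X XX) _; rewrite lerD2l; apply: ler_wpM2r; [exact: exprn_ge0|exact: ltW].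
move=> iq jq e0; have q0 : (0 < q)%N by apply: leq_ltn_trans iq.
(* With x = X^2 the losses are 5 d x = e x / 4 from the majorants, and e x / 10 each from the small
   moduli, the term in h and the triple counts. *)
pose d := e / 20; have d0 : 0 < d by rewrite divr_gt0.
have d01 : 0 < d < 1 by rewrite /d; lra.
have [Q HQ] := @box_count_le R q d q0 d01.
pose h := e / (10 * (Q%:R ^+ 4 + 1)).
have Q40 : 0 <= Q%:R ^+ 4 :> R by rewrite exprn_ge0.
have h0 : 0 < h by rewrite divr_gt0 // mulr_gt0 //; lra.
have Qh : Q%:R ^+ 4 * h <= e / 10.
  have Q1 : 0 < Q%:R ^+ 4 + 1 :> R by lra.
  have -> : Q%:R ^+ 4 * h = e / 10 * (Q%:R ^+ 4 / (Q%:R ^+ 4 + 1)).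
    by rewrite /h; field; lra.
  rewrite -[leRHS]mulr1 ler_wpM2l ?divr_ge0 ?(ltW e0) //.
  by rewrite ler_pdivrMr // mul1r lerDl.
pose t := e / 40; have t0 : 0 < t by rewrite divr_gt0.
pose e' := e / 10 * (h ^+ 4 * t ^+ 2) / (Q%:R ^+ 5 + 1).
have Q50 : 0 <= Q%:R ^+ 5 :> R by rewrite exprn_ge0.
have ht0 : 0 < h ^+ 4 * t ^+ 2 by rewrite mulr_gt0 // exprn_gt0.
have e'0 : 0 < e' by rewrite divr_gt0 ?mulr_gt0 ?divr_gt0 //; lra.
have Qe' : Q%:R ^+ 5 * e' / (h ^+ 4 * t ^+ 2) <= e / 10.
  rewrite ler_pdivrMr // /e' mulrA ler_pdivrMr; last lra.
  by rewrite mulrC ler_pM2l ?mulr_gt0 ?divr_gt0 //; lra.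
have [X1 HX1] := sum_triple_count_small e'0.
exists (maxn X1 (Num.truncn (2 / t)).+1) => X; rewrite geq_max => /andP[XX Xt].
have X0 : (0 < X)%N by apply: leq_ltn_trans Xt.
have {}Xt : 2 / t < X%:R by apply: lt_le_trans (truncnS_gt _) _; rewrite ler_nat.
have x0 : 0 < X%:R :> R by rewrite ltr0n.
(* m lies in (t X, 2 t X], and m >= 2 gives every c of the second range the form c' + 2. *)
pose m := (Num.truncn (t * X%:R)).+2.
have tX0 : 0 <= t * X%:R by rewrite mulr_ge0 // ltW.
have m1 : t * X%:R < m%:R.
  by apply: lt_trans (truncnS_gt _) _; rewrite ltr_nat.
have m2 : m%:R <= 2 * (t * X%:R).
  have : (Num.truncn (t * X%:R))%:R <= t * X%:R by rewrite truncn_le.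
  move: Xt; rewrite ltr_pdivrMr // /m -natr1 -natr1; lra.
have mX : (m <= X.+1)%N.
  have : m%:R <= X%:R :> R.
    apply: le_trans m2 _; rewrite mulrA -[leRHS]mul1r ler_wpM2r // /t; lra.
  by rewrite ler_nat => /leqW.
have [x x2] : {x | x = X%:R ^+ 2 :> R} by exists (X%:R ^+ 2).
have xp : 0 < x by rewrite x2 exprn_gt0.
rewrite -x2 (@big_cat_nat _ _ _ m) //= natrD.
have low : (\sum_(1 <= c < m) box_count q c i j)%:R <= e / 10 * x.
  apply: (@le_trans _ _ (m.-1 ^ 2)%:R); first by rewrite ler_nat sum_box_le.
  apply: (@le_trans _ _ (m%:R ^+ 2)); first by rewrite natrX lerXn2r ?nnegrE // ler_nat.
  apply: (@le_trans _ _ ((2 * (t * X%:R)) ^+ 2)).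
    by rewrite lerXn2r ?nnegrE // mulr_ge0.
  have -> : (2 * (t * X%:R)) ^+ 2 = (4 * t ^+ 2) * x by rewrite x2; ring.
  rewrite ler_wpM2r ?ltW // /t; nra.
set S : R := (\sum_(m <= c < X.+1) box_count q c i j)%:R.
have Sx : S <= x.
  rewrite x2 -natrX ler_nat; apply: leq_trans (sum_box_le X iq jq).
  by rewrite [leqRHS](@big_cat_nat _ _ _ m) //= leq_addl.
have S0 : 0 <= S by exact: ler0n.
have Fx : (totient_sum X)%:R <= x by rewrite x2 -natrX ler_nat totient_sum_le.
have F0 : 0 <= (totient_sum X)%:R :> R by [].
set F := (totient_sum X)%:R in Fx F0 *.
have key : (1 - d) ^+ 2 * S <= (q%:R^-1 + d) ^+ 2 * F + e / 10 * x + e / 10 * x.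
  apply: (@le_trans _ _ (\sum_(m <= c < X.+1)
    ((q%:R^-1 + d) ^+ 2 * (totient c)%:R + (Q ^ 4)%:R * (h * X%:R) +
     (Q%:R ^+ 5 / (h ^+ 4 * t ^+ 2 * x)) * (triple_count c)%:R))).
    rewrite /S natr_sum mulr_sumr [leLHS]big_nat_cond [leRHS]big_nat_cond.
    apply: ler_sum => c; rewrite andbT => /andP[mc cX].
    case: c mc cX => [|[|c]] // mc cX.
    apply: le_trans (HQ h c i j h0 iq jq) _; rewrite -addrA lerD2l mulrDr.
    have cx : c.+2%:R <= X%:R :> R by rewrite ler_nat.
    apply: lerD; first by rewrite ler_wpM2l // ler_wpM2l // ltW.
    have c2 : t ^+ 2 * x <= c.+2%:R ^+ 2.
      rewrite x2 -exprMn lerXn2r ?nnegrE //; apply: ltW.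
      by apply: lt_le_trans m1 _; rewrite ler_nat.
    have -> : (Q ^ 4)%:R * (Q%:R * (triple_count c.+2)%:R / (h ^+ 4 * c.+2%:R ^+ 2)) =
        Q%:R ^+ 5 / (h ^+ 4 * c.+2%:R ^+ 2) * (triple_count c.+2)%:R :> R.
      by rewrite natrX; ring.
    rewrite ler_wpM2r // ler_wpM2l // -mulrA lef_pV2 ?posrE; last 2 first.
    - by rewrite mulr_gt0 ?exprn_gt0.
    - by rewrite mulr_gt0 ?exprn_gt0 // mulr_gt0 ?exprn_gt0.
    by rewrite ler_pM2l ?exprn_gt0.
  rewrite big_split big_split /= -!mulr_sumr -!natr_sum.
  have sub (G : nat -> nat) : (\sum_(m <= c < X.+1) G c <= \sum_(1 <= c < X.+1) G c)%N.
    by rewrite [leqRHS](@big_cat_nat _ _ _ m) //= leq_addl.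
  apply: lerD; first apply: lerD.
  - by rewrite ler_wpM2l ?exprn_ge0 ?addr_ge0 ?invr_ge0 ?(ltW d0) // ler_nat sub.
  - rewrite sum_nat_const_nat; apply: (@le_trans _ _ ((Q ^ 4)%:R * (h * X%:R) * X%:R)).
      have lX : (X.+1 - m)%:R <= X%:R :> R by rewrite ler_nat /m subSS leq_subr.
      rewrite natrM -[leRHS]mulrA; apply: ler_wpM2l => //; rewrite -mulrA.
      by apply: ler_wpM2l; [exact: ltW|exact: ler_wpM2r].
    have -> : (Q ^ 4)%:R * (h * X%:R) * X%:R = Q%:R ^+ 4 * h * x.
      by rewrite x2 natrX; ring.
    by rewrite ler_wpM2r // ltW.
  - apply: (@le_trans _ _ (Q%:R ^+ 5 / (h ^+ 4 * t ^+ 2 * x) * (e' * X%:R ^+ 4))).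
      apply: ler_wpM2l; first by apply: divr_ge0 => //; apply: mulr_ge0; exact: ltW.
      apply: le_trans (HX1 X XX); rewrite ler_nat; exact: sub.
    have -> : Q%:R ^+ 5 / (h ^+ 4 * t ^+ 2 * x) * (e' * X%:R ^+ 4) =
        Q%:R ^+ 5 * e' / (h ^+ 4 * t ^+ 2) * x.
      have -> : X%:R ^+ 4 = x ^+ 2 by rewrite x2 -exprM.
      by field; rewrite !gt_eqF.
    by rewrite ler_wpM2r // ltW.
have dS : (1 - d) ^+ 2 * S >= S - 2 * d * x.
  have : 2 * d * S <= 2 * d * x by rewrite ler_wpM2l // mulr_ge0 // ltW.
  have : 0 <= d ^+ 2 * S by rewrite mulr_ge0 // exprn_ge0 // ltW.
  nra.
have q1 : q%:R^-1 <= 1 :> R by rewrite invf_le1 ?ltr0n // ler1n.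
have q2 : 0 < q%:R^-1 :> R by rewrite invr_gt0 ltr0n.
have dF : (q%:R^-1 + d) ^+ 2 * F <= F / q%:R ^+ 2 + 3 * d * x.
  have -> : (q%:R^-1 + d) ^+ 2 * F = F / q%:R ^+ 2 + (2 * q%:R^-1 + d) * d * F.
    by rewrite -exprVn; ring.
  rewrite lerD2l; apply: (@le_trans _ _ (3 * d * F)).
    rewrite ler_wpM2r // ler_wpM2r ?(ltW d0) //; lra.
  by rewrite ler_wpM2l // mulr_ge0 // ltW.
have dE : d * x = e / 20 * x by [].
by move: dS dF key low; nra.
Qed.

Lemma sum_box_partition (q X : nat) : (0 < q)%N ->
  (\sum_(i < q) \sum_(j < q) \sum_(1 <= c < X.+1) box_count q c i j =
   totient_sum X)%N.
Proof.
move=> q0; under eq_bigr => i _ do rewrite exchange_big /=.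
rewrite exchange_big /=; apply: eq_big_nat => -[|c] // _.
exact: box_count_partition.
Qed.

(** The q^2 boxes sum to the totient sum, and each stays below its share plus d X^2 with d = e /
    q^2. The slacks are nonnegative with total e X^2, so no single box falls short by more. *)
Lemma sum_box_asymp (q i j : nat) (e : R) : (i < q)%N -> (j < q)%N -> 0 < e ->
  exists X0 : nat, forall X, (X0 <= X)%N ->
  `|(\sum_(1 <= c < X.+1) box_count q c i j)%:R -
  (totient_sum X)%:R / q%:R ^+ 2| <= e * X%:R ^+ 2.
Proof.
move=> iq jq e0; have q0 : (0 < q)%N by apply: leq_ltn_trans iq.
have qp : 0 < q%:R :> R by rewrite ltr0n.
pose d := e / q%:R ^+ 2; have d0 : 0 < d by rewrite divr_gt0 ?exprn_gt0.
have /choice [N HN] : forall ij : 'I_q * 'I_q, exists X0 : nat, forall X, (X0 <= X)%N ->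
    (\sum_(1 <= c < X.+1) box_count q c ij.1 ij.2)%:R <=
    (totient_sum X)%:R / q%:R ^+ 2 + d * X%:R ^+ 2.
  by move=> [a b]; exact: sum_box_upper.
exists (\max_ij N ij)%N => X XX.
have up (a b : 'I_q) : (\sum_(1 <= c < X.+1) box_count q c a b)%:R <=
    (totient_sum X)%:R / q%:R ^+ 2 + d * X%:R ^+ 2.
  by apply: (HN (a, b)); apply: leq_trans XX; exact: leq_bigmax.
have dX : d * X%:R ^+ 2 <= e * X%:R ^+ 2.
  rewrite ler_wpM2r ?exprn_ge0 // ler_pdivrMr ?exprn_gt0 // ler_peMr ?(ltW e0) //.
  by rewrite exprn_ege1 // ler1n.
pose b (ij : 'I_q * 'I_q) : R := (\sum_(1 <= c < X.+1) box_count q c ij.1 ij.2)%:R.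
have part : \sum_ij b ij = (totient_sum X)%:R.
  rewrite -(sum_box_partition X q0) natr_sum -(pair_bigA _ (fun i j => b (i, j))) /=.
  by apply: eq_bigr => a _; rewrite natr_sum.
set F := (totient_sum X)%:R in up part *; set x := X%:R ^+ 2 in up dX *.
have slack : F / q%:R ^+ 2 + d * x - b (Ordinal iq, Ordinal jq) <= e * x.
  have -> : e * x = \sum_ij (F / q%:R ^+ 2 + d * x - b ij).
    rewrite sumrB part sumr_const card_prod card_ord -[X in X - _]mulr_natl natrM /d.
    by field; rewrite gt_eqF.
  rewrite (bigD1 (Ordinal iq, Ordinal jq)) //= lerDl.
  by apply: sumr_ge0 => -[k l] _; rewrite subr_ge0; exact: up.
have d1 : 0 <= d * x by rewrite mulr_ge0 ?exprn_ge0 // ltW.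
have := up (Ordinal iq) (Ordinal jq); move: slack; rewrite /b /= => h1 h2.
by rewrite ler_distl; apply/andP; split; lra.
Qed.

End BoxDensity.

(** * Counting matrices by trace *)

Lemma leq_sum_support (m n m' n' : nat) (F F' : nat -> nat) :
  (forall d, (m <= d < n)%N -> F d != 0%N -> (m' <= d < n')%N /\ (F d <= F' d)%N) ->
  (\sum_(m <= d < n) F d <= \sum_(m' <= d < n') F' d)%N.
Proof.
move=> H; pose B := maxn n n'.
have E k l (G : nat -> nat) : (l <= B)%N ->
    (\sum_(k <= d < l) G d = \sum_(0 <= d < B) (if (k <= d < l) then G d else 0))%N.
  move=> lB; rewrite -big_mkcond /= (big_nat_widen _ _ _ _ _ lB) /=.
  rewrite (big_nat_widenl _ 0) //=.
  by apply: eq_bigl => d; rewrite andbC.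
rewrite (E m) ?leq_maxl // (E m') ?leq_maxr //.
apply: leq_sum => d _; case: ifP => // md.
have [->|F0] := eqVneq (F d) 0%N; first by [].
by have [->] := H d md F0.
Qed.

(* The matrix (a, b; c, d) with b = (a d - 1) / c is in SL_2(Z), with positive
   entries and a <= c. *)
Definition farey_matrix (a c d : nat) : bool :=
  [&& 0 < a, a <= c, 0 < d, 1 < a * d & a * d == 1 %[mod c]]%N.

(** The cells are squares of side 1/q in the coordinates (a/c, d/c); j is unbounded since d may
    exceed c. *)
Definition in_cell (q i j a c d : nat) : bool :=
  (i * c < q * a <= i.+1 * c)%N && (j * c < q * d <= j.+1 * c)%N.

Section MatrixSums.
Variable R : realType.

(** The range of c is exhaustive: c <= b c < a d <= N^2, as b >= 1. *)
Definition matrix_sum (N : nat) (w : nat -> nat -> nat -> R) : R :=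
  \sum_(1 <= c < (N ^ 2).+1) \sum_(1 <= d < N.+1) \sum_(1 <= a < c.+1)
    if farey_matrix a c d && (a + d <= N)%N then w a c d else 0.

Lemma matrix_sumD N w w' :
  matrix_sum N (fun a c d => w a c d + w' a c d) = matrix_sum N w + matrix_sum N w'.
Proof.
rewrite /matrix_sum -big_split /=; apply: eq_bigr => c _.
rewrite -big_split /=; apply: eq_bigr => d _.
rewrite -big_split /=; apply: eq_bigr => a _.
by case: ifP => _; rewrite ?addr0.
Qed.

Lemma matrix_sumZ N k w :
  matrix_sum N (fun a c d => k * w a c d) = k * matrix_sum N w.
Proof.
rewrite /matrix_sum mulr_sumr; apply: eq_bigr => c _.
rewrite mulr_sumr; apply: eq_bigr => d _.
rewrite mulr_sumr; apply: eq_bigr => a _.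
by case: ifP => _; rewrite ?mulr0.
Qed.

Lemma matrix_sum_sum N (I : Type) (r : seq I) (P : pred I) (w : I -> nat -> nat -> nat -> R) :
  matrix_sum N (fun a c d => \sum_(i <- r | P i) w i a c d) =
  \sum_(i <- r | P i) matrix_sum N (w i).
Proof.
rewrite /matrix_sum [RHS]exchange_big /=; apply: eq_bigr => c _.
rewrite [RHS]exchange_big /=; apply: eq_bigr => d _.
rewrite [RHS]exchange_big /=; apply: eq_bigr => a _.
by case: ifP => _ //; rewrite big1.
Qed.

Lemma ler_matrix_sum N w w' :
  (forall a c d, farey_matrix a c d -> (a + d <= N)%N -> w a c d <= w' a c d) ->
  matrix_sum N w <= matrix_sum N w'.
Proof.
move=> H; apply: ler_sum => c _; apply: ler_sum => d _; apply: ler_sum => a _.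
by case: ifP => // /andP[]; exact: H.
Qed.

Lemma ler_norm_matrix_sum N w :
  `|matrix_sum N w| <= matrix_sum N (fun a c d => `|w a c d|).
Proof.
rewrite /matrix_sum; apply: le_trans (ler_norm_sum _ _ _) _; apply: ler_sum => c _.
apply: le_trans (ler_norm_sum _ _ _) _; apply: ler_sum => d _.
apply: le_trans (ler_norm_sum _ _ _) _; apply: ler_sum => a _.
by case: ifP => // _; rewrite normr0.
Qed.

(** d is invertible mod c and a is its inverse among 1, ..., c. Hence a sum over matrices is at most
    a sum over pairs (c, d). *)
Lemma farey_matrix_uniq (a a' c d : nat) :
  farey_matrix a c d -> farey_matrix a' c d -> a = a'.
Proof.
move=> /and5P[a0 ac d0 _ /eqP ad] /and5P[a'0 a'c _ _ /eqP a'd].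
wlog aa : a a' a0 ac ad a'0 a'c a'd / (a <= a')%N.
  by move=> W; case/orP: (leq_total a a') => ?; [|symmetry]; apply: W.
have cd : coprime c d.
  have [c1|c1] := leqP c 1.
    have -> : c = 1%N by lia.
    by rewrite coprime1n.
  rewrite coprime_sym /coprime -dvdn1 -(modn_small c1) -ad.
  rewrite -(dvdn_addr _ (dvdn_mull (a * d %/ c) (dvdn_gcdr d c))) -divn_eq.
  by rewrite dvdn_mull // dvdn_gcdl.
have : (c %| (a' - a) * d)%N.
  by rewrite mulnBl -eqn_mod_dvd ?leq_mul2r ?aa ?orbT // ad a'd.
rewrite Gauss_dvdl // => h.
by have [|p] := posnP (a' - a)%N; [lia|have := dvdn_leq p h; lia].
Qed.

Lemma matrix_sum_le2 N w (v : nat -> nat -> R) :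
  (forall c d, 0 <= v c d) ->
  (forall a c d, farey_matrix a c d -> (a + d <= N)%N -> w a c d <= v c d) ->
  matrix_sum N w <= \sum_(1 <= c < (N ^ 2).+1) \sum_(1 <= d < N.+1) v c d.
Proof.
move=> v0 H; apply: ler_sum => c _; apply: ler_sum => d _.
pose P a := farey_matrix a c d && (a + d <= N)%N.
have [/hasP[a ar Pa]|/hasPn noa] := boolP (has P (index_iota 1 c.+1)); last first.
  rewrite big_seq big1 // => a /noa; rewrite /P; case: ifP => //.
rewrite (bigD1_seq a) ?iota_uniq //= big1_seq ?addr0; last first.
  move=> a' /andP[a'a _]; case: ifP => // /andP[Pa' _].
  by case/andP: Pa => Pa _; rewrite (farey_matrix_uniq Pa Pa') eqxx in a'a.
by move: Pa; rewrite /P => /andP[P1 P2]; rewrite P1 P2; exact: H.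
Qed.

Lemma matrix_sum_small_c N C0 :
  matrix_sum N (fun a c d => (c < C0)%N%:R) <= C0%:R * N%:R.
Proof.
apply: le_trans (@matrix_sum_le2 N _ (fun c d => (c < C0)%N%:R) _ _) _ => //.
under eq_bigr => c _ do rewrite sumr_const_nat subn1 /= -[_ *+ N]mulr_natr.
rewrite -mulr_suml ler_wpM2r // -natr_sum ler_nat.
apply: (@leq_trans (\sum_(0 <= c < C0) 1)%N); last by rewrite sum_nat_const_nat subn0 muln1.
by apply: leq_sum_support => d _; case: (d < C0)%N.
Qed.

(** The edge y near 1: from K c < d <= N there are at most N / K choices for c. *)
Lemma matrix_sum_large_d N K : (0 < K)%N ->
  matrix_sum N (fun a c d => (K * c < d)%N%:R) <= N%:R ^+ 2 / K%:R.
Proof.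
move=> K0; apply: le_trans (@matrix_sum_le2 N _ (fun c d => (K * c < N)%N%:R) _ _) _ => //.
  move=> a c d /and5P[a0 _ _ _ _] adN; rewrite ler_nat.
  by case: (ltnP (K * c) d) => // h; rewrite (leq_trans h) //; lia.
under eq_bigr => c _ do rewrite sumr_const_nat subn1 /= -[_ *+ N]mulr_natr.
rewrite -mulr_suml expr2 mulrAC ler_wpM2r // ler_pdivlMr ?ltr0n // -natr_sum -natrM ler_nat.
apply: leq_trans (leq_divM N K); rewrite leq_mul2r; apply/orP; right.
apply: (@leq_trans (\sum_(1 <= c < (N %/ K).+1) 1)%N); last first.
  by rewrite sum_nat_const_nat subn1 muln1.
apply: leq_sum_support => c /andP[c1 _]; rewrite eqb0 negbK => h.
by rewrite h c1 ltnS leq_divRL // mulnC ltnW.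
Qed.

(** The corner (0, 0): up to N values of d for every c up to N^2, and only the weight, bounded by
    N^2 / c^2, makes the sum over c converge. *)
Lemma matrix_sum_large_c N K : (0 < K)%N -> (0 < N)%N ->
  matrix_sum N (fun a c d => if (K * N < c)%N then N%:R ^+ 2 / c%:R ^+ 2 else 0) <=
  N%:R ^+ 2 / K%:R.
Proof.
move=> K0 N0.
apply: le_trans (@matrix_sum_le2 N _ (fun c d =>
  if (K * N < c)%N then N%:R ^+ 2 / c%:R ^+ 2 else 0) _ _) _ => //.
  by move=> c d; case: ifP => // _; rewrite divr_ge0 // exprn_ge0.
under eq_bigr => c _ do rewrite sumr_const_nat subn1 /= -[_ *+ N]mulr_natr.
rewrite -mulr_suml.
have KN0 : (0 < K * N)%N by rewrite muln_gt0 K0.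
have Np : 0 < N%:R :> R by rewrite ltr0n.
have Kp : 0 < K%:R :> R by rewrite ltr0n.
apply: (@le_trans _ _ (N%:R ^+ 2 * (K * N)%:R^-1 * N%:R)); last first.
  by rewrite natrM invfM mulrA -mulrA mulVf ?mulr1 // gt_eqF.
rewrite ler_wpM2r //; apply: le_trans (ler_wpM2l (exprn_ge0 2 (ler0n R N))
  (@sum_inv_sqr_le R _ (N ^ 2) KN0)).
rewrite mulr_sumr.
have [h|h] := leqP (K * N).+1 (N ^ 2).+1; last first.
  rewrite [leRHS]big_geq //; last by rewrite ltnW.
  rewrite big_seq big1 // => c; rewrite mem_index_iota => /andP[_ c2].
  by case: ifP => // c3; lia.
rewrite (@big_cat_nat _ _ _ (K * N).+1) //= big_seq big1 ?add0r.
  rewrite [leLHS]big_seq [leRHS]big_seq; apply: ler_sum => c.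
  by rewrite mem_index_iota => /andP[c1 _]; rewrite c1.
by move=> c; rewrite mem_index_iota => /andP[_ c2]; case: ifP => // c3; lia.
Qed.

(** The edge y near 0, away from the corner: at most j0 c / q values of d for each c <= K N. *)
Lemma matrix_sum_small_d N K q j0 : (0 < q)%N ->
  matrix_sum N (fun a c d => ((c <= K * N) && (q * d <= j0 * c))%N%:R) <=
  j0%:R / q%:R * (K%:R * N%:R) ^+ 2.
Proof.
move=> q0.
apply: le_trans (@matrix_sum_le2 N _ (fun c d =>
  ((c <= K * N) && (q * d <= j0 * c))%N%:R) _ _) _ => //.
have qp : 0 < q%:R :> R by rewrite ltr0n.
apply: (@le_trans _ _ (\sum_(1 <= c < (K * N).+1) (j0%:R / q%:R * (K%:R * N%:R)))); last first.
  by rewrite sumr_const_nat subn1 /= -[_ *+ _]mulr_natr natrM -mulrA -expr2.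
apply: (@le_trans _ _ (\sum_(1 <= c < (N ^ 2).+1)
   (if (c < (K * N).+1)%N then j0%:R / q%:R * (K%:R * N%:R) else 0))).
  apply: ler_sum => c _; rewrite ltnS; case: leqP => [cKN|_]; last by rewrite big1.
  rewrite -natr_sum mulrAC ler_pdivlMr // -!natrM ler_nat.
  apply: (@leq_trans (q * ((j0 * c) %/ q))%N).
    rewrite mulnC leq_mul2l; apply/orP; right.
    apply: (@leq_trans (\sum_(1 <= d < ((j0 * c) %/ q).+1) 1)%N); last first.
      by rewrite sum_nat_const_nat subn1 muln1.
    apply: leq_sum_support => d /andP[d1 _]; rewrite /= eqb0 negbK => h.
    by rewrite h d1 ltnS leq_divRL // mulnC.
  apply: (@leq_trans (j0 * c)%N); first by rewrite mulnC leq_divM.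
  by rewrite leq_mul2l cKN orbT.
rewrite -big_mkcond /=.
have z0 : 0 <= j0%:R / q%:R * (K%:R * N%:R) :> R by rewrite !mulr_ge0 ?invr_ge0.
have E r (P : pred nat) (z : R) : \sum_(c <- r | P c) z = z * (\sum_(c <- r | P c) 1)%N%:R.
  by rewrite natr_sum mulr_sumr; apply: eq_bigr => c _; rewrite mulr1.
rewrite !E ler_wpM2l // ler_nat [X in (X <= _)%N]big_mkcond /=.
by apply: leq_sum_support => d /andP[d1 d2]; case: (d < (K * N).+1)%N => //; rewrite d1.
Qed.

(* Translating d by a multiple of c reduces the cell (i, j) to the cell
   (i, j mod q). *)
Lemma cell_count (q c i j : nat) : (0 < q)%N -> (0 < c)%N ->
  (\sum_(1 <= a < c.+1) \sum_(((j %/ q) * c).+1 <= d < ((j %/ q).+1 * c).+1)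
    ((a * d == 1 %[mod c]) && in_cell q i j a c d) =
   box_count q c i (j %% q))%N.
Proof.
move=> q0 c0; apply: eq_bigr => a _.
rewrite -{1}[((j %/ q) * c).+1]add1n big_addn.
have -> : (((j %/ q).+1 * c).+1 - (j %/ q) * c = c.+1)%N by rewrite mulSn; lia.
apply: eq_bigr => d _; rewrite /in_cell.
have -> : (a * (d + j %/ q * c) == 1 %[mod c]) = (a * d == 1 %[mod c]).
  by rewrite mulnDr mulnA addnC modnMDl.
have E k r : ((k * q + r) * c = q * (k * c) + r * c)%N.
  by rewrite mulnDl mulnA [(k * q)%N]mulnC.
have [-> ->] : (j * c = q * (j %/ q * c) + j %% q * c)%N /\
    (j.+1 * c = q * (j %/ q * c) + (j %% q).+1 * c)%N.
  by split; rewrite {1}(divn_eq j q) ?E // -addnS E.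
by rewrite mulnDr [(q * d + _)%N]addnC ltn_add2l leq_add2l.
Qed.

(** Inside a cell the condition a + d <= N is implied by c <= q N / (i + j + 2) and implies c <= q N
    / (i + j): the trace bound becomes a bound on c. *)
Lemma cell_bounds (q i j a c d : nat) : (0 < q)%N -> in_cell q i j a c d ->
  ((j %/ q) * c < d <= (j %/ q).+1 * c)%N /\
  ((i + j) * c < q * (a + d) <= (i + j).+2 * c)%N.
Proof.
move=> q0 /andP[/andP[k1 k2] /andP[k3 k4]]; split; apply/andP; split.
- rewrite ltnNge; apply/negP => h; have h' : (q * d <= q * (j %/ q * c))%N.
    by rewrite leq_mul2l h orbT.
  suff : (j * c < j * c)%N by rewrite ltnn.
  apply: leq_trans k3 (leq_trans h' _).
  by rewrite mulnA leq_mul2r mulnC leq_divM orbT.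
- rewrite -(leq_pmul2l q0); apply: leq_trans k4 _.
  by rewrite mulnA leq_mul2r mulnC ltn_ceil ?orbT.
- by rewrite mulnDl mulnDr; lia.
- by rewrite -addSn -addnS mulnDl mulnDr leq_add.
Qed.

Lemma matrix_sum_cell_le (N q i j : nat) : (0 < q)%N -> (0 < i + j)%N ->
  matrix_sum N (fun a c d => (in_cell q i j a c d)%:R) <=
  (\sum_(1 <= c < ((q * N) %/ (i + j)).+1) box_count q c i (j %% q))%:R.
Proof.
move=> q0 ij; rewrite /matrix_sum.
pose G a c d : nat := (farey_matrix a c d && (a + d <= N)%N && in_cell q i j a c d)%N.
apply: (@le_trans _ _ (\sum_(1 <= c < (N ^ 2).+1) \sum_(1 <= d < N.+1)
   \sum_(1 <= a < c.+1) G a c d)%N%:R).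
  rewrite natr_sum; apply: ler_sum => c _; rewrite natr_sum; apply: ler_sum => d _.
  by rewrite natr_sum; apply: ler_sum => a _; rewrite /G; case: ifP.
rewrite ler_nat; apply: leq_sum_support => c /andP[c1 _] nz.
have sup a d : (G a c d != 0%N) -> (c < ((q * N) %/ (i + j)).+1)%N /\
    (((j %/ q) * c).+1 <= d < ((j %/ q).+1 * c).+1)%N.
  rewrite /G eqb0 negbK => /andP[/andP[_ adN] /(cell_bounds q0)[dr /andP[s1 _]]].
  split=> //; rewrite ltnS leq_divRL // mulnC; apply: ltnW; apply: leq_trans s1 _.
  by rewrite leq_mul2l adN orbT.
have nzE : exists d a, G a c d != 0%N.
  apply/not_existsP => H; case/negP: nz; apply/eqP.
  rewrite big1 // => d _; rewrite big1 // => a _.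
  by apply/eqP; apply: contrapT => /negP G0; apply: (H d); exists a.
have [d0 [a0 /sup [cX _]]] := nzE; rewrite c1 cX; split => //.
rewrite -cell_count // exchange_big_nat /=; apply: leq_sum => a _.
apply: leq_sum_support => d _ /[dup] /sup [_ ->] _; split => //.
by rewrite /G; case: andP => // -[/andP[/and5P[_ _ _ _ ->] _] ->].
Qed.

(** The term q^2 pays for the moduli c < q. For c >= q and j > 0 the cell forces d > 1, hence a d >
    1 as [farey_matrix] requires. *)
Lemma matrix_sum_cell_ge (N q i j : nat) : (0 < q)%N -> (i < q)%N -> (0 < j)%N -> (q <= N)%N ->
  (\sum_(1 <= c < ((q * N) %/ (i + j).+2).+1) box_count q c i (j %% q))%:R
  - (q ^ 2)%:R <= matrix_sum N (fun a c d => (in_cell q i j a c d)%:R).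
Proof.
move=> q0 iq j0 qN; rewrite lerBlDr /matrix_sum.
pose G a c d : nat := (farey_matrix a c d && (a + d <= N)%N && in_cell q i j a c d)%N.
apply: (@le_trans _ _ ((\sum_(1 <= c < (N ^ 2).+1) \sum_(1 <= d < N.+1)
   \sum_(1 <= a < c.+1) G a c d)%N%:R + (q ^ 2)%:R)); last first.
  rewrite lerD2r.
  rewrite natr_sum; apply: ler_sum => c _; rewrite natr_sum; apply: ler_sum => d _.
  rewrite natr_sum; apply: ler_sum => a _; rewrite /G; by case: ifP.
rewrite -natrD ler_nat; set X := ((q * N) %/ _)%N.
apply: (@leq_trans (\sum_(1 <= c < X.+1) (if (q <= c)%N then box_count q c i (j %% q) else 0) +
   \sum_(1 <= c < q.-1.+1) box_count q c i (j %% q))%N).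
  apply: (@leq_trans (\sum_(1 <= c < X.+1) ((if (q <= c)%N then box_count q c i (j %% q) else 0) +
    (if (q <= c)%N then 0 else box_count q c i (j %% q))))%N).
    by apply: leq_sum => c _; case: ifP => _; rewrite ?addn0.
  rewrite big_split leq_add2l; apply: leq_sum_support => c /andP[c1 _].
  by case: (leqP q c) => // cq _; rewrite c1 prednK.
apply: leq_add; last first.
  apply: leq_trans (sum_box_le _ iq (ltn_pmod j q0)) _.
  by rewrite leq_exp2r // leq_pred.
apply: leq_sum_support => c /andP[c1 cX]; case: (leqP q c) => // qc nz; split.
  rewrite c1 ltnS; apply: (@leq_trans X); first by rewrite -ltnS.
  apply: (@leq_trans (q * N)); first by rewrite leq_div.
  by rewrite -mulnn leq_mul2r qN orbT.
rewrite -cell_count //.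
rewrite [X in (_ <= X)%N]exchange_big_nat /=; apply: leq_sum => a _.
apply: leq_sum_support => d _; rewrite eqb0 negbK => /andP[ad cell].
have [/andP[d1 _] /andP[_ s2]] := cell_bounds q0 cell.
have adN : (a + d <= N)%N.
  rewrite -(leq_pmul2l q0); apply: leq_trans s2 _.
  rewrite mulnC; apply: leq_trans (leq_divM _ (i + j).+2).
  by rewrite leq_mul2r -ltnS cX orbT.
have c0 : (0 < c)%N by [].
case/andP: (cell) => /andP[k1 k2] /andP[k3 k4].
have a0 : (0 < a)%N by move: k1; case: (a) => //; rewrite muln0.
have d0 : (0 < d)%N by move: d1; case: (d).
split; first by rewrite d0 ltnS; apply: leq_trans adN; exact: leq_addl.
have ac : (a <= c)%N.
  rewrite -(leq_pmul2l q0); apply: leq_trans k2 _.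
  by rewrite leq_mul2r iq orbT.
have d2 : (1 < d)%N.
  rewrite -(ltn_pmul2l q0) muln1; apply: leq_ltn_trans qc _.
  by apply: leq_ltn_trans k3; rewrite leq_pmull.
rewrite /G /farey_matrix a0 ac d0 ad adN cell /= !andbT.
by rewrite (leq_trans d2) // leq_pmull.
Qed.

End MatrixSums.

(** * Cell densities and the weight *)

Section WeightedCount.
Variables (R : realType) (rho : R).
Hypothesis rho0 : 0 < rho.
Hypothesis totient_rho : forall e, 0 < e -> exists X0 : nat, forall X, (X0 <= X)%N ->
  `|(totient_sum X)%:R - rho * X%:R ^+ 2| <= e * X%:R ^+ 2.

Lemma box_density (q i j : nat) (e : R) : (i < q)%N -> (j < q)%N -> 0 < e ->
  exists X0 : nat, forall X, (X0 <= X)%N ->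
  `|(\sum_(1 <= c < X.+1) box_count q c i j)%:R - rho / q%:R ^+ 2 * X%:R ^+ 2|
  <= e * X%:R ^+ 2.
Proof.
move=> iq jq e0; have q0 : (0 < q)%N by apply: leq_ltn_trans iq.
have e2 : 0 < e / 2 by rewrite divr_gt0.
have [X1 H1] := sum_box_asymp iq jq e2; have [X2 H2] := totient_rho e2.
exists (maxn X1 X2) => X; rewrite geq_max => /andP[XX1 XX2].
have := H1 X XX1; have := H2 X XX2.
set F := (totient_sum X)%:R; set B := (\sum_(_ <= _ < _) _)%:R; set x := X%:R ^+ 2.
move=> h2 h1; have -> : B - rho / q%:R ^+ 2 * x =
    (B - F / q%:R ^+ 2) + (F - rho * x) / q%:R ^+ 2 by field; rewrite pnatr_eq0 -lt0n.
apply: le_trans (ler_normD _ _) _; rewrite normrM.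
have : `|F - rho * x| * `|q%:R ^- 2| <= `|F - rho * x|.
  rewrite -[leRHS]mulr1 ler_wpM2l // ger0_norm ?invr_ge0 ?exprn_ge0 //.
  by rewrite invf_le1 ?exprn_gt0 ?ltr0n // exprn_ege1 // ler1n.
lra.
Qed.

(** For c up to X = q N / (i + j), [box_density] gives rho X^2 / q^2, in which q cancels. *)
Lemma cell_upper (q i j : nat) (e : R) : (i < q)%N -> (0 < j)%N -> 0 < e ->
  exists N0 : nat, forall N, (N0 <= N)%N ->
  matrix_sum N (fun a c d => (in_cell q i j a c d)%:R) <=
  (rho / (i + j)%:R ^+ 2 + e) * N%:R ^+ 2.
Proof.
move=> iq j0 e0; have q0 : (0 < q)%N by apply: leq_ltn_trans iq.
have qp : 0 < q%:R :> R by rewrite ltr0n.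
have e'0 : 0 < e / q%:R ^+ 2 by rewrite divr_gt0 ?exprn_gt0.
have [X0 H] := box_density iq (ltn_pmod j q0) e'0.
exists (X0 * (i + j))%N => N NN.
have ij : (0 < i + j)%N by rewrite addn_gt0 j0 orbT.
have sp : 0 < (i + j)%:R :> R by rewrite ltr0n.
have s1 : 1 <= (i + j)%:R :> R by rewrite ler1n.
apply: le_trans (@matrix_sum_cell_le R N q i j q0 ij) _.
set X := ((q * N) %/ (i + j))%N.
have XX : (X0 <= X)%N.
  by rewrite leq_divRL // (leq_trans NN) // leq_pmull.
have XN : X%:R <= q%:R * N%:R / (i + j)%:R :> R.
  by rewrite ler_pdivlMr // -!natrM ler_nat leq_divM.
have := H X XX; rewrite ler_distl => /andP[_ h]; apply: le_trans h _.
rewrite -mulrDl; apply: (@le_trans _ _ ((rho / q%:R ^+ 2 + e / q%:R ^+ 2) *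
  (q%:R * N%:R / (i + j)%:R) ^+ 2)).
  rewrite ler_wpM2l //; first by rewrite addr_ge0 // divr_ge0 ?exprn_ge0 // ltW.
  by rewrite lerXn2r ?nnegrE // divr_ge0 ?mulr_ge0.
have [s Es] : {s : R | s = (i + j)%:R} by exists (i + j)%:R.
clear XN; rewrite -!Es in sp s1 *; clear Es.
have -> : (rho / q%:R ^+ 2 + e / q%:R ^+ 2) * (q%:R * N%:R / s) ^+ 2 =
    (rho / s ^+ 2 + e / s ^+ 2) * N%:R ^+ 2.
  by field; rewrite !gt_eqF.
rewrite ler_wpM2r ?exprn_ge0 // lerD2l ler_pdivrMr ?exprn_gt0 //.
by rewrite ler_peMr ?(ltW e0) // exprn_ege1.
Qed.

Lemma cell_lower (q i j : nat) (e : R) : (i < q)%N -> (0 < j)%N -> 0 < e ->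
  exists N0 : nat, forall N, (N0 <= N)%N ->
  (rho / (i + j).+2%:R ^+ 2 - e) * N%:R ^+ 2 <=
  matrix_sum N (fun a c d => (in_cell q i j a c d)%:R).
Proof.
move=> iq j0 e0; have q0 : (0 < q)%N by apply: leq_ltn_trans iq.
have qp : 0 < q%:R :> R by rewrite ltr0n.
have q1 : 1 <= q%:R :> R by rewrite ler1n.
(* The second term keeps rho / q^2 - e' nonnegative, so that X^2 may be replaced by the smaller s^2
   - 2 s. *)
pose e' := Num.min (e / (2 * q%:R ^+ 2)) (rho / q%:R ^+ 2).
have e'0 : 0 < e'.
  by rewrite lt_min !divr_gt0 ?mulr_gt0 ?exprn_gt0.
have e'1 : e' <= e / (2 * q%:R ^+ 2) by rewrite ge_min lexx.
have e'2 : e' <= rho / q%:R ^+ 2 by rewrite ge_min lexx orbT.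
have [X0 H] := box_density iq (ltn_pmod j q0) e'0.
exists (maxn (X0 * (i + j).+2) (maxn q (Num.truncn (2 * (2 * rho + q%:R ^+ 2) / e)).+1)) => N.
rewrite !geq_max => /and3P[NN qN eN].
have N0 : (0 < N)%N by apply: leq_trans qN.
have {}eN : 2 * (2 * rho + q%:R ^+ 2) / e < N%:R.
  by apply: lt_le_trans (truncnS_gt _) _; rewrite ler_nat.
apply: le_trans (@matrix_sum_cell_ge R N q i j q0 iq j0 qN).
set X := ((q * N) %/ _)%N; have sp : 0 < (i + j).+2%:R :> R by [].
have s2 : 1 <= (i + j).+2%:R :> R by rewrite ler1n.
have XX : (X0 <= X)%N by rewrite leq_divRL // (leq_trans NN) // leq_pmull.
have := H X XX; rewrite ler_distl => /andP[h _].
have Np : 0 < N%:R :> R by rewrite ltr0n.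
have N1 : 1 <= N%:R :> R by rewrite ler1n.
pose s : R := q%:R * N%:R / (i + j).+2%:R.
have s0 : 0 < s by rewrite divr_gt0 ?mulr_gt0.
have Xs : s - 1 < X%:R.
  rewrite ltrBlDr natr1 /s ltr_pdivrMr // -!natrM ltr_nat ltn_ceil //.
have X2 : s ^+ 2 - 2 * s <= X%:R ^+ 2.
  have X0' : 0 <= X%:R :> R by [].
  have [s1|s1] := leP s 1; first by have : 0 <= X%:R ^+ 2 :> R; [exact: exprn_ge0|nra].
  have : (s - 1) ^+ 2 <= X%:R ^+ 2 by rewrite lerXn2r ?nnegrE ?subr_ge0 ?(ltW s1) ?(ltW Xs).
  by have -> : (s - 1) ^+ 2 = s ^+ 2 - 2 * s + 1 by [ring]; lra.
have A0 : 0 <= rho / q%:R ^+ 2 - e' by rewrite subr_ge0.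
apply: le_trans (lerD h (lexx _)); rewrite -mulrBl.
apply: le_trans (lerD (ler_wpM2l A0 X2) (lexx _)).
have sN : s <= q%:R * N%:R.
  by rewrite /s ler_pdivrMr // ler_peMr // mulr_ge0 // ltW.
have s2e : rho / q%:R ^+ 2 * s ^+ 2 = rho / (i + j).+2%:R ^+ 2 * N%:R ^+ 2.
  by rewrite /s; field; rewrite !gt_eqF.
have es2 : e' * s ^+ 2 <= e / 2 * N%:R ^+ 2.
  apply: (@le_trans _ _ (e / (2 * q%:R ^+ 2) * (q%:R * N%:R) ^+ 2)).
    apply: ler_pM; rewrite ?(ltW e'0) ?exprn_ge0 ?(ltW s0) //.
    by rewrite lerXn2r ?nnegrE ?(ltW s0) // mulr_ge0.
  by rewrite le_eqVlt; apply/orP; left; apply/eqP; field; rewrite gt_eqF.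
have rs : rho / q%:R ^+ 2 * (2 * s) <= 2 * rho * N%:R.
  apply: (@le_trans _ _ (rho / q%:R ^+ 2 * (2 * (q%:R * N%:R)))).
    by rewrite ler_wpM2l ?divr_ge0 ?exprn_ge0 ?(ltW rho0) // ler_wpM2l.
  have -> : rho / q%:R ^+ 2 * (2 * (q%:R * N%:R)) = (2 * rho * N%:R) / q%:R.
    by field; rewrite gt_eqF.
  by rewrite ler_pdivrMr // ler_peMr // !mulr_ge0 // ltW.
have es : 0 <= e' * (2 * s) by rewrite mulr_ge0 ?mulr_ge0 // ltW.
have fin : (2 * rho + q%:R ^+ 2) * N%:R <= e / 2 * N%:R ^+ 2.
  rewrite expr2 mulrA ler_pM2r //; move: eN; rewrite ltr_pdivrMr //; clear; lra.
have qq : (q ^ 2)%:R <= q%:R ^+ 2 * N%:R :> R by rewrite natrX ler_peMr // exprn_ge0.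
rewrite mulrBl mulrBr mulrBl -s2e; rewrite mulrDl in fin.
set P := rho / q%:R ^+ 2 * s ^+ 2 in s2e *; lra.
Qed.

Lemma in_cellE (q i j a c d : nat) : (0 < q)%N -> (0 < a)%N -> (0 < c)%N -> (0 < d)%N ->
  in_cell q i j a c d = (i == (q * a).-1 %/ c)%N && (j == (q * d).-1 %/ c)%N.
Proof.
move=> q0 a0 c0 d0.
have E k y : (0 < y)%N -> (k * c < q * y <= k.+1 * c)%N = (k == (q * y).-1 %/ c)%N.
  move=> y0; have p : (0 < q * y)%N by rewrite muln_gt0 q0.
  rewrite eqn_leq leq_divRL // -[X in _ = _ && X]ltnS ltn_divLR //.
  by case: (q * y)%N p => // n _ /=; rewrite ltnS.
by rewrite /in_cell !E.
Qed.

Variables (mu : nat -> R) (f : R -> R -> R) (M : R).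
Hypothesis mu01 : forall t, 0 <= mu t <= 1.
Hypothesis fM : forall x y, 0 <= x <= 1 -> 0 <= y <= 1 -> `|f x y| <= M.
Let h (x y : R) := (x + y - x * y) ^+ 2.
Let H (x y : R) := h x y * f x y.
Hypothesis Hunif : forall e, 0 < e -> exists2 r, 0 < r & forall x y x' y',
  0 <= x <= 1 -> 0 <= y <= 1 -> 0 <= x' <= 1 -> 0 <= y' <= 1 ->
  `|x - x'| <= r -> `|y - y'| <= r -> `|H x y - H x' y'| <= e.

(** Here [mu] is any function into [0, 1]. It becomes the smaller eigenvalue m for the trace a + d,
    and then c x + d = a + d - m gives x = (a - m) / c. *)
Definition fix_x (a c d : nat) : R := (a%:R - mu (a + d)) / c%:R.
Definition fix_y (a c d : nat) : R :=
  (d%:R - mu (a + d)) / (c%:R + d%:R - mu (a + d)).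

Lemma fix_estimates (a c d : nat) : (0 < a <= c)%N -> (0 < d)%N ->
  [/\ 0 <= fix_x a c d <= 1, 0 <= fix_y a c d <= 1,
      `|fix_x a c d - a%:R / c%:R| <= c%:R^-1,
      `|fix_y a c d - d%:R / (c%:R + d%:R)| <= c%:R^-1 &
      h (fix_x a c d) (fix_y a c d) <= (a + d)%:R ^+ 2 / c%:R ^+ 2].
Proof.
move=> /andP[a0 ac] d0; rewrite /fix_x /fix_y /h natrD.
have := mu01 (a + d); set m := mu _ => /andP[m0 m1].
have a1 : 1 <= a%:R :> R by rewrite ler1n.
have d1 : 1 <= d%:R :> R by rewrite ler1n.
have acR : a%:R <= c%:R :> R by rewrite ler_nat.
move: a1 d1 acR; set A := a%:R; set D := d%:R; set C := c%:R => a1 d1 ac1.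
have C0 : 0 < C by lra.
have CD0 : 0 < C + D - m by lra.
have CD1 : 0 < C + D by lra.
split.
- by rewrite divr_ge0 ?ler_pdivrMr //; lra.
- by rewrite divr_ge0 ?ler_pdivrMr //; lra.
- have -> : (A - m) / C - A / C = - (m / C) by field; rewrite gt_eqF.
  by rewrite normrN ger0_norm ?divr_ge0 ?(ltW C0) // ler_pdivrMr // mulVf ?gt_eqF.
- have -> : (D - m) / (C + D - m) - D / (C + D) = - (m * C / ((C + D - m) * (C + D))).
    by field; rewrite !gt_eqF.
  rewrite normrN ger0_norm; last by rewrite divr_ge0 ?mulr_ge0 // ltW.
  rewrite ler_pdivrMr ?mulr_gt0 // ler_pdivlMl // mulrA mulrAC.
  apply: (@le_trans _ _ (C * C)); first by rewrite ler_piMr // mulr_ge0 // ltW.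
  by apply: ler_pM; lra.
- have -> : (A - m) / C + (D - m) / (C + D - m) - (A - m) / C * ((D - m) / (C + D - m))
     = (A + D - 2 * m) / (C + D - m) by field; rewrite !gt_eqF.
  rewrite -expr_div_n lerXn2r ?nnegrE ?divr_ge0 //; try lra.
  rewrite ler_pdivrMr // mulrAC ler_pdivlMr //.
  apply: ler_pM; lra.
Qed.

Lemma weight_itv x y : 0 <= x <= 1 -> 0 <= y <= 1 -> 0 <= h x y <= 1.
Proof.
move=> /andP[x0 x1] /andP[y0 y1].
have -> : h x y = (1 - (1 - x) * (1 - y)) ^+ 2 by rewrite /h; congr (_ ^+ 2); ring.
have z0 : 0 <= (1 - x) * (1 - y) by rewrite mulr_ge0; lra.
have z1 : (1 - x) * (1 - y) <= 1 by nra.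
by rewrite exprn_ge0 /=; [apply: exprn_ile1|]; lra.
Qed.

End WeightedCount.

Lemma le_sum5 (R : realType) (t1 t2 t3 t4 t5 : R) :
  0 <= t1 -> 0 <= t2 -> 0 <= t3 -> 0 <= t4 -> 0 <= t5 ->
  [/\ t1 <= t1 + t2 + t3 + t4 + t5, t2 <= t1 + t2 + t3 + t4 + t5,
      t3 <= t1 + t2 + t3 + t4 + t5, t4 <= t1 + t2 + t3 + t4 + t5 &
      t5 <= t1 + t2 + t3 + t4 + t5].
Proof. by move=> *; split; lra. Qed.

(** * Asymptotics of the weighted matrix sum *)

Section WeightedAsymptotics.
Variables (R : realType) (rho : R).
Hypothesis rho0 : 0 < rho.
Hypothesis totient_rho : forall e, 0 < e -> exists X0 : nat, forall X, (X0 <= X)%N ->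
  `|(totient_sum X)%:R - rho * X%:R ^+ 2| <= e * X%:R ^+ 2.
Variables (mu : nat -> R) (f : R -> R -> R) (M : R).
Hypothesis mu01 : forall t, 0 <= mu t <= 1.
Hypothesis fM : forall x y, 0 <= x <= 1 -> 0 <= y <= 1 -> `|f x y| <= M.
Let h (x y : R) := (x + y - x * y) ^+ 2.
Let H (x y : R) := h x y * f x y.
Hypothesis Hunif : forall e, 0 < e -> exists2 r, 0 < r & forall x y x' y',
  0 <= x <= 1 -> 0 <= y <= 1 -> 0 <= x' <= 1 -> 0 <= y' <= 1 ->
  `|x - x'| <= r -> `|y - y'| <= r -> `|H x y - H x' y'| <= e.

Let fix_x := fix_x mu.
Let fix_y := fix_y mu.
Let G (a c d : nat) : R := H (fix_x a c d) (fix_y a c d).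

Lemma H_bound x y : 0 <= x <= 1 -> 0 <= y <= 1 -> `|H x y| <= M * h x y.
Proof.
move=> x01 y01; have /andP[h0 _] := weight_itv x01 y01.
by rewrite /H normrM (ger0_norm h0) mulrC ler_wpM2r // fM.
Qed.

Let node (q j : nat) : R := j%:R / (q%:R + j%:R).

(** The map t -> t / (1 + t) contracts, so the cell keeps its size 1/q when d/c becomes d/(c + d).
    One half of r is for the cell, the other for the distance 1/c from the fixed point. *)
Lemma cell_near (q i j a c d : nat) (r : R) : (0 < q)%N -> (0 < a)%N -> (a <= c)%N ->
  (0 < d)%N -> in_cell q i j a c d -> q%:R^-1 <= r / 2 -> c%:R^-1 <= r / 2 ->
  `|fix_x a c d - i%:R / q%:R| <= r /\ `|fix_y a c d - node q j| <= r.
Proof.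
move=> q0 a0 ac d0 /andP[/andP[k1 k2] /andP[k3 k4]] qr cr.
have c0 : (0 < c)%N by apply: leq_trans ac.
have [_ _ ex ey _] := @fix_estimates R mu mu01 a c d (introT andP (conj a0 ac)) d0.
have qp : 0 < q%:R :> R by rewrite ltr0n.
have cp : 0 < c%:R :> R by rewrite ltr0n.
move: k1 k2 k3 k4; rewrite -!(ltr_nat R) -!(ler_nat R) !natrM -![_.+1%:R]natr1.
move: (ler0n R i) (ler0n R j) (ler0n R d).
rewrite /node; set I := i%:R; set J := j%:R; set A := a%:R in ex *; set D := d%:R in ey *.
move: ex ey qr cr; set C := c%:R in cp *; set Q := q%:R in qp * => ex ey qr cr I0 J0 D0 k1 k2 k3 k4.
have dx : `|A / C - I / Q| <= Q^-1.
  have -> : A / C - I / Q = (Q * A - I * C) / (C * Q) by field; rewrite !gt_eqF.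
  rewrite ger0_norm; last by rewrite divr_ge0 ?mulr_ge0 ?(ltW cp) ?(ltW qp) // subr_ge0 ltW.
  rewrite ler_pdivrMr ?mulr_gt0 // mulrCA mulVf ?gt_eqF // mulr1; lra.
have dy : `|D / (C + D) - J / (Q + J)| <= Q^-1.
  have CD : 0 < C + D by lra.
  have QJ : 0 < Q + J by lra.
  have -> : D / (C + D) - J / (Q + J) = (Q * D - J * C) / ((C + D) * (Q + J)).
    by field; rewrite !gt_eqF.
  rewrite ger0_norm; last by rewrite divr_ge0 ?mulr_ge0 ?(ltW CD) ?(ltW QJ) // subr_ge0 ltW.
  rewrite ler_pdivrMr ?mulr_gt0 // ler_pdivlMl // .
  apply: (@le_trans _ _ (Q * C)); first by rewrite ler_pM2l //; lra.
  by rewrite [leRHS]mulrC; apply: ler_pM => //; rewrite ?(ltW qp) ?(ltW cp) //; lra.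
split.
  have -> : fix_x a c d - I / Q = (fix_x a c d - A / C) + (A / C - I / Q) by ring.
  by apply: le_trans (ler_normD _ _) _; lra.
have -> : fix_y a c d - J / (Q + J) =
  (fix_y a c d - D / (C + D)) + (D / (C + D) - J / (Q + J)) by ring.
by apply: le_trans (ler_normD _ _) _; lra.
Qed.

Lemma grid01 (q i : nat) : (0 < q)%N -> (i <= q)%N -> 0 <= (i%:R / q%:R : R) <= 1.
Proof.
move=> q0 iq; rewrite divr_ge0 //= ler_pdivrMr ?ltr0n // mul1r ler_nat //.
Qed.

Lemma node01 (q j : nat) : (0 < q)%N -> 0 <= node q j <= 1.
Proof.
move=> q0; have qp : 0 < q%:R :> R by rewrite ltr0n.
have qj : 0 < q%:R + j%:R :> R by rewrite ltr_wpDr.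
rewrite /node; apply/andP; split; first by rewrite divr_ge0 ?(ltW qj).
by rewrite ler_pdivrMr // mul1r lerDr ltW.
Qed.

Let Hn (q i j : nat) := H (i%:R / q%:R) (node q j).
Let cellsum (q j0 j1 : nat) (w : nat -> nat -> R) : R :=
  \sum_(0 <= i < q) \sum_(j0 <= j < j1) w i j.

Lemma cellsum_indicator (q j0 j1 a c d : nat) (w : nat -> nat -> R) :
  (0 < q)%N -> (0 < a)%N -> (a <= c)%N -> (0 < d)%N ->
  cellsum q j0 j1 (fun i j => w i j * (in_cell q i j a c d)%:R) =
  if (j0 <= (q * d).-1 %/ c < j1)%N then w ((q * a).-1 %/ c)%N ((q * d).-1 %/ c)%N else 0.
Proof.
move=> q0 a0 ac d0; have c0 : (0 < c)%N by apply: leq_trans ac.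
have iq : ((q * a).-1 %/ c < q)%N.
  by rewrite ltn_divLR // prednK ?muln_gt0 ?q0 // leq_mul2l ac orbT.
rewrite /cellsum (eq_bigr (fun i => if i == ((q * a).-1 %/ c)%N then
   (if (j0 <= (q * d).-1 %/ c < j1)%N then w i ((q * d).-1 %/ c)%N else 0) else 0)).
  by rewrite -big_mkcond /= big_nat1_eq iq.
move=> i _; case: eqP => [->|/eqP ni]; last first.
  by rewrite big1 // => j _; rewrite in_cellE // (negbTE ni) mulr0.
rewrite -[RHS](big_nat1_eq +%R) big_mkcond /=; apply: eq_bigr => j _.
by rewrite in_cellE // eqxx /=; case: eqP => _; rewrite ?mulr1 ?mulr0.
Qed.

(** One cell contains the matrix. If j is above the kept range, d > K c; if below, either c > K N
    and the weight is small, or the matrix is in a thin strip. In a kept cell [H] varies by at most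
    w, unless c < C0, where only the bound M is available. *)
Lemma cell_approx (q K N C0 a c d : nat) (r w : R) :
  (0 < K)%N -> (K ^ 3 <= q)%N ->
  (forall x y x' y', 0 <= x <= 1 -> 0 <= y <= 1 -> 0 <= x' <= 1 -> 0 <= y' <= 1 ->
    `|x - x'| <= r -> `|y - y'| <= r -> `|H x y - H x' y'| <= w) ->
  q%:R^-1 <= r / 2 -> (forall c : nat, (C0 <= c)%N -> c%:R^-1 <= r / 2) -> 0 <= w ->
  farey_matrix a c d -> (a + d <= N)%N ->
  `|G a c d - cellsum q (q %/ K ^ 3) (K * q) (fun i j => Hn q i j * (in_cell q i j a c d)%:R)| <=
  2 * M * (c < C0)%N%:R + M * (K * c < d)%N%:R
  + M * ((c <= K * N) && (q * d <= q %/ K ^ 3 * c))%N%:R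
  + M * (if (K * N < c)%N then N%:R ^+ 2 / c%:R ^+ 2 else 0)
  + w * (c < 2 * K ^ 3 * N)%N%:R.
Proof.
move=> K0 Kq Hr qr cr w0 /and5P[a0 ac d0 _ _] adN.
have K30 : (0 < K ^ 3)%N by rewrite expn_gt0 K0.
have q0 : (0 < q)%N by apply: leq_trans Kq.
have c0 : (0 < c)%N by apply: leq_trans ac.
have [x01 y01 _ _ hle] := @fix_estimates R mu mu01 a c d (introT andP (conj a0 ac)) d0.
have M0 : 0 <= M by apply: le_trans (fM x01 y01).
have /andP[h0 h1] := weight_itv x01 y01.
have GM : `|G a c d| <= M.
  by apply: le_trans (H_bound x01 y01) _; rewrite ler_piMr.
have GN : `|G a c d| <= M * (N%:R ^+ 2 / c%:R ^+ 2).
  apply: le_trans (H_bound x01 y01) _; rewrite ler_wpM2l //.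
  apply: le_trans hle _; rewrite ler_wpM2r ?invr_ge0 ?exprn_ge0 //.
  by rewrite lerXn2r ?nnegrE // ler_nat.
have n0 (b : bool) : 0 <= b%:R :> R by [].
have t1 : 0 <= 2 * M * (c < C0)%N%:R by rewrite !mulr_ge0.
have t2 : 0 <= M * (K * c < d)%N%:R by rewrite mulr_ge0.
have t3 : 0 <= M * ((c <= K * N) && (q * d <= q %/ K ^ 3 * c))%N%:R by rewrite mulr_ge0.
have t4 : 0 <= M * (if (K * N < c)%N then N%:R ^+ 2 / c%:R ^+ 2 else 0).
  by case: ifP; rewrite ?mulr0 // mulr_ge0 // divr_ge0 // exprn_ge0.
have t5 : 0 <= w * (c < 2 * K ^ 3 * N)%N%:R by rewrite mulr_ge0.
have [] := le_sum5 t1 t2 t3 t4 t5.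
rewrite cellsum_indicator //; set i := ((q * a).-1 %/ c)%N; set j := ((q * d).-1 %/ c)%N.
move=> s1 s2 s3 s4 s5.
have cell : in_cell q i j a c d by rewrite in_cellE // !eqxx.
have qd0 : (0 < q * d)%N by rewrite muln_gt0 q0.
case: ifPn => [/andP[jl jh]|]; last first.
  rewrite negb_and -!ltnNge subr0 => /orP[jl|jh].
    have qd : (q * d <= q %/ K ^ 3 * c)%N.
      by rewrite -[(q * d)%N](prednK qd0) -ltn_divLR.
    have /orP[cKN|cKN] := leqVgt c (K * N).
      by apply: le_trans GM (le_trans _ s3); rewrite cKN qd mulr1.
    by apply: le_trans GN (le_trans _ s4); rewrite cKN.
  have Kd : (K * c < d)%N.
    rewrite -(ltn_pmul2l q0) mulnA [(q * K)%N]mulnC -[X in (_ < X)%N](prednK qd0) ltnS.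
    by rewrite -leq_divRL // -ltnS.
  by apply: le_trans GM (le_trans _ s2); rewrite Kd mulr1.
have iq : (i <= q)%N.
  by apply: ltnW; rewrite ltn_divLR // prednK ?muln_gt0 ?q0 // leq_mul2l ac orbT.
have i01 := grid01 q0 iq; have j01 := node01 j q0.
have /orP[cC|cC] := leqVgt C0 c; last first.
  have HnM : `|Hn q i j| <= M.
    apply: le_trans (H_bound i01 j01) _; rewrite ler_piMr //.
    by case/andP: (weight_itv i01 j01).
  apply: le_trans (ler_normB _ _) (le_trans _ s1).
  by rewrite cC mulr1 mulr_natl mulr2n lerD.
(* In a kept cell d > c j0 / q with j0 = q %/ K^3 at least q / (2 K^3), so c < 2 K^3 d <= 2 K^3
   N. *)
have cN : (c < 2 * K ^ 3 * N)%N.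
  have e1 : ((q %/ K ^ 3) * c < q * d)%N.
    rewrite -[X in (_ < X)%N](prednK qd0) ltnS; apply: leq_trans (leq_divM _ c).
    by rewrite leq_mul2r jl orbT.
  have e2 : (q < (q %/ K ^ 3).+1 * K ^ 3)%N by rewrite ltn_ceil.
  have p0 : (0 < q %/ K ^ 3)%N by rewrite divn_gt0.
  have e3 : (q <= 2 * (q %/ K ^ 3) * K ^ 3)%N.
    apply: leq_trans (ltnW e2) _; rewrite leq_mul2r; apply/orP; right.
    by rewrite mul2n -addnn -addn1 leq_add2l.
  rewrite -(ltn_pmul2l p0); apply: leq_trans e1 _.
  apply: (@leq_trans (2 * (q %/ K ^ 3) * K ^ 3 * d)%N); first by rewrite leq_mul2r e3 orbT.
  apply: (@leq_trans (2 * (q %/ K ^ 3) * K ^ 3 * N)%N).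
    by rewrite leq_mul2l (leq_trans (leq_addl a d) adN) orbT.
  by rewrite [(2 * (_ %/ _))%N]mulnC -!mulnA.
apply: le_trans s5; rewrite cN mulr1.
have [dx dy] := cell_near q0 a0 ac d0 cell qr (cr c cC).
exact: Hr.
Qed.

Lemma matrix_sum_cellsum N q j0 j1 :
  matrix_sum N (fun a c d => cellsum q j0 j1 (fun i j => Hn q i j * (in_cell q i j a c d)%:R)) =
  cellsum q j0 j1 (fun i j => Hn q i j *
    matrix_sum N (fun a c d => (in_cell q i j a c d)%:R)).
Proof.
rewrite /cellsum matrix_sum_sum; apply: eq_bigr => i _.
by rewrite matrix_sum_sum; apply: eq_bigr => j _; exact: matrix_sumZ.
Qed.

(** The exponent 3 is calibrated here: the strip d <= c / K^3 with c <= K N holds at most (K N)^2 /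
    K^3 = N^2 / K matrices, the order of the other two cut-offs. *)
Lemma weighted_error (q K N C0 : nat) (r w : R) :
  (0 < N)%N -> (0 < K)%N -> (K ^ 3 <= q)%N ->
  (forall x y x' y', 0 <= x <= 1 -> 0 <= y <= 1 -> 0 <= x' <= 1 -> 0 <= y' <= 1 ->
    `|x - x'| <= r -> `|y - y'| <= r -> `|H x y - H x' y'| <= w) ->
  q%:R^-1 <= r / 2 -> (forall c : nat, (C0 <= c)%N -> c%:R^-1 <= r / 2) -> 0 <= w ->
  `|matrix_sum N G - cellsum q (q %/ K ^ 3) (K * q) (fun i j => Hn q i j *
    matrix_sum N (fun a c d => (in_cell q i j a c d)%:R))| <=
  2 * M * (C0%:R * N%:R) + 3 * M * (N%:R ^+ 2 / K%:R) + w * (2 * K%:R ^+ 3 * N%:R ^+ 2).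
Proof.
move=> N0 K0 Kq Hr qr cr w0; rewrite -matrix_sum_cellsum.
have M0 : 0 <= M by apply: le_trans (fM (x := 0) (y := 0) _ _); rewrite ?lexx ?ler01.
have -> : matrix_sum N G - matrix_sum N (fun a c d =>
    cellsum q (q %/ K ^ 3) (K * q) (fun i j => Hn q i j * (in_cell q i j a c d)%:R)) =
  matrix_sum N (fun a c d => G a c d -
    cellsum q (q %/ K ^ 3) (K * q) (fun i j => Hn q i j * (in_cell q i j a c d)%:R)).
  rewrite -mulN1r -matrix_sumZ -matrix_sumD; congr matrix_sum.
  by apply/funext => a; apply/funext => c; apply/funext => d; rewrite mulN1r.
apply: le_trans (ler_norm_matrix_sum _ _) _.
apply: le_trans (ler_matrix_sum (fun a c d => @cell_approx q K N C0 a c d r w K0 Kq Hr qr cr w0)) _.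
rewrite !matrix_sumD !matrix_sumZ.
have q0 : (0 < q)%N by apply: leq_trans Kq; rewrite expn_gt0 K0.
have b1 := matrix_sum_small_c R N C0.
have b2 := matrix_sum_large_d R N K0.
have b3 := matrix_sum_small_d R N K (q %/ K ^ 3) q0.
have b4 := matrix_sum_large_c R K0 N0.
have b5 := matrix_sum_small_c R N (2 * K ^ 3 * N).
have Kp : 0 < K%:R :> R by rewrite ltr0n.
have b3' : (q %/ K ^ 3)%:R / q%:R * (K%:R * N%:R) ^+ 2 <= N%:R ^+ 2 / K%:R :> R.
  have -> : N%:R ^+ 2 / K%:R = K%:R ^- 3 * (K%:R * N%:R) ^+ 2 :> R.
    by field; rewrite gt_eqF.
  rewrite ler_wpM2r ?exprn_ge0 ?mulr_ge0 // ler_pdivrMr ?ltr0n //.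
  rewrite mulrC ler_pdivlMr ?exprn_gt0 // -natrX -natrM ler_nat.
  exact: leq_divM.
have b5' : (2 * K ^ 3 * N)%:R * N%:R = 2 * K%:R ^+ 3 * N%:R ^+ 2 :> R.
  by rewrite 2!natrM natrX expr2 mulrA.
rewrite b5' in b5; have {b3'}b3 := le_trans b3 b3'.
have m2 : 0 <= 2 * M by rewrite mulr_ge0.
apply: le_trans (lerD (lerD (lerD (lerD (ler_wpM2l m2 b1) (ler_wpM2l M0 b2))
  (ler_wpM2l M0 b3)) (ler_wpM2l M0 b4)) (ler_wpM2l w0 b5)) _.
rewrite lerD2r -!addrA lerD2l !addrA -!mulrDr.
by rewrite -!mulrA [leRHS]mulrCA ler_wpM2l //; lra.
Qed.

(** At a node x + y - x y = (i + j) / (q + j): the weight cancels the cell density 1 / (i + j)^2 and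
    leaves 1 / (q + j)^2, which is 1/q times the approximate width q / (q + j)^2 of the cell in
    y. *)
Lemma Hn_node (q i j : nat) : (0 < q)%N -> (0 < i + j)%N ->
  Hn q i j * (rho / (i + j)%:R ^+ 2) =
  rho * (f (i%:R / q%:R) (node q j) / (q%:R + j%:R) ^+ 2).
Proof.
move=> q0 ij; have qp : 0 < q%:R :> R by rewrite ltr0n.
have qj : 0 < q%:R + j%:R :> R by rewrite ltr_wpDr.
have ijp : 0 < i%:R + j%:R :> R by rewrite -natrD ltr0n.
rewrite /Hn /H /h natrD; set F := f _ _.
have -> : i%:R / q%:R + node q j - i%:R / q%:R * node q j =
    (i%:R + j%:R) / (q%:R + j%:R).
  by rewrite /node; field; rewrite !gt_eqF.
by field; rewrite !gt_eqF.
Qed.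

Lemma inv_sqr_gap (s : R) : 0 < s -> s ^- 2 - (s + 2) ^- 2 <= 4 / s ^+ 3.
Proof.
move=> s0; have s2 : 0 < s + 2 by lra.
have -> : s ^- 2 - (s + 2) ^- 2 = (4 / s ^+ 3) * (s * (s + 1) / (s + 2) ^+ 2).
  by field; rewrite !gt_eqF.
rewrite ler_piMr ?divr_ge0 ?exprn_ge0 ?(ltW s0) //.
by rewrite ler_pdivrMr ?exprn_gt0 // mul1r; nra.
Qed.

(** The order of choices: K for the trimming error 3 M / K, then q for the variation of [H] and the
    gap between upper and lower cell counts, then N for the error terms of finitely many cells. *)
Theorem weighted_asymp (e : R) : 0 < e -> exists K0 : nat, forall K, (K0 <= K)%N ->
  exists q0 : nat, forall q, (q0 <= q)%N -> exists N0 : nat, forall N, (N0 <= N)%N ->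
  `|matrix_sum N G - rho * N%:R ^+ 2 * cellsum q (q %/ K ^ 3) (K * q)
     (fun i j => f (i%:R / q%:R) (node q j) / (q%:R + j%:R) ^+ 2)| <= e * N%:R ^+ 2.
Proof.
move=> e0; have M0 : 0 <= M by apply: le_trans (fM (x := 0) (y := 0) _ _); rewrite ?lexx ?ler01.
have M1 : 0 < M + 1 by lra.
exists (Num.truncn (15 * M / e)).+1 => K KK.
have K0 : (0 < K)%N by apply: leq_ltn_trans KK.
have Kp : 0 < K%:R :> R by rewrite ltr0n.
have Ke : 3 * M / K%:R <= e / 5.
  have : 15 * M / e < K%:R by apply: lt_le_trans (truncnS_gt _) _; rewrite ler_nat.
  rewrite ltr_pdivrMr // => h'; rewrite ler_pdivrMr //; lra.
(* At most 2 K^3 N^2 matrices lie in kept cells, so an oscillation w costs e N^2 / 5. *)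
pose w := e / (10 * K%:R ^+ 3).
have w0 : 0 < w by rewrite divr_gt0 ?mulr_gt0 ?exprn_gt0.
have [r r0 Hr] := Hunif w0.
(* At most K q^2 cells have a gap of 4 rho / j0^3 each, with j0 >= q / (2 K^3). Times the bound M
   this sums to 32 M rho K^10 / q, which B makes at most e / 5. *)
pose B := 160 * (M + 1) * rho * K%:R ^+ 10 / e.
exists (maxn (K ^ 3) (maxn (Num.truncn (2 / r)).+1 (Num.truncn B).+1)) => q.
rewrite !geq_max => /and3P[Kq qr qB].
have q0 : (0 < q)%N by apply: leq_ltn_trans qr.
have qp : 0 < q%:R :> R by rewrite ltr0n.
have inv_r (n : nat) : 2 / r < n%:R -> n%:R^-1 <= r / 2.
  move=> h'; have n0 : 0 < n%:R :> R by apply: lt_trans h'; rewrite divr_gt0.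
  by rewrite -[r / 2]invrK invf_div lef_pV2 ?posrE ?divr_gt0 // ltW.
have {}qr : q%:R^-1 <= r / 2.
  by apply: inv_r; apply: lt_le_trans (truncnS_gt _) _; rewrite ler_nat.
have {}qB : B < q%:R by apply: lt_le_trans (truncnS_gt _) _; rewrite ler_nat.
pose C0 := (Num.truncn (2 / r)).+1.
have cr c : (C0 <= c)%N -> c%:R^-1 <= r / 2.
  by move=> cC; apply: inv_r; apply: lt_le_trans (truncnS_gt _) _; rewrite ler_nat.
pose j0 := (q %/ K ^ 3)%N.
have K30 : (0 < K ^ 3)%N by rewrite expn_gt0 K0.
have j00 : (0 < j0)%N by rewrite divn_gt0.
have j0q : q%:R <= 2 * K%:R ^+ 3 * j0%:R :> R.
  rewrite -natrX -!natrM ler_nat.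
  apply: leq_trans (ltnW (ltn_ceil q K30)) _.
  rewrite -mulnA [(K ^ 3 * _)%N]mulnC mulnA leq_mul2r; apply/orP; right.
  by rewrite mul2n -addnn -addn1 leq_add2l.
pose eta := e / (5 * (M + 1) * K%:R * q%:R ^+ 2).
have eta0 : 0 < eta by rewrite divr_gt0 ?mulr_gt0 ?exprn_gt0.
pose I := ('I_q * 'I_(K * q))%type.
have /choice [N1 HN1] : forall ij : I, exists N0 : nat, forall N, (N0 <= N)%N ->
    (0 < ij.2)%N -> matrix_sum N (fun a c d => (in_cell q ij.1 ij.2 a c d)%:R) <=
    (rho / (ij.1 + ij.2)%:R ^+ 2 + eta) * N%:R ^+ 2.
  move=> [i j] /=; have [jz|jp] := posnP j; first by exists 0%N; rewrite jz.
  have [n Hn'] := cell_upper rho0 totient_rho (ltn_ord i) jp eta0.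
  by exists n => N nN _; exact: Hn'.
have /choice [N2 HN2] : forall ij : I, exists N0 : nat, forall N, (N0 <= N)%N ->
    (0 < ij.2)%N -> (rho / (ij.1 + ij.2).+2%:R ^+ 2 - eta) * N%:R ^+ 2 <=
    matrix_sum N (fun a c d => (in_cell q ij.1 ij.2 a c d)%:R).
  move=> [i j] /=; have [jz|jp] := posnP j; first by exists 0%N; rewrite jz.
  have [n Hn'] := cell_lower rho0 totient_rho (ltn_ord i) jp eta0.
  by exists n => N nN _; exact: Hn'.
exists (maxn (\max_ij N1 ij) (maxn (\max_ij N2 ij) (Num.truncn (10 * M * C0%:R / e)).+1)) => N.
rewrite !geq_max => /and3P[NN1 NN2 NC].
have N0 : (0 < N)%N by apply: leq_ltn_trans NC.
have Np : 0 < N%:R :> R by rewrite ltr0n.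
have {}NC : 10 * M * C0%:R / e < N%:R.
  by apply: lt_le_trans (truncnS_gt _) _; rewrite ler_nat.
have E1 := weighted_error N0 K0 Kq Hr qr cr (ltW w0).
set V := matrix_sum N G in E1 *; set W := cellsum _ _ _ _ in E1.
have [x Ex] : {x : R | x = N%:R ^+ 2} by exists (N%:R ^+ 2).
have x0 : 0 < x by rewrite Ex exprn_gt0.
have e1 : 2 * M * (C0%:R * N%:R) <= e / 5 * x.
  have -> : 2 * M * (C0%:R * N%:R) = (2 * M * C0%:R) * N%:R by ring.
  rewrite Ex expr2 mulrA ler_pM2r //; move: NC; rewrite ltr_pdivrMr //; lra.
have e2 : 3 * M * (N%:R ^+ 2 / K%:R) <= e / 5 * x.
  rewrite -Ex; have -> : 3 * M * (x / K%:R) = 3 * M / K%:R * x by ring.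
  by rewrite ler_pM2r.
have e3 : w * (2 * K%:R ^+ 3 * N%:R ^+ 2) <= e / 5 * x.
  rewrite -Ex /w le_eqVlt; apply/orP; left; apply/eqP; field; rewrite gt_eqF //.
have E2 : `|W - rho * x * cellsum q j0 (K * q)
     (fun i j => f (i%:R / q%:R) (node q j) / (q%:R + j%:R) ^+ 2)| <= 2 * e / 5 * x.
  have -> : W - rho * x * cellsum q j0 (K * q)
      (fun i j => f (i%:R / q%:R) (node q j) / (q%:R + j%:R) ^+ 2) =
    cellsum q j0 (K * q) (fun i j => Hn q i j *
      (matrix_sum N (fun a c d => (in_cell q i j a c d)%:R) - rho / (i + j)%:R ^+ 2 * x)).
    rewrite /W /cellsum mulr_sumr -sumrB; apply: eq_bigr => i _.
    rewrite mulr_sumr -sumrB; apply: eq_big_nat => j /andP[jj _].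
    rewrite mulrBr; congr (_ - _); rewrite [in RHS]mulrA Hn_node //; first by ring.
    by rewrite addn_gt0 (leq_trans j00 jj) orbT.
  pose D := M * ((4 * rho / j0%:R ^+ 3 + eta) * x).
  apply: (@le_trans _ _ (\sum_(0 <= i < q) \sum_(j0 <= j < K * q) D)).
    apply: le_trans (ler_norm_sum _ _ _) _.
    rewrite [leLHS]big_nat_cond [leRHS]big_nat_cond.
    apply: ler_sum => i; rewrite andbT => /andP[_ iq].
    apply: le_trans (ler_norm_sum _ _ _) _.
    rewrite [leLHS]big_nat_cond [leRHS]big_nat_cond.
    apply: ler_sum => j; rewrite andbT => /andP[jj jK].
    have jp : (0 < j)%N by apply: leq_trans jj.
    have HnM : `|Hn q i j| <= M.
      have i01 := grid01 q0 (ltnW iq); have j01 := node01 j q0.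
      apply: le_trans (H_bound i01 j01) _; rewrite ler_piMr //.
      by case/andP: (weight_itv i01 j01).
    rewrite normrM; apply: ler_pM => //.
    have up := HN1 (Ordinal iq, Ordinal jK) N (leq_trans (leq_bigmax _) NN1) jp.
    have lo := HN2 (Ordinal iq, Ordinal jK) N (leq_trans (leq_bigmax _) NN2) jp.
    move: up lo; rewrite /= -Ex; set n := matrix_sum _ _.
    have sp : 0 < (i + j)%:R :> R by rewrite ltr0n addn_gt0 jp orbT.
    have -> : (i + j).+2%:R = (i + j)%:R + 2 :> R by rewrite -addn2 natrD.
    have js : j0%:R <= (i + j)%:R :> R.
      by rewrite ler_nat (leq_trans jj) // leq_addl.
    move: sp js; set s := (i + j)%:R => sp js up lo.
    have gap := inv_sqr_gap sp.
    have j0p : 0 < j0%:R :> R by rewrite ltr0n.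
    have gap2 : s ^- 2 - (s + 2) ^- 2 <= 4 / j0%:R ^+ 3.
      apply: le_trans gap _; rewrite ler_wpM2l // lef_pV2 ?posrE ?exprn_gt0 //.
      by rewrite lerXn2r // nnegrE ltW.
    have gap3 : rho / s ^+ 2 * x - rho / (s + 2) ^+ 2 * x <= 4 * rho / j0%:R ^+ 3 * x.
      have -> : rho / s ^+ 2 * x - rho / (s + 2) ^+ 2 * x =
        rho * x * (s ^- 2 - (s + 2) ^- 2) by ring.
      have -> : 4 * rho / j0%:R ^+ 3 * x = rho * x * (4 / j0%:R ^+ 3) by ring.
      by rewrite ler_wpM2l // mulr_ge0 // ltW.
    have pos3 : 0 <= 4 * rho / j0%:R ^+ 3 * x.
      by rewrite mulr_ge0 ?(ltW x0) // divr_ge0 ?mulr_ge0 ?exprn_ge0 ?(ltW rho0).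
    rewrite mulrBl in lo; rewrite mulrDl in up; rewrite mulrDl.
    move: gap3 pos3 up lo; set A1 := rho / s ^+ 2 * x; set A2 := rho / (s + 2) ^+ 2 * x.
    set A3 := 4 * rho / _ * x; set A4 := eta * x; clear; move=> *.
    by rewrite ler_distl; apply/andP; split; lra.
  rewrite !sumr_const_nat subn0.
  have j0p : 0 < j0%:R :> R by rewrite ltr0n.
  have D0 : 0 <= D.
    rewrite /D mulr_ge0 // mulr_ge0 ?(ltW x0) // addr_ge0 ?(ltW eta0) //.
    by rewrite divr_ge0 ?mulr_ge0 ?exprn_ge0 ?(ltW rho0).
  apply: (@le_trans _ _ (D * (K%:R * q%:R ^+ 2))).
    rewrite -mulrnA -[X in X <= _]mulr_natr; apply: ler_wpM2l => //.
    rewrite -natrX -natrM ler_nat.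
    by rewrite -mulnn mulnA leq_mul2r leq_subr orbT.
  rewrite /D; have -> : M * ((4 * rho / j0%:R ^+ 3 + eta) * x) * (K%:R * q%:R ^+ 2) =
     (M * (4 * rho / j0%:R ^+ 3) * (K%:R * q%:R ^+ 2) + M * eta * (K%:R * q%:R ^+ 2)) * x by ring.
  rewrite ler_pM2r //.
  have d1 : M * eta * (K%:R * q%:R ^+ 2) <= e / 5.
    have -> : M * eta * (K%:R * q%:R ^+ 2) = e / 5 * (M / (M + 1)).
      by rewrite /eta; field; rewrite !gt_eqF.
    by rewrite ler_piMr ?divr_ge0 ?(ltW e0) // ler_pdivrMr // mul1r lerDl.
  have d2 : M * (4 * rho / j0%:R ^+ 3) * (K%:R * q%:R ^+ 2) <= e / 5.
    have q3 : q%:R ^+ 3 <= (2 * K%:R ^+ 3 * j0%:R) ^+ 3 :> R.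
      by rewrite lerXn2r // nnegrE ?mulr_ge0 ?exprn_ge0.
    have i3 : j0%:R ^- 3 <= (2 * K%:R ^+ 3) ^+ 3 / q%:R ^+ 3 :> R.
      rewrite ler_pdivlMr ?exprn_gt0 // mulrC ler_pdivrMr ?exprn_gt0 //.
      by rewrite -exprMn.
    apply: (@le_trans _ _ (M * (4 * rho * ((2 * K%:R ^+ 3) ^+ 3 / q%:R ^+ 3)) * (K%:R * q%:R ^+ 2))).
      rewrite ler_wpM2r ?mulr_ge0 ?exprn_ge0 // ler_wpM2l // ler_wpM2l //.
      by rewrite mulr_ge0 // ltW.
    have -> : M * (4 * rho * ((2 * K%:R ^+ 3) ^+ 3 / q%:R ^+ 3)) * (K%:R * q%:R ^+ 2) =
       32 * M * rho * K%:R ^+ 10 / q%:R by field; rewrite gt_eqF.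
    rewrite ler_pdivrMr //.
    move: qB; rewrite /B ltr_pdivrMr // => qB.
    have : 0 <= rho * K%:R ^+ 10 by rewrite mulr_ge0 ?exprn_ge0 // ltW.
    have -> : 32 * M * rho * K%:R ^+ 10 = 32 * M * (rho * K%:R ^+ 10) by ring.
    move: qB; rewrite -mulrA; set z := rho * _; move=> qB z0; lra.
  lra.
rewrite -Ex; have -> : V - rho * x * cellsum q j0 (K * q)
     (fun i j => f (i%:R / q%:R) (node q j) / (q%:R + j%:R) ^+ 2) =
   (V - W) + (W - rho * x * cellsum q j0 (K * q)
     (fun i j => f (i%:R / q%:R) (node q j) / (q%:R + j%:R) ^+ 2)) by ring.
apply: le_trans (ler_normD _ _) _; rewrite -Ex in E1 e2 e3; move: E1 E2 e1 e2 e3; clear; lra.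
Qed.

End WeightedAsymptotics.

(** * Fixed points of integer matrices *)

Lemma square_of_quotient (n q k : nat) : (0 < q)%N -> (n * q ^ 2 = k ^ 2)%N ->
  exists r, n = (r ^ 2)%N.
Proof.
move=> q0 nqk; have : (q ^ 2 %| k ^ 2)%N by rewrite -nqk dvdn_mull.
rewrite dvdn_pexp2r // => /dvdnP[r kE]; exists r; apply/eqP.
rewrite -(@eqn_pmul2r (q ^ 2)) ?expn_gt0 ?q0 //.
by rewrite nqk kE expnMn.
Qed.

Section Stabilizer.
Variable R : realType.
Implicit Types x z l : R.

Definition irrational x := forall p q : int, q%:~R * x = p%:~R -> q = 0.

(* (x, 1) is an eigenvector, with eigenvalue l, of a matrix in SL_2(Z). *)
Definition stab x l := exists a b c d : int,
  [/\ a * d - b * c = 1, a%:~R * x + b%:~R = l * x & c%:~R * x + d%:~R = l].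

Lemma stab_neq0 x l : stab x l -> l != 0.
Proof.
move=> [a [b [c [d [D e1 e2]]]]]; apply/eqP => l0; subst l.
move: e1; rewrite l0 mul0r => e1.
have : x = (a * d - b * c)%:~R * x by rewrite D mul1r.
rewrite rmorphB !rmorphM /= => xE.
have x0 : x = 0 by rewrite xE; move: e1 l0; nra.
rewrite x0 !mulr0 !add0r in e1 l0.
have b0 : b = 0 by apply: (@intr_inj R).
have d0 : d = 0 by apply: (@intr_inj R).
by rewrite b0 d0 mulr0 mul0r subr0 in D.
Qed.

Lemma stab_trace x l a b c d : a * d - b * c = 1 ->
  a%:~R * x + b%:~R = l * x -> c%:~R * x + d%:~R = l ->
  l * (a%:~R - c%:~R * x) = 1 /\ l + l^-1 = (a + d)%:~R.
Proof.
move=> D e1 e2; have l0 : l != 0 by apply: (@stab_neq0 x); exists a, b, c, d.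
have DR : a%:~R * d%:~R - b%:~R * c%:~R = 1 :> R by rewrite -!intrM -intrB D.
have k : l * (a%:~R - c%:~R * x) = 1.
  transitivity (a%:~R * (c%:~R * x + d%:~R) - c%:~R * (a%:~R * x + b%:~R)).
    by rewrite e1 e2; ring.
  by rewrite -[RHS]DR; ring.
split => //; have -> : l^-1 = a%:~R - c%:~R * x by apply: (mulfI l0); rewrite k mulfV.
by rewrite intrD -e2; ring.
Qed.

Lemma stabV x l : stab x l -> stab x l^-1.
Proof.
move=> S; have l0 := stab_neq0 S; move: S => [a [b [c [d [D e1 e2]]]]].
have [k _] := stab_trace D e1 e2.
exists d, (- b), (- c), a; split; first by rewrite -D; ring.
  apply: (mulfI l0); rewrite mulrA mulfV // mul1r rmorphN /=.
  have DR : a%:~R * d%:~R - b%:~R * c%:~R = 1 :> R by rewrite -!intrM -intrB D.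
  transitivity (d%:~R * (a%:~R * x + b%:~R) - b%:~R * (c%:~R * x + d%:~R)).
    by rewrite e1 e2; ring.
  transitivity ((a%:~R * d%:~R - b%:~R * c%:~R) * x); first by ring.
  by rewrite DR mul1r.
by apply: (mulfI l0); rewrite mulfV // -[RHS]k; ring.
Qed.

Lemma stabM x l l' : stab x l -> stab x l' -> stab x (l * l').
Proof.
move=> [a [b [c [d [D e1 e2]]]]] [a' [b' [c' [d' [D' e1' e2']]]]].
exists (a * a' + b * c'), (a * b' + b * d'), (c * a' + d * c'), (c * b' + d * d').
split.
- rewrite [RHS](_ : 1 = (a * d - b * c) * (a' * d' - b' * c')); first by ring.
  by rewrite D D'.
- rewrite !rmorphD !rmorphM /=.
  transitivity (a%:~R * (a'%:~R * x + b'%:~R) + b%:~R * (c'%:~R * x + d'%:~R)).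
    by ring.
  by rewrite e1' e2'; transitivity (l' * (a%:~R * x + b%:~R)); [ring|rewrite e1; ring].
- rewrite !rmorphD !rmorphM /=.
  transitivity (c%:~R * (a'%:~R * x + b'%:~R) + d%:~R * (c'%:~R * x + d'%:~R)).
    by ring.
  by rewrite e1' e2'; transitivity (l' * (c%:~R * x + d%:~R)); [ring|rewrite e2; ring].
Qed.

(** If x were rational, so would be l, and t^2 - 4 would be a perfect square for the integer trace
    t. For t >= 3 it lies strictly between (t - 1)^2 and t^2. *)
Lemma stab_irrational x l : stab x l -> 1 < l -> irrational x.
Proof.
move=> [a [b [c [d [D e1 e2]]]]] l1 p q qx.
have l0 : 0 < l by lra.
have [_ tr] := stab_trace D e1 e2; set t := a + d in tr.
have [//|q0] := eqVneq q 0.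
pose m := c * p + d * q.
have ml : q%:~R * l = m%:~R.
  rewrite /m rmorphD !rmorphM /= -qx -e2; ring.
have l2 : l ^+ 2 + 1 = t%:~R * l by rewrite -tr mulrDl mulVf ?gt_eqF // expr2.
have E : (2 * m - t * q) ^+ 2 = (t ^+ 2 - 4) * q ^+ 2.
  apply: (@intr_inj R).
  transitivity ((2 * (q%:~R * l) - t%:~R * q%:~R) ^+ 2); first by rewrite ml; ring.
  transitivity (q%:~R ^+ 2 * (4 * (l ^+ 2 + 1 - t%:~R * l) + t%:~R ^+ 2 - 4)).
    by ring.
  by rewrite l2 subrr mulr0 add0r; ring.
have t3 : 3 <= t.
  have : 2 < t%:~R :> R.
    rewrite -tr -subr_gt0; have -> : l + l^-1 - 2 = (l - 1) ^+ 2 / l.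
      by field; rewrite gt_eqF.
    by rewrite divr_gt0 // exprn_gt0 // subr_gt0.
  by rewrite -[2]/(2%:~R) ltr_int.
case: t t3 E {tr l2} => // n n3 /(congr1 absz); rewrite abszX abszM abszX.
have n3' : (3 <= n)%N by [].
have -> : `|n%:Z ^+ 2 - 4|%N = (n * n - 4)%N.
  have -> : n%:Z ^+ 2 = (n * n)%N%:Z by rewrite PoszM expr2.
  by rewrite subzn //; apply: leq_trans (leq_mul n3' n3').
move=> /esym E; have [|r rE] := square_of_quotient _ E; first by rewrite absz_gt0.
have [n' nE] : exists n', n = n'.+3 by exists (n - 3)%N; lia.
have lo : (n'.+2 ^ 2 < r ^ 2)%N by rewrite -rE nE -!mulnn; nia.
have hi : (r ^ 2 < n'.+3 ^ 2)%N by rewrite -rE nE -!mulnn; nia.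
by move: lo hi; rewrite !ltn_sqr; lia.
Qed.

Lemma irrational_lin x (p q : int) : irrational x ->
  q%:~R * x + p%:~R = 0 -> q = 0 /\ p = 0.
Proof.
move=> ix e; have q0 : q = 0.
  by apply: (ix (- p)); apply/eqP; rewrite rmorphN -subr_eq0 opprK e.
split => //; apply: (@intr_inj R).
by move: e; rewrite q0 mul0r add0r.
Qed.

(** x and [farey x] are related by an integer matrix of determinant 1 or -1; conjugation by it
    preserves determinant and eigenvalues. *)
Lemma stab_farey x l : 0 < x < 1 -> stab (farey x) l <-> stab x l.
Proof.
move=> /andP[x0 x1]; rewrite /farey; case: ifP => _.
  have n0 : 1 - x != 0 by rewrite gt_eqF // subr_gt0.
  split => -[a [b [c [d [D e1 e2]]]]].
    have f1 : a%:~R * x + b%:~R * (1 - x) = l * x.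
      transitivity (l * (x / (1 - x)) * (1 - x)); last by field.
      by rewrite -e1; field.
    have f2 : c%:~R * x + d%:~R * (1 - x) = l * (1 - x).
      by rewrite -e2; field.
    exists (a - b), b, (a + c - b - d), (b + d); split; first by rewrite -D; ring.
      by rewrite -f1; ring.
    transitivity (l * x + l * (1 - x)); last by ring.
    by rewrite -f1 -f2; ring.
  exists (a + b), b, (c - a + d - b), (d - b); split; first by rewrite -D; ring.
    rewrite mulrA -e1; field.
    by [].
  transitivity ((l - l * x) / (1 - x)); last by field.
  by rewrite -e1 -[in l - _]e2; field.
have n0 : x != 0 by rewrite gt_eqF.
split => -[a [b [c [d [D e1 e2]]]]].
  have f1 : a%:~R * (1 - x) + b%:~R * x = l * (1 - x).
    transitivity (l * ((1 - x) / x) * x); last by field.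
    by rewrite -e1; field.
  have f2 : c%:~R * (1 - x) + d%:~R * x = l * x by rewrite -e2; field.
  exists (d - c), c, (b + d - a - c), (a + c); split; first by rewrite -D; ring.
    by rewrite -f2; ring.
  transitivity (l * x + l * (1 - x)); last by ring.
  by rewrite -f1 -f2; ring.
exists (d - b), (c - a + d - b), b, (a + b); split; first by rewrite -D; ring.
  transitivity ((l - l * x) / x); last by field.
  by rewrite -e1 -[in l - _]e2; field.
transitivity (l * x / x); last by field.
by rewrite -e1; field.
Qed.

(* The smaller eigenvalue of a matrix of determinant 1 and trace t. *)
Definition mu (t : nat) : R := (t%:R - Num.sqrt (t%:R ^+ 2 - 4)) / 2.

Lemma mu_itv t : 0 <= mu t <= 1.
Proof.
rewrite /mu; have t0 : 0 <= t%:R :> R by [].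
have s0 := sqrtr_ge0 (t%:R ^+ 2 - 4 : R); set s := Num.sqrt _ in s0 *.
(* For t <= 1 the square root of the negative discriminant is 0 by convention, and [mu t] is t /
   2. *)
case: (leqP t 1) => t1.
  have : t%:R <= 1 :> R by rewrite (ler_nat _ _ 1).
  have -> : s = 0.
    apply: ler0_sqrtr; have : t%:R <= 1 :> R by rewrite (ler_nat _ _ 1).
    by move=> h; have : t%:R ^+ 2 <= 1 :> R by [apply: exprn_ile1]; lra.
  by move=> h; apply/andP; split; lra.
have t2 : 2 <= t%:R :> R by rewrite (ler_nat _ 2).
have d0 : 0 <= t%:R ^+ 2 - 4 :> R by nra.
have ss : s ^+ 2 = t%:R ^+ 2 - 4 by rewrite sqr_sqrtr.
have : s <= t%:R by rewrite -(@ler_pXn2r _ 2) ?nnegrE // ss; lra.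
have : t%:R - 2 <= s.
  by rewrite -(@ler_pXn2r _ 2) ?nnegrE ?subr_ge0 // ss; nra.
by move=> *; apply/andP; split; lra.
Qed.

Lemma mu_eq t : (3 <= t)%N -> [/\ 0 < mu t, mu t < 1 & mu t ^+ 2 - t%:R * mu t + 1 = 0].
Proof.
move=> t3; have t3' : 3 <= t%:R :> R by rewrite (ler_nat _ 3).
have E : mu t ^+ 2 - t%:R * mu t + 1 = 0.
  rewrite /mu; have d0 : 0 <= t%:R ^+ 2 - 4 :> R by nra.
  have := sqr_sqrtr d0; set s := Num.sqrt _ => ss.
  transitivity ((s ^+ 2 - (t%:R ^+ 2 - 4)) / 4); first by field.
  by rewrite ss subrr mul0r.
have /andP[m0 m1] := mu_itv t.
split => //; rewrite lt_def ?m0 ?m1 andbT; apply/eqP => e.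
  by move: E; rewrite e; move/eqP; rewrite expr0n mulr0 subrr add0r oner_eq0.
by move: E; rewrite -e => E; lra.
Qed.

Lemma mu_unique t l : (3 <= t)%N -> 1 < l -> l + l^-1 = t%:R -> l = (mu t)^-1.
Proof.
move=> t3 l1 lt; have [m0 m1 E] := mu_eq t3; set m := mu t in m0 m1 E *.
have ml : m + m^-1 = t%:R.
  apply: (mulfI (lt0r_neq0 m0)); rewrite mulrDr mulfV ?gt_eqF // -expr2.
  by apply/eqP; rewrite -subr_eq0 -E; apply/eqP; ring.
have l0 : 0 < l by lra.
have : (l - m^-1) * (1 - m / l) = 0.
  transitivity ((l + l^-1) - (m + m^-1) ); first by field; rewrite !gt_eqF.
  by rewrite ml lt subrr.
move/eqP; rewrite mulf_eq0 => /orP[|]; rewrite subr_eq0 => /eqP //.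
move=> e; have : m / l < 1 by rewrite ltr_pdivrMr // mul1r; lra.
by rewrite -e ltxx.
Qed.

Notation fixx := (fix_x mu).
Notation fixy := (fix_y mu).

Lemma farey_matrix_b a c d : farey_matrix a c d -> exists b,
  [/\ (0 < b)%N, (a * d = b * c + 1)%N, (b < d)%N & (3 <= a + d)%N].
Proof.
move=> /and5P[a0 ac d0 ad1]; rewrite eqn_mod_dvd ?(ltnW ad1) // => /dvdnP[b bE].
have adE : (a * d = b * c + 1)%N by rewrite -bE subnK // ltnW.
have b0 : (0 < b)%N by case: b adE {bE} => // e; rewrite e in ad1.
exists b; split => //; last by nia.
have c0 : (0 < c)%N by apply: leq_trans ac.
rewrite ltnNge; apply/negP => db; have : (a * d <= c * b)%N by rewrite leq_mul.
by rewrite adE mulnC; lia.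
Qed.

Section FixedPoint.
Variables (a b c d : nat).
Hypothesis M : farey_matrix a c d.
Hypothesis adE : (a * d = b * c + 1)%N.
Let m := mu (a + d).
Let x := fixx a c d.

Lemma fix_trace3 : (3 <= a + d)%N.
Proof. by have [b' []] := farey_matrix_b M. Qed.

Lemma fix_eigen : [/\ 0 < m, m < 1, a%:R * x + b%:R = m^-1 * x & c%:R * x + d%:R = m^-1].
Proof.
have [m0 m1 E] := mu_eq fix_trace3; rewrite -/m in m0 m1 E.
have c0 : 0 < c%:R :> R.
  by case/and5P: M => a0 ac _ _ _; rewrite ltr0n; apply: leq_trans ac.
have mE : m^-1 = a%:R + d%:R - m.
  apply: (mulfI (lt0r_neq0 m0)); rewrite mulfV ?gt_eqF //.
  by apply/eqP; rewrite eq_sym -subr_eq0 -oppr_eq0 -E natrD; apply/eqP; ring.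
have bE : b%:R = (a%:R * d%:R - 1) / c%:R :> R.
  by rewrite -natrM adE natrD natrM addrK mulfK // gt_eqF.
split => //; last by rewrite /x /fix_x -/m mE; field; rewrite gt_eqF.
rewrite mE /x /fix_x -/m bE.
have -> : (a%:R + d%:R - m) * ((a%:R - m) / c%:R) =
    (a%:R * a%:R + a%:R * d%:R - a%:R * m + (m ^+ 2 - (a + d)%:R * m + 1) - 1) / c%:R.
  by rewrite natrD; field; rewrite gt_eqF.
by rewrite E; field; rewrite gt_eqF.
Qed.

Lemma fix_itv : 0 < x < 1.
Proof.
have [m0 m1 _ _] := fix_eigen; case/and5P: M => a0 ac _ _ _.
have a1 : 1 <= a%:R :> R by rewrite ler1n.
have ac' : a%:R <= c%:R :> R by rewrite ler_nat.
by rewrite /x /fix_x -/m divr_gt0 ?ltr_pdivrMr; lra.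
Qed.

(** The second root of c z^2 + (d - a) z - b is x' = -b / (c x), and y = x' / (x' - 1). This form is
    the one compared with continued fractions. *)
Lemma fix_dual : fixy a c d = b%:R / (b%:R + c%:R * x).
Proof.
have [m0 m1 _ _] := fix_eigen; case/and5P: M => a0 ac d0 _ _.
have a1 : 1 <= a%:R :> R by rewrite ler1n.
have d1 : 1 <= d%:R :> R by rewrite ler1n.
have ac' : a%:R <= c%:R :> R by rewrite ler_nat.
have c0 : 0 < c%:R :> R by lra.
have [_ _ E] := mu_eq fix_trace3; rewrite -/m in E.
have bE : b%:R = (a%:R - m) * (d%:R - m) / c%:R :> R.
  have -> : (a%:R - m) * (d%:R - m) = a%:R * d%:R - 1 + (m ^+ 2 - (a + d)%:R * m + 1).
    by rewrite natrD; ring.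
  by rewrite E addr0 -natrM adE natrD natrM addrK mulfK // gt_eqF.
have am : 0 < a%:R - m by lra.
have cdm : 0 < c%:R + d%:R - m by lra.
rewrite bE /x /fix_x /fix_y -/m; field; rewrite !gt_eqF //=.
have -> : (a%:R - m) * (d%:R - m) + (a%:R - m) * c%:R = (a%:R - m) * (c%:R + d%:R - m) by ring.
by rewrite mulr_gt0.
Qed.

(** The roots have product -b / c, so only one of them is positive. *)
Lemma fix_unique z : 0 < z -> a%:R * z + b%:R = (c%:R * z + d%:R) * z -> z = x.
Proof.
move=> z0 e; have [m0 m1 e1 e2] := fix_eigen; have /andP[x0 x1] := fix_itv.
have c0 : 0 < c%:R :> R.
  by case/and5P: M => a0 ac _ _ _; rewrite ltr0n; apply: leq_trans ac.
have b0 : 0 <= b%:R :> R by [].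
have e3 : a%:R * x + b%:R = (c%:R * x + d%:R) * x by rewrite e2.
have : (z - x) * (c%:R * z * x + b%:R) = 0.
  have : x * ((c%:R * z + d%:R) * z - (a%:R * z + b%:R)) -
    z * ((c%:R * x + d%:R) * x - (a%:R * x + b%:R)) = 0 by rewrite e e3 !subrr !mulr0 subrr.
  by move=> <-; ring.
move/eqP; rewrite mulf_eq0 subr_eq0 => /orP[/eqP //|/eqP h].
have p : 0 < c%:R * z * x by apply: mulr_gt0 => //; apply: mulr_gt0.
lra.
Qed.

Lemma fix_stab : stab x m^-1.
Proof.
have [_ _ e1 e2] := fix_eigen.
exists (a%:Z), (b%:Z), (c%:Z), (d%:Z); split => //.
by rewrite -!PoszM adE PoszD addrAC subrr add0r.
Qed.

End FixedPoint.

End Stabilizer.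

(** * Matrices as words in the Farey branches *)

Definition unimodular (e : bool) (a b c d : nat) : bool :=
  if e then (b * c == a * d + 1)%N else (a * d == b * c + 1)%N.

Lemma unimodular_neq e a b c d : unimodular e a b c d -> (a * d != b * c)%N.
Proof. by case: e => /eqP; lia. Qed.

Lemma unimodular_A e a b c d : (a <= c)%N -> (b <= d)%N ->
  unimodular e a b c d -> unimodular e a b (c - a) (d - b).
Proof.
move=> ac bd; have h1 : (a * b <= a * d)%N by rewrite leq_mul2l bd orbT.
have h2 : (b * a <= b * c)%N by rewrite leq_mul2l ac orbT.
by case: e => /eqP h; apply/eqP; rewrite !mulnBr [(b * a)%N]mulnC in h2 *; lia.
Qed.

Lemma unimodular_J e a b c d : (a <= c)%N -> (b <= d)%N ->
  unimodular e a b c d -> unimodular (~~ e) (c - a) (d - b) a b.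
Proof.
move=> ac bd; have h1 : (a * b <= d * a)%N by rewrite mulnC leq_mul2r bd orbT.
have h2 : (a * b <= c * b)%N by rewrite leq_mul2r ac orbT.
case: e => /eqP h; apply/eqP; rewrite !mulnBl [(b * a)%N]mulnC.
  by rewrite [(b * c)%N]mulnC [(a * d)%N]mulnC in h; lia.
by rewrite [(b * c)%N]mulnC [(a * d)%N]mulnC in h; lia.
Qed.

(** In the two mixed cases the strict inequalities give c + d <= 2 |a d - b c| = 2. What is left are
    the matrices of z / (1 + z) and 1 / (1 + z), so the descent stops exactly at a generator. *)
Lemma unimodular_base e a b c d : (a <= c)%N -> (b <= d)%N -> unimodular e a b c d ->
  ~~ ((2 * a <= c) && (2 * b <= d))%N -> ~~ ((c <= 2 * a) && (d <= 2 * b))%N ->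
  [/\ c = 1, d = 1 & if e then a = 0 /\ b = 1 else a = 1 /\ b = 0]%N.
Proof.
move=> ac bd det; rewrite !negb_and -!ltnNge => /orP[h|h] /orP[h'|h'].
- by exfalso; clear det; lia.
- have p1 : (c.+1 * d <= 2 * a * d)%N by rewrite leq_mul2r h orbT.
  have p2 : (c * (2 * b).+1 <= c * d)%N by rewrite leq_mul2l h' orbT.
  rewrite mulSn in p1; rewrite mulnS in p2.
  move: p1 p2; rewrite -mulnA [(c * (2 * b))%N]mulnCA [(c * b)%N]mulnC => p1 p2.
  case: e det => /eqP det; first by exfalso; lia.
  have cd : (c + d <= 2)%N by lia.
  clear p1 p2 det; have c1 : c = 1%N by lia.
  have d1 : d = 1%N by lia.
  by split => //; split; lia.
- have p1 : (d.+1 * c <= 2 * b * c)%N by rewrite leq_mul2r h orbT.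
  have p2 : (d * (2 * a).+1 <= d * c)%N by rewrite leq_mul2l h' orbT.
  rewrite mulSn in p1; rewrite mulnS in p2.
  move: p1 p2; rewrite -mulnA [(d * (2 * a))%N]mulnCA [(d * a)%N]mulnC => p1 p2.
  case: e det => /eqP det; last by exfalso; lia.
  have cd : (c + d <= 2)%N by lia.
  clear p1 p2 det; have c1 : c = 1%N by lia.
  have d1 : d = 1%N by lia.
  by split => //; split; lia.
- by exfalso; clear det; lia.
Qed.

Lemma half_sub m n : (2 * m <= n)%N -> (m <= n - m)%N.
Proof. lia. Qed.

Lemma half_sub' m n : (n <= 2 * m)%N -> (n - m <= m)%N.
Proof. lia. Qed.

Section FareyOrbits.
Variable R : realType.
Implicit Types x z w l : R.
Notation fixx := (fix_x (@mu R)).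
Notation fixy := (fix_y (@mu R)).
Notation farey := (@farey R).
Notation gauss := (@gauss R).

(** An irrational x satisfies one integer quadratic equation up to scale, so b and c are
    proportional to b0 and c0 and share a sign. It is positive because b / x + c x = l - 1/l > 0. *)
Lemma matrix_of_stab a0 c0 d0 x l : farey_matrix a0 c0 d0 -> x = fixx a0 c0 d0 ->
  stab x l -> 1 < l -> exists a c d,
  [/\ farey_matrix a c d, x = fixx a c d & l = (mu R (a + d))^-1].
Proof.
move=> M0 xE S l1; have [b0 [b00 adE0 _ _]] := farey_matrix_b M0.
have [_ _ f1 f2] := fix_eigen R M0 adE0; rewrite -xE in f1 f2.
have /andP[x0 x1] := fix_itv R M0 adE0; rewrite -xE in x0 x1.
have ix := stab_irrational S l1.
move: S => [a [b [c [d [D e1 e2]]]]].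
have c00 : (0 < c0)%N by case/and5P: M0 => h1 h2 _ _ _; apply: leq_trans h2.
have l0 : 0 < l by lra.
have [k tr] := stab_trace D e1 e2.
have prop : c0%:Z * b = c * b0%:Z.
  have e : (c0%:Z * (d - a) - c * (d0%:Z - a0%:Z))%:~R * x +
      (c * b0%:Z - c0%:Z * b)%:~R = 0.
    transitivity (c0%:R * ((c%:~R * x + d%:~R) * x - (a%:~R * x + b%:~R)) -
      c%:~R * ((c0%:R * x + d0%:R) * x - (a0%:R * x + b0%:R))); first by ring.
    by rewrite e1 e2 f1 f2 !subrr !mulr0 subrr.
  have [_ /eqP] := irrational_lin ix e.
  by rewrite subr_eq0 => /eqP.
have gap : 0 < b%:~R / x + c%:~R * x.
  have -> : b%:~R / x + c%:~R * x = l - l^-1.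
    have -> : b%:~R / x = l - a%:~R.
      by apply: (mulIf (lt0r_neq0 x0)); rewrite divfK ?gt_eqF // mulrBl -e1; ring.
    have -> : l^-1 = a%:~R - c%:~R * x.
      by apply: (mulfI (lt0r_neq0 l0)); rewrite k mulfV // gt_eqF.
    ring.
  by rewrite subr_gt0 (@lt_trans _ _ 1) // invf_lt1.
have cp : 0 < c.
  rewrite ltNge; apply/negP => c_le.
  have b_le : b <= 0.
    have : c0%:Z * b <= 0 by rewrite prop mulr_le0_ge0.
    by rewrite pmulr_rle0 // ltz_nat.
  have : b%:~R / x + c%:~R * x <= 0.
    rewrite -[leRHS]addr0 lerD //; last by rewrite mulr_le0_ge0 ?(ltW x0) // lerz0.
    by rewrite mulr_le0_ge0 ?invr_ge0 ?(ltW x0) // lerz0.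
  by rewrite leNgt gap.
have bp : 0 < b.
  have : 0 < c0%:Z * b by rewrite prop mulr_gt0 // ltz_nat.
  by rewrite pmulr_rgt0 // ltz_nat.
have adp : 0 < a * d by have := mulr_gt0 bp cp; lia.
have trp : 0 < a + d.
  by rewrite -(ltr_int R) -tr addr_gt0 // invr_gt0.
have ap : 0 < a by nia.
have dp : 0 < d by nia.
case: a b c d ap bp cp dp D e1 e2 tr {k prop gap adp trp} => // a [] // b [] // c [] // d.
rewrite !ltz_nat => ap bp cp dp D e1 e2 tr.
have adE : (a * d = b * c + 1)%N by lia.
(* If c < a, the determinant forces d <= b; the top row then dominates and l x >= l, against x <
   1. *)
have ac : (a <= c)%N.
  rewrite leqNgt; apply/negP => ca.
  have db : (d <= b)%N.
    rewrite leqNgt; apply/negP => bd.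
    have : (c.+1 * d <= a * d)%N by rewrite leq_mul2r ca orbT.
    have : (b.+1 * c <= d * c)%N by rewrite leq_mul2r bd orbT.
    rewrite adE !mulSn [(d * c)%N]mulnC; lia.
  have h1 : c%:R * x <= a%:R * x by rewrite ler_wpM2r ?(ltW x0) // ler_nat ltnW.
  have h2 : d%:R <= b%:R :> R by rewrite ler_nat.
  have h3 : l * x < l by rewrite gtr_pMr.
  rewrite -e1 in h3; rewrite -[X in _ < X]e2 in h3.
  by move: h3; rewrite ltNge lerD.
have M : farey_matrix a c d.
  by rewrite /farey_matrix ap ac dp adE addn1 ltnS muln_gt0 bp cp -addn1 modnMDl eqxx.
exists a, c, d; split => //.
  by apply: (fix_unique M adE) => //; rewrite -[a%:R]/(a%:~R) e1 -e2.
apply: mu_unique => //; first exact: (fix_trace3 M).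
Qed.

(** 1 + F(x) is 1 / (1 - x) or 1 / x: the bottom row (1, 1) of either inverse branch, evaluated at
    F(x). Along a period the product is the eigenvalue of the corresponding word. *)
Fixpoint farey_cocycle n x : R :=
  if n is m.+1 then (1 + farey x) * farey_cocycle m (farey x) else 1.

(** Parity of the number of orientation-reversing steps: true when the word has determinant -1,
    matching the flag of [unimodular]. *)
Fixpoint farey_parity n x : bool :=
  if n is m.+1 then (2^-1 < x) (+) farey_parity m (farey x) else false.

Lemma farey_cocycleD m n x :
  farey_cocycle (m + n) x = farey_cocycle m x * farey_cocycle n (iter m farey x).
Proof.
elim: m x => [|m IH] x /=; first by rewrite mul1r.
by rewrite IH mulrA -iterSr.
Qed.

Lemma farey_parityD m n x :
  farey_parity (m + n) x = farey_parity m x (+) farey_parity n (iter m farey x).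
Proof.
elim: m x => [|m IH] x //=.
by rewrite IH addbA -iterSr.
Qed.

Lemma farey_A z : 0 <= z -> z <= 1 -> farey (z / (1 + z)) = z /\ (2^-1 < z / (1 + z)) = false.
Proof.
move=> z0 z1; have z1p : 0 < 1 + z by lra.
have le : z / (1 + z) <= 2^-1 by rewrite ler_pdivrMr //; lra.
rewrite /farey le ltNge le; split => //; field; rewrite gt_eqF //=; lra.
Qed.

Lemma farey_J z : 0 <= z -> z < 1 -> farey (1 + z)^-1 = z /\ 2^-1 < (1 + z)^-1.
Proof.
move=> z0 z1; have z1p : 0 < 1 + z by lra.
have lt : 2^-1 < (1 + z)^-1 by rewrite ltf_pV2 ?posrE; lra.
rewrite /farey leNgt lt; split => //=; field; rewrite gt_eqF //.
Qed.

(* Stripping letters from the left: a nonnegative matrix of determinant +-1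
   with a <= c and b <= d is a nonempty product of the two matrices of the
   inverse branches z/(1+z) and 1/(1+z). *)
Lemma farey_descent n (a b c d : nat) (e : bool) x z l :
  (c + d <= n)%N -> (a <= c)%N -> (b <= d)%N ->
  unimodular e a b c d ->
  0 < z -> z < 1 -> a%:R * z + b%:R = l * x -> c%:R * z + d%:R = l ->
  exists k, [/\ iter k.+1 farey x = z, farey_cocycle k.+1 x = l & farey_parity k.+1 x = e].
Proof.
elim: n a b c d e x l => [|n IH] a b c d e x l cdn ac bd det z0 z1 e1 e2.
  move: (unimodular_neq det) cdn; rewrite leqn0 addn_eq0 => h /andP[/eqP c0 /eqP d0].
  by rewrite c0 d0 !muln0 in h.
have det' := unimodular_neq det.
have ab : (0 < a + b)%N.
  by rewrite lt0n addn_eq0; apply: contra det' => /andP[/eqP -> /eqP ->].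
have cz : a%:R * z <= c%:R * z by rewrite ler_wpM2r ?(ltW z0) // ler_nat.
have bdR : b%:R <= d%:R :> R by rewrite ler_nat.
have abz : 0 < a%:R * z + b%:R.
  case: (posnP a) => a0; last by rewrite ltr_wpDr // mulr_gt0 // ltr0n.
  by rewrite ltr_wpDl ?mulr_ge0 ?(ltW z0) // ltr0n; move: ab; rewrite a0.
have l0 : 0 < l by rewrite -e2; lra.
have x0 : 0 < x by rewrite -(pmulr_rgt0 _ l0) -e1.
have l0' : l != 0 by rewrite gt_eqF.
have [A|nA] := boolP ((2 * a <= c) && (2 * b <= d))%N.
  case/andP: A => ac2 bd2.
  pose x' := x / (1 - x); pose l' := l * (1 - x).
  have l'E : l' = (c - a)%:R * z + (d - b)%:R.
    rewrite /l' mulrBr mulr1 -e1 -e2 !natrB //; ring.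
  have sub1 : (a <= c - a)%N by exact: half_sub.
  have sub2 : (b <= d - b)%N by exact: half_sub.
  have lt' : a%:R * z + b%:R <= l'.
    by rewrite l'E lerD ?ler_nat // ler_wpM2r ?(ltW z0) // ler_nat.
  have l'0 : 0 < l' by lra.
  have x1 : 0 < 1 - x by move: l'0; rewrite /l' pmulr_rgt0.
  have x1' : 1 - x != 0 by rewrite gt_eqF.
  have cd' : (c - a + (d - b) <= n)%N.
    by rewrite -ltnS; apply: leq_trans cdn; clear -ab ac bd; lia.
  have dt := unimodular_A ac bd det.
  have e1' : a%:R * z + b%:R = l' * x' by rewrite e1 /l' /x'; field.
  have [k [k1 k2 k3]] := IH a b (c - a)%N (d - b)%N e x' l'
    cd' sub1 sub2 dt z0 z1 e1' (esym l'E).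
  have x'0 : 0 <= x' by rewrite divr_ge0 // ltW.
  have x'1 : x' <= 1 by rewrite -(ler_pM2l l'0) mulr1 -e1'.
  have xE : x = x' / (1 + x') by rewrite /x'; field; rewrite x1' subrK oner_neq0.
  have [fx px] := farey_A x'0 x'1; rewrite -xE in fx px.
  exists k.+1; split.
  - by rewrite iterSr fx.
  - change ((1 + farey x) * farey_cocycle k.+1 (farey x) = l).
    by rewrite fx k2 /l' /x'; field.
  - change ((2^-1 < x) (+) farey_parity k.+1 (farey x) = e).
    by rewrite fx px k3.
have [J|nJ] := boolP ((c <= 2 * a) && (d <= 2 * b))%N.
  case/andP: J => ac2 bd2.
  pose x' := (1 - x) / x; pose l' := l * x.
  have x0' : x != 0 by rewrite gt_eqF.
  have l'E : l' = a%:R * z + b%:R by rewrite /l' e1.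
  have l'0 : 0 < l' by rewrite l'E.
  have sub1 : (c - a <= a)%N by exact: half_sub'.
  have sub2 : (d - b <= b)%N by exact: half_sub'.
  have e1' : (c - a)%:R * z + (d - b)%:R = l' * x'.
    transitivity (l - l * x); last by rewrite /l' /x'; field.
    by rewrite -e1 -e2 !natrB //; ring.
  have cd' : (a + b <= n)%N.
    rewrite -ltnS; apply: leq_trans cdn.
    rewrite ltn_neqAle leq_add // andbT; apply: contra det' => /eqP h.
    have [-> ->] : a = c /\ b = d by clear -h ac bd; lia.
    by rewrite mulnC.
  have dt := unimodular_J ac bd det.
  have [k [k1 k2 k3]] := IH (c - a)%N (d - b)%N a b (~~ e) x' l'
    cd' sub1 sub2 dt z0 z1 e1' (esym l'E).
  have x'0 : 0 <= x'.
    by rewrite -(pmulr_rge0 _ l'0) -e1' addr_ge0 // mulr_ge0 // ltW.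
  have x'1 : x' < 1.
    rewrite -(ltr_pM2l l'0) mulr1 -e1' l'E.
    have [h|ca] : (c - a < a)%N \/ (c - a = a)%N by clear -sub1; lia.
      by rewrite ltr_leD // ?ler_nat // ltr_pM2r // ltr_nat.
    have h : (d - b < b)%N.
      rewrite ltn_neqAle sub2 andbT; apply: contra det' => /eqP hb.
      have [-> ->] : c = (2 * a)%N /\ d = (2 * b)%N by clear -ca hb ac bd; lia.
      by rewrite mulnCA [(b * (2 * a))%N]mulnCA [(b * a)%N]mulnC.
    by rewrite ca ltrD2l ltr_nat.
  have xE : x = (1 + x')^-1 by rewrite /x'; field; rewrite x0' subrKC oner_neq0.
  have [fx px] := farey_J x'0 x'1; rewrite -xE in fx px.
  exists k.+1; split.
  - by rewrite iterSr fx.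
  - change ((1 + farey x) * farey_cocycle k.+1 (farey x) = l).
    by rewrite fx k2 /l' /x'; field.
  - change ((2^-1 < x) (+) farey_parity k.+1 (farey x) = e).
    by rewrite fx px k3 /= negbK.
exists 0%N.
have [c1 d1 ab1] := unimodular_base ac bd det nA nJ.
move: ab1; case: (e) => -[a1 b1]; last first.
  have xE : x = z / (1 + z).
    apply: (mulfI l0'); rewrite -e1 -e2 a1 b1 c1 d1; field; rewrite gt_eqF //; lra.
  have [fx px] := farey_A (ltW z0) (ltW z1); rewrite -xE in fx px.
  by split; rewrite /= ?fx ?px ?mulr1 // -e2 c1 d1 mul1r addrC.
have xE : x = (1 + z)^-1.
  apply: (mulfI l0'); rewrite -e1 -e2 a1 b1 c1 d1; field; rewrite gt_eqF //; lra.
have [fx px] := farey_J (ltW z0) z1; rewrite -xE in fx px.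
by split; rewrite /= ?fx ?px ?mulr1 // -e2 c1 d1 mul1r addrC.
Qed.

End FareyOrbits.

Lemma iter_periodic (T : Type) (f : T -> T) n k x : iter n f x = x -> iter (k * n) f x = x.
Proof. by move=> p; elim: k => [|k IH] //; rewrite mulSn iterD IH. Qed.

(** * Periodic points of the Farey and Gauss maps *)

Section PeriodicPoints.
Variable R : realType.
Implicit Types x z w l : R.
Notation fixx := (fix_x (@mu R)).
Notation fixy := (fix_y (@mu R)).
Notation farey := (@farey R).
Notation gauss := (@gauss R).

(** 0 is fixed and 1 maps to 0, so a periodic orbit through either would be that of 0. *)
Lemma periodic_orbit (f : R -> R) x : (forall y, 0 <= y <= 1 -> 0 <= f y <= 1) ->
  f 0 = 0 -> f 1 = 0 -> periodic_points f x -> forall i, 0 < iter i f x < 1.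
Proof.
move=> f01 f0 f1 [x01 x0 [n n0 px]].
have itv i : 0 <= iter i f x <= 1 by elim: i => [|i IH] //=; exact: f01.
have z0 m : iter m f 0 = 0 by elim: m => [|m IH] //=; rewrite IH.
have nz i : iter i f x != 0.
  apply/eqP => h; have := iter_periodic i px.
  have -> : (i * n = (i * n - i) + i)%N by rewrite subnK // leq_pmulr.
  by rewrite iterD h z0 => e; rewrite -e eqxx in x0.
move=> i; have /andP[h0 h1] := itv i.
rewrite lt_def h0 nz /= lt_def h1 andbT; apply/eqP => e.
by have := nz i.+1; rewrite iterS -e f1 eqxx.
Qed.

Lemma QF_orbit x : QF x -> forall i, 0 < iter i farey x < 1.
Proof.
apply: periodic_orbit; rewrite /farey.
- move=> y /andP[y0 y1]; case: ifP => h.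
    by rewrite divr_ge0 ?ler_pdivrMr /=; lra.
  move/negbT: h; rewrite -ltNge => h.
  by rewrite divr_ge0 ?ler_pdivrMr /=; lra.
- by rewrite ifT ?mul0r.
- by rewrite ifF ?subrr ?mul0r //; apply/negbTE; rewrite -ltNge; lra.
Qed.

Lemma QG_orbit x : QG x -> forall i, 0 < iter i gauss x < 1.
Proof.
apply: periodic_orbit; rewrite /gauss.
- move=> y /andP[y0 y1]; case: ifP => _; first by rewrite lexx ler01.
  have := floorD1_gt y^-1; rewrite intrD; have := floor_le y^-1.
  by move=> *; apply/andP; split; lra.
- by rewrite eqxx.
- by rewrite oner_eq0 invr1 -[1]/(1%:~R) intrKfloor subrr.
Qed.

Lemma farey_word n x : (0 < n)%N -> exists a b c d : nat, exists l,
  [/\ (a <= c)%N, (b <= d)%N, (a%:Z * d%:Z - b%:Z * c%:Z) ^+ 2 = 1,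
      a%:R * iter n farey x + b%:R = l * x & c%:R * iter n farey x + d%:R = l].
Proof.
have step y : exists a b : bool, [/\ (a || b), ~~ (a && b), 
    a%:R * farey y + b%:R = (1 + farey y) * y & True].
  rewrite /farey; case: ifP => h; [exists true, false|exists false, true]; split => //=.
    by field; rewrite subr_eq0; apply/eqP => e; move: h; rewrite -e; lra.
  by field; apply/eqP => e; move: h; rewrite e; lra.
case: n => // n _; elim: n x => [|n IH] x.
  have [a [b [ab nab e _]]] := step x.
  exists a, b, 1%N, 1%N, (1 + farey x); split => //=.
  - by case: a {nab e ab}.
  - by case: b {nab e ab}.
  - by move: ab nab {e}; case: a; case: b.
  - by rewrite mul1r addrC.
have [a [b [c [d [l [ac bd det e1 e2]]]]]] := IH (farey x).
have [s [t [st nst e _]]] := step x.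
exists (s * a + t * c)%N, (s * b + t * d)%N, (a + c)%N, (b + d)%N, (l * (1 + farey x)).
rewrite [iter n.+2 _ _]iterSr.
split.
- by move: st nst {e}; case: s; case: t => // _ _; rewrite !(mul0n, mul1n, addn0, add0n) ?leq_addr ?leq_addl.
- by move: st nst {e}; case: s; case: t => // _ _; rewrite !(mul0n, mul1n, addn0, add0n) ?leq_addr ?leq_addl.
- rewrite -det; move: st nst {e}; case: s; case: t => // _ _;
    rewrite !(mul0n, mul1n, addn0, add0n) !PoszD; ring.
- rewrite -mulrA -e mulrDr mulrCA -e1 !natrD !natrM -e2; ring.
- by rewrite mulrDr mulr1 -e1 -e2 !natrD; ring.
Qed.

Lemma exists_matrix x : QF x -> exists a c d, farey_matrix a c d /\ x = fixx a c d.
Proof.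
move=> xF; have orb := QF_orbit xF; case: xF => _ _ [n n0 px].
have /andP[x0 x1] := orb 0%N; rewrite /= in x0 x1.
have [a [b [c [d [l [ac bd det]]]]]] := farey_word x n0.
rewrite px => e1 e2.
(* The word of a period may have determinant -1; its square has determinant 1 and still fixes x. *)
pose a2 := (a * a + b * c)%N; pose b2 := (a * b + b * d)%N.
pose c2 := (c * a + d * c)%N; pose d2 := (c * b + d * d)%N.
have E1 : a2%:R * x + b2%:R = l ^+ 2 * x.
  transitivity (a%:R * (a%:R * x + b%:R) + b%:R * (c%:R * x + d%:R)).
    by rewrite /a2 /b2 !natrD !natrM; ring.
  by rewrite e1 e2; transitivity (l * (a%:R * x + b%:R)); [ring|rewrite e1; ring].
have E2 : c2%:R * x + d2%:R = l ^+ 2.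
  transitivity (c%:R * (a%:R * x + b%:R) + d%:R * (c%:R * x + d%:R)).
    by rewrite /c2 /d2 !natrD !natrM; ring.
  by rewrite e1 e2; transitivity (l * (c%:R * x + d%:R)); [ring|rewrite e2; ring].
have D2 : (a2 * d2 = b2 * c2 + 1)%N.
  suff : (a2%:Z * d2%:Z - b2%:Z * c2%:Z = 1) by lia.
  by rewrite -det /a2 /b2 /c2 /d2 !PoszD !PoszM; ring.
have ac2 : (a2 <= c2)%N by rewrite /a2 /c2 [(b * c)%N]mulnC [(d * c)%N]mulnC leq_add ?leq_mul.
have a20 : (0 < a2)%N by rewrite lt0n; apply/eqP => e; rewrite e mul0n addn1 in D2.
have d20 : (0 < d2)%N by rewrite lt0n; apply/eqP => e; rewrite e muln0 addn1 in D2.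
have c20 : (0 < c2)%N by apply: leq_trans ac2.
have b20 : (0 < b2)%N.
  rewrite lt0n; apply/eqP => b0; move: D2; rewrite b0 mul0n add0n => /eqP.
  rewrite muln_eq1 => /andP[/eqP a1 /eqP d1].
  rewrite a1 b0 mul1r addr0 in E1.
  have l1 : l ^+ 2 = 1 by apply: (mulIf (lt0r_neq0 x0)); rewrite -E1 mul1r.
  move: E2; rewrite l1 d1 -[RHS]add0r => /addIr /eqP.
  by rewrite mulf_eq0 pnatr_eq0 !gtn_eqF // gt_eqF.
have M : farey_matrix a2 c2 d2.
  by rewrite /farey_matrix a20 ac2 d20 D2 addn1 ltnS muln_gt0 b20 c20 -addn1 modnMDl eqxx.
exists a2, c2, d2; split => //.
by apply: (fix_unique M D2 x0); rewrite E1 E2.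
Qed.

Lemma matrix_orbit a c d : farey_matrix a c d -> exists k,
  [/\ iter k.+1 farey (fixx a c d) = fixx a c d,
      farey_cocycle k.+1 (fixx a c d) = (mu R (a + d))^-1 &
      farey_parity k.+1 (fixx a c d) = false].
Proof.
move=> M; have [b [b0 adE bd _]] := farey_matrix_b M.
have [_ _ e1 e2] := fix_eigen R M adE; have /andP[x0 x1] := fix_itv R M adE.
apply: (@farey_descent R (c + d) a b c d) => //; last exact/eqP.
  by case/and5P: M.
exact: ltnW.
Qed.

Lemma QF_fix a c d : farey_matrix a c d -> QF (fixx a c d).
Proof.
move=> M; have [b [b0 adE bd _]] := farey_matrix_b M.
have /andP[x0 x1] := fix_itv R M adE; have [k [k1 _ _]] := matrix_orbit M.
by split; [rewrite !ltW|rewrite gt_eqF|exists k.+1].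
Qed.

Lemma stab_orbit x l : QF x -> stab x l -> 1 < l -> exists k,
  [/\ iter k.+1 farey x = x, farey_cocycle k.+1 x = l & farey_parity k.+1 x = false].
Proof.
move=> xF S l1; have [a0 [c0 [d0 [M0 xE]]]] := exists_matrix xF.
have [a [c [d [M -> ->]]]] := matrix_of_stab M0 xE S l1.
exact: matrix_orbit.
Qed.

Definition digit z : nat := Num.truncn z^-1.

Lemma digit_itv z : 0 < z < 1 -> (0 < digit z)%N /\ (digit z)%:R <= z^-1 < (digit z).+1%:R.
Proof.
move=> /andP[z0 z1]; rewrite /digit.
have z' : 1 < z^-1 by rewrite invf_gt1.
have /truncn_itv -> : 0 <= z^-1 by lra.
split => //; rewrite truncn_gt0; lra.
Qed.

Lemma gauss_digit z : 0 < z < 1 -> gauss z = z^-1 - (digit z)%:R.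
Proof.
move=> z01; have [d0 dz] := digit_itv z01; case/andP: z01 => z0 z1.
rewrite /gauss gt_eqF //; congr (_ - _).
suff -> : Num.floor z^-1 = (digit z)%:Z by [].
by apply: floor_def; rewrite -natr1 in dz *; rewrite intrD.
Qed.

(** On [0, 1/2] the Farey map subtracts 1 from 1/z; on (1/2, 1] it sends z to 1/z - 1. A Gauss step
    with digit a is thus a - 1 steps on the left branch and one on the right. *)
Lemma gauss_excursion a z : (0 < a)%N -> 0 < z -> a%:R <= z^-1 < a.+1%:R ->
  [/\ iter a farey z = z^-1 - a%:R, farey_cocycle a z = z^-1,
      farey_parity a z = true, 2^-1 < iter a.-1 farey z &
      forall j, 2^-1 < iter j farey z -> (a <= j.+1)%N].
Proof.
case: a => // a _; elim: a z => [|a IH] z z0 /andP[za az].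
  have z2 : 2^-1 < z.
    by rewrite -[ltRHS]invrK ltf_pV2 ?posrE ?invr_gt0.
  have fz : farey z = z^-1 - 1 by rewrite /farey leNgt z2 /=; field; rewrite gt_eqF.
  split => //=; first by rewrite fz mulr1; ring.
  by rewrite z2.
have z2 : z <= 2^-1.
  rewrite -[leLHS]invrK lef_pV2 ?posrE ?invr_gt0 //; apply: le_trans za.
  by rewrite (ler_nat _ 2).
have z1 : 0 < 1 - z by lra.
have fz : farey z = z / (1 - z) by rewrite /farey z2.
have fzV : (farey z)^-1 = z^-1 - 1 by rewrite fz; field; rewrite !gt_eqF.
have fz0 : 0 < farey z by rewrite fz divr_gt0.
have [|h1 h2 h3 h4 h5] := IH (farey z) fz0.
  rewrite fzV; move: za az; rewrite -![_.+2%:R]natr1 -![_.+1%:R]natr1 => za az.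
  by apply/andP; split; lra.
have n2 : (2^-1 < z) = false by rewrite ltNge z2.
split.
- by rewrite iterSr h1 fzV -[a.+2%:R]natr1; ring.
- change ((1 + farey z) * farey_cocycle a.+1 (farey z) = z^-1).
  by rewrite h2 fzV fz; field; rewrite !gt_eqF.
- change ((2^-1 < z) (+) farey_parity a.+1 (farey z) = true).
  by rewrite h3 n2.
- by rewrite /= -iterS iterSr.
- by case=> [|j]; [rewrite /= n2|rewrite iterSr => /h5].
Qed.

Lemma gauss_farey z : 0 < z < 1 ->
  [/\ iter (digit z) farey z = gauss z, farey_cocycle (digit z) z = z^-1,
      farey_parity (digit z) z = true, 2^-1 < iter (digit z).-1 farey z &
      forall j, 2^-1 < iter j farey z -> (digit z <= j.+1)%N].
Proof.
move=> z01; have [d0 dz] := digit_itv z01; rewrite gauss_digit //.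
by apply: gauss_excursion => //; case/andP: z01.
Qed.

(* A Farey orbit segment that ends just after a visit to (1/2, 1] is a
   concatenation of Gauss steps. *)
Lemma farey_segment n z : (forall i, 0 < iter i farey z < 1) -> 2^-1 < iter n farey z ->
  exists m, [/\ iter m.+1 gauss z = iter n.+1 farey z,
    \prod_(j < m.+1) (iter j gauss z)^-1 = farey_cocycle n.+1 z &
    odd m.+1 = farey_parity n.+1 z].
Proof.
elim/ltn_ind: n z => n IH z orb hn.
have z01 := orb 0%N; rewrite /= in z01.
have [g1 g2 g3 g4 g5] := gauss_farey z01; have [d0 _] := digit_itv z01.
have := g5 n hn; rewrite leq_eqVlt => /orP[/eqP dn|dn].
  exists 0%N; rewrite big_ord_recl big_ord0 mulr1 -dn g1 g2 g3 /=; split => //.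
have En : (n.+1 = digit z + (n - digit z).+1)%N by lia.
have En' : (n = (n - digit z) + digit z)%N by lia.
have lt : (n - digit z < n)%N by clear -d0 dn; lia.
have orb' i : 0 < iter i farey (gauss z) < 1 by rewrite -g1 -iterD.
have hn' : 2^-1 < iter (n - digit z) farey (gauss z) by rewrite -g1 -iterD -En'.
have [m [h1 h2 h3]] := IH _ lt _ orb' hn'.
exists m.+1; rewrite En farey_cocycleD farey_parityD g1 g2 g3; split.
- by rewrite iterSr h1 addnC iterD g1.
- rewrite -h2 big_ord_recl; congr (_ * _); apply: eq_bigr => j _.
  by rewrite lift0 iterSr.
- by rewrite -h3.
Qed.

Lemma gauss_iter_farey p w : (forall i, 0 < iter i gauss w < 1) ->
  exists n, iter n.+1 farey w = iter p.+1 gauss w /\ 2^-1 < iter n farey w.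
Proof.
move=> orb; elim: p => [|p [n [IH _]]].
  have w01 := orb 0%N; have [g1 _ _ g4 _] := gauss_farey w01.
  have [d0 _] := digit_itv w01.
  by exists (digit w).-1; rewrite prednK.
have z01 := orb p.+1; have [g1 _ _ g4 _] := gauss_farey z01.
have [d0 _] := digit_itv z01.
exists ((digit (iter p.+1 gauss w)).-1 + n.+1)%N.
rewrite -addSn prednK // !iterD IH g4; split => //.
Qed.

Lemma QG_QF w : QG w -> QF w.
Proof.
move=> wG; have orb := QG_orbit wG; case: wG => w01 w0 [[//|p] _ pw].
have [n [h _]] := gauss_iter_farey p orb.
by split => //; exists n.+1 => //; rewrite h.
Qed.

(** Some period L + 1 ends with a visit to (1/2, 1]. The times L (n + 1) + n and n (L + 1) + L
    coincide, so both periods have the same last point. *)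
Lemma QG_farey_period w n : QG w -> iter n.+1 farey w = w -> 2^-1 < iter n farey w.
Proof.
move=> wG pn; have orb := QG_orbit wG; case: wG => w01 w0 [[//|p] _ pw].
have [L [pL hL]] := gauss_iter_farey p orb; rewrite pw in pL.
have E m k : iter m.+1 farey w = w -> iter m farey w = iter ((k * m.+1) + m) farey w.
  by move=> pm; rewrite addnC iterD iter_periodic.
rewrite (E n L pn); have -> : (L * n.+1 + n = n * L.+1 + L)%N by lia.
by rewrite -(E L n pL).
Qed.

Lemma stab_gauss_period w l : QG w -> stab w l -> 1 < l -> exists m,
  [/\ (0 < m)%N, ~~ odd m, iter m gauss w = w & \prod_(j < m) (iter j gauss w)^-1 = l].
Proof.
move=> wG S l1; have wF := QG_QF wG.
have [k [k1 k2 k3]] := stab_orbit wF S l1.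
have [m [m1 m2 m3]] := farey_segment (QF_orbit wF) (QG_farey_period wG k1).
by exists m.+1; rewrite m3 k3 m1 m2.
Qed.

(** An orbit confined to [0, 1/2] would lower 1/x by 1 forever. Just after a visit to (1/2, 1] it is
    at a Gauss periodic point, and completing periods leads back to x. *)
Lemma QF_QG x : QF x -> exists w k, QG w /\ x = iter k farey w.
Proof.
move=> xF; have orb := QF_orbit xF; case: (xF) => x01 x0 [[//|n] _ pn].
have /andP[xp _] := orb 0%N.
have [i hi] : exists i, 2^-1 < iter i farey x.
  apply/not_existsP => H.
  have low i : (iter i farey x)^-1 = x^-1 - i%:R.
    elim: i => [|i IH]; first by rewrite subr0.
    have /negP := H i; rewrite -leNgt => h; have /andP[p0 _] := orb i.
    rewrite iterS /Defs.farey h -[i.+1%:R]natr1 opprD addrA -IH; field.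
    by rewrite !gt_eqF //; lra.
  have := low (Num.truncn x^-1).+1; have /andP[p0 _] := orb (Num.truncn x^-1).+1.
  move=> e; have : 0 < x^-1 - (Num.truncn x^-1).+1%:R by rewrite -e invr_gt0.
  by rewrite subr_gt0 ltNge ltW // truncnS_gt.
pose w := iter i.+1 farey x.
have pw : iter n.+1 farey w = w by rewrite /w -iterD addnC iterD pn.
have hw : 2^-1 < iter n farey w.
  rewrite /w -iterD; have -> : (n + i.+1 = i + n.+1)%N by lia.
  by rewrite iterD pn.
have orbw j : 0 < iter j farey w < 1 by rewrite /w -iterD.
have [m [m1 _ _]] := farey_segment orbw hw.
have /andP[w0 w1] := orbw 0%N.
exists w, (n * i.+1)%N; split.
  split; [by rewrite !ltW|by rewrite gt_eqF|exists m.+1 => //].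
  by rewrite m1.
rewrite /w -iterD; have -> : (n * i.+1 + i.+1 = i.+1 * n.+1)%N by lia.
by rewrite iter_periodic.
Qed.

End PeriodicPoints.

(** * Periodic continued fractions *)

Section ContinuedFractions.
Variable R : realType.
Implicit Types x z w l : R.
Notation fixx := (fix_x (@mu R)).
Notation fixy := (fix_y (@mu R)).
Notation farey := (@farey R).
Notation gauss := (@gauss R).
Notation pos := (all (fun d => 0 < d)%N).

Lemma cf_fin_mkseqS (a : nat -> nat) n :
  cf_fin R (mkseq a n.+1) = ((a 0%N)%:R + cf_fin R (mkseq (fun i => a i.+1) n))^-1.
Proof.
rewrite /mkseq /= -[1%N]/(1 + 0)%N iotaDl -map_comp /=.
by rewrite /cf_fin /=.
Qed.

Section Expansion.
Variables (a : nat -> nat) (y : nat -> R).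
Hypothesis a0 : forall n, (0 < a n)%N.
Hypothesis y01 : forall n, 0 <= y n <= 1.
Hypothesis ya : forall n, y n * ((a n)%:R + y n.+1) = 1.

Lemma cf_fin_ge0 k n : 0 <= cf_fin R (mkseq (fun i => a (k + i)) n).
Proof.
elim: n k => [|n IH] k; first by rewrite /cf_fin /=.
rewrite cf_fin_mkseqS; under eq_mkseq => i do rewrite addnS -addSn.
by rewrite invr_ge0 addr_ge0.
Qed.

(* Two steps contract by y k y (k+1) <= 1/2. *)
Lemma cf_error n k : `|cf_fin R (mkseq (fun i => a (k + i)) n) - y k| <= 3 / n.+3%:R.
Proof.
have step j u : 0 <= u -> `|((a j)%:R + u)^-1 - y j| <= y j * `|u - y j.+1|.
  move=> u0; have /andP[v0 v1] := y01 j.+1; have /andP[w0 w1] := y01 j.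
  have a1 : 1 <= (a j)%:R :> R by rewrite ler1n.
  have au : 0 < (a j)%:R + u by lra.
  have av : 0 < (a j)%:R + y j.+1 by lra.
  have yE : y j = ((a j)%:R + y j.+1)^-1 
    by apply: (mulIf (lt0r_neq0 av)); rewrite ya mulVf ?gt_eqF.
  have -> : ((a j)%:R + u)^-1 - y j = ((a j)%:R + u)^-1 * (y j * (y j.+1 - u)).
    by rewrite yE; field; rewrite !gt_eqF.
  rewrite normrM (gtr0_norm (_ : 0 < _^-1)) ?invr_gt0 // normrM (ger0_norm w0) distrC.
  rewrite ler_piMl ?mulr_ge0 // invf_le1 //; lra.
elim/ltn_ind: n k => -[|[|n]] IH k.
- rewrite /cf_fin /= sub0r normrN divff ?pnatr_eq0 //.
  by have /andP[h0 h1] := y01 k; rewrite ger0_norm.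
- rewrite cf_fin_mkseqS /cf_fin /= !addn0; apply: le_trans (step _ _ _) _ => //.
  rewrite sub0r normrN; have /andP[v0 v1] := y01 k.+1; have /andP[w0 w1] := y01 k.
  rewrite ger0_norm //; have := ya k.
  have a1 : 1 <= (a k)%:R :> R by rewrite ler1n.
  have : y k <= y k * (a k)%:R by rewrite ler_peMr.
  rewrite mulrDr => h e; have -> : 4%:R = 4 :> R by []. nra.
- rewrite cf_fin_mkseqS; under eq_mkseq => i do rewrite addnS -addSn.
  rewrite addn0; apply: le_trans (step _ _ (cf_fin_ge0 _ _)) _.
  rewrite cf_fin_mkseqS; under eq_mkseq => i do rewrite addnS -addSn.
  rewrite addn0.
  have /andP[v0 v1] := y01 k.+1; have /andP[w0 w1] := y01 k.
  have s2 := step k.+1 _ (cf_fin_ge0 k.+2 n).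
  have ih := IH n (ltnW (ltnSn n.+1)) k.+2.
  apply: le_trans (ler_wpM2l w0 (le_trans s2 (ler_wpM2l v0 ih))) _.
  have half : y k * y k.+1 <= 2^-1.
    have := ya k; have a1 : 1 <= (a k)%:R :> R by rewrite ler1n.
    have : y k <= y k * (a k)%:R by rewrite ler_peMr.
    rewrite mulrDr => h e; nra.
  (* The rate 3 / (n + 3) is 1 for n = 0 and loses at most half of its value in two steps, since n +
     5 <= 2 (n + 3). *)
  rewrite mulrA; apply: (@le_trans _ _ (2^-1 * (3 / n.+3%:R))).
    by rewrite ler_wpM2r // divr_ge0.
  have n0 : 0 <= n%:R :> R by [].
  have -> : n.+3%:R = n%:R + 3 :> R by rewrite -addn3 natrD.
  have -> : n.+2.+3%:R = n%:R + 5 :> R by rewrite -natrD addnC.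
  rewrite ler_pdivlMr; last lra.
  have -> : 2^-1 * (3 / (n%:R + 3)) * (n%:R + 5) = 3 * ((n%:R + 5) / (2 * (n%:R + 3))) :> R.
    by field; rewrite gt_eqF //; lra.
  by rewrite ler_piMr // ler_pdivrMr ?mul1r; lra.
Qed.

Lemma cf_eq : cf R a = y 0%N.
Proof.
apply: cvg_lim => //; apply/cvgrPdist_le => e e0.
exists (Num.truncn (3 / e)) => //= n ne.
rewrite distrC; apply: le_trans (cf_error n 0) _.
rewrite ler_pdivrMr ?ltr0n // mulrC -ler_pdivrMr //.
apply: ltW; apply: lt_le_trans (truncnS_gt _) _; rewrite ler_nat.
by rewrite ltnS; apply: leq_trans ne _; lia.
Qed.

End Expansion.

Definition phi (s : seq nat) z : R := foldr (fun d x => (d%:R + x)^-1) z s.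

Lemma phi_itv s z : pos s -> 0 < z < 1 -> 0 < phi s z < 1.
Proof.
move=> + z01; elim: s => [|d s IH] //= /andP[d0 /IH /andP[v0 v1]].
have d1 : 1 <= d%:R :> R by rewrite ler1n.
by rewrite invr_gt0 invf_lt1; lra.
Qed.

Lemma gauss_inv d v : (0 < d)%N -> 0 < v < 1 -> gauss (d%:R + v)^-1 = v.
Proof.
move=> d0 /andP[v0 v1]; have d1 : 1 <= d%:R :> R by rewrite ler1n.
rewrite /Defs.gauss invr_eq0 gt_eqF; last lra.
rewrite invrK (_ : Num.floor _ = d%:Z); first by rewrite addrAC subrr add0r.
by apply: floor_def; rewrite intrD; apply/andP; split; lra.
Qed.

Lemma iter_gauss_phi s z : pos s -> 0 < z < 1 -> iter (size s) gauss (phi s z) = z.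
Proof.
move=> + z01; elim: s => [|d s IH] // /andP[d0 s0].
by rewrite [size _]/= iterSr [phi _ _]/= gauss_inv ?IH // phi_itv.
Qed.

Lemma phi_orbit s z n : pos s -> s != [::] -> 0 < z < 1 -> phi s z = z ->
  let y n := phi (drop (n %% size s) s) z in
  [/\ (0 < nth 0 s (n %% size s))%N, 0 < y n < 1 &
      y n * ((nth 0%N s (n %% size s))%:R + y n.+1) = 1].
Proof.
move=> s0 sn z01 pz y.
have m0 : (0 < size s)%N by case: s sn {s0 pz y}.
have lt k : (k %% size s < size s)%N by rewrite ltn_mod.
have y01 k : 0 < y k < 1 by apply: phi_itv => //; apply/allP => d /mem_drop; apply/allP.
split=> //; first by move/allP: s0; apply; rewrite mem_nth.
rewrite {1}/y (drop_nth 0%N (lt n)) /=.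
suff -> : phi (drop (n %% size s).+1 s) z = y n.+1.
  by have /andP[h0 h1] := y01 n.+1; rewrite mulVf // gt_eqF // ltr_wpDl.
rewrite /y; have [h|h] := ltnP (n %% size s).+1 (size s).
  have -> // : (n.+1 %% size s = (n %% size s).+1)%N.
  by rewrite -addn1 -modnDml addn1 modn_small.
have e : (n %% size s).+1 = size s by apply/eqP; rewrite eqn_leq h lt.
have -> : (n.+1 %% size s = 0)%N by rewrite -addn1 -modnDml addn1 e modnn.
by rewrite e drop_size drop0.
Qed.

Lemma cf_per_phi s z : pos s -> s != [::] -> 0 < z < 1 -> phi s z = z -> cf_per R s = z.
Proof.
move=> s0 sn z01 pz; rewrite /cf_per /cf_pre.
have orb n := phi_orbit n s0 sn z01 pz.
have -> : z = phi (drop (0 %% size s) s) z by rewrite mod0n drop0.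
apply: (cf_eq (y := fun n => phi (drop (n %% size s) s) z)) => n;
  have [h1 h2 h3] := orb n; rewrite /preperiodic /= ?subn0 //.
by have /andP[/ltW -> /ltW] := h2.
Qed.

(* The entries (p, q; r, u) of the product of the matrices (0, 1; 1, d). *)
Fixpoint wmat (s : seq nat) : nat * nat * nat * nat :=
  if s is d :: s' then
    let: (p, q, r, u) := wmat s' in (r, u, p + d * r, q + d * u)%N
  else (1, 0, 0, 1)%N.

Lemma wmat_rcons s d : wmat (rcons s d) =
  let: (p, q, r, u) := wmat s in (q, p + d * q, u, r + d * u)%N.
Proof.
elim: s => [|e s IH] /=; first by rewrite !muln0 !muln1 !addn0 !add0n.
rewrite IH; case: (wmat s) => [[[p q] r] u]; congr (_, _, _, _); ring.
Qed.

(** Every factor (0, 1; 1, d) is symmetric, so reversing the word transposes the product. This ties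
    the reversed expansion of the dual point to the matrix of x. *)
Lemma wmat_rev s : wmat (rev s) = let: (p, q, r, u) := wmat s in (p, r, q, u).
Proof.
elim: s => [|d s IH] //=; rewrite rev_cons wmat_rcons IH.
by case: (wmat s) => [[[p q] r] u]; congr (_, _, _, _); ring.
Qed.

Lemma wmat_act s z : pos s -> 0 <= z -> let: (p, q, r, u) := wmat s in
  0 < r%:R * z + u%:R /\ p%:R * z + q%:R = (r%:R * z + u%:R) * phi s z.
Proof.
move=> + z0; elim: s => [|d s IH] /=; first by rewrite !mul0r !add0r !mul1r addr0.
move=> /andP[d0 /IH]; case: (wmat s) => [[[p q] r] u] [l0 e].
have d1 : 1 <= d%:R :> R by rewrite ler1n.
have f0 : 0 <= phi s z.
  by rewrite -(pmulr_rge0 _ l0) -e addr_ge0 ?mulr_ge0.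
have E : (p + d * r)%:R * z + (q + d * u)%:R = (r%:R * z + u%:R) * (d%:R + phi s z).
  by rewrite mulrDr -e !natrD !natrM; ring.
rewrite E; split; first by rewrite mulr_gt0 //; lra.
by rewrite mulfK // gt_eqF //; lra.
Qed.

Lemma wmat_pos s : pos s -> s != [::] -> let: (p, q, r, u) := wmat s in
  [/\ 0 < q, 0 < r & 0 < u]%N.
Proof.
elim: s => [|d s IH] //= /andP[d0 s0] _.
case: s IH s0 => [|e s] IH s0; first by rewrite /= muln0 muln1 add0n addn0.
have := IH s0 isT; case: (wmat _) => [[[p q] r] u] [q0 r0 u0].
by rewrite !addn_gt0 !muln_gt0 d0 q0 r0 u0 !orbT.
Qed.

(** The fixed point is the positive root of r z^2 + (u - p) z - q, available because q and r are
    positive. *)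
Lemma phi_fix s : pos s -> s != [::] -> exists2 z, 0 < z < 1 & phi s z = z.
Proof.
move=> s0 sn; have := wmat_pos s0 sn; have act := @wmat_act s _ s0.
case: (wmat s) act => [[[p q] r] u] act [q0 r0 u0].
have rp : 0 < r%:R :> R by rewrite ltr0n.
have qp : 0 < q%:R :> R by rewrite ltr0n.
pose D : R := (p%:R - u%:R) ^+ 2 + 4 * (r%:R * q%:R).
have D0 : 0 <= D by rewrite addr_ge0 ?sqr_ge0 // !mulr_ge0.
pose z : R := (p%:R - u%:R + Num.sqrt D) / (2 * r%:R).
have root : r%:R * z ^+ 2 + (u%:R - p%:R) * z - q%:R = 0.
  transitivity ((Num.sqrt D ^+ 2 - D) / (4 * r%:R)); last by rewrite sqr_sqrtr // subrr mul0r.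
  by rewrite /z /D; field; rewrite gt_eqF.
have z0 : 0 < z.
  rewrite divr_gt0 ?mulr_gt0 //.
  have : `|p%:R - u%:R| < Num.sqrt D.
    rewrite -(@ltr_pXn2r _ 2) ?nnegrE ?normr_ge0 ?sqrtr_ge0 //.
    rewrite sqr_sqrtr // real_normK ?num_real // /D ltrDl.
    by rewrite !mulr_gt0.
  by rewrite ltr_norml => /andP[h _]; lra.
have [l0 e] := act z (ltW z0).
have pz : phi s z = z.
  by apply: (mulfI (lt0r_neq0 l0)); rewrite -e; apply/eqP; rewrite -subr_eq0 -oppr_eq0 -root; apply/eqP; ring.
exists z => //; rewrite z0 /=.
case: s s0 sn pz {act l0 e} => [|d s] //= /andP[d0 s0] _ pz.
have f0 : 0 < phi s z.
  elim: s s0 {pz} => [|d' s IH] //= /andP[d'0 /IH h].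
  by rewrite invr_gt0 ltr_wpDl.
have d1 : 1 <= d%:R :> R by rewrite ler1n.
by rewrite -pz invf_lt1; lra.
Qed.

Lemma cf_per_fix s : pos s -> s != [::] -> 0 < cf_per R s < 1 /\ phi s (cf_per R s) = cf_per R s.
Proof.
move=> s0 sn; have [z z01 pz] := phi_fix s0 sn.
by rewrite (cf_per_phi s0 sn z01 pz).
Qed.

Lemma gauss_expand z : 0 < z < 1 -> z * ((digit z)%:R + gauss z) = 1.
Proof.
move=> z01; rewrite gauss_digit // addrCA subrr addr0 mulfV //.
by case/andP: z01 => h _; rewrite gt_eqF.
Qed.

Lemma gauss_cf_per w m : (forall i, 0 < iter i gauss w < 1) -> (0 < m)%N ->
  iter m gauss w = w -> cf_per R (mkseq (fun j => digit (iter j gauss w)) m) = w.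
Proof.
move=> orb m0 pw; rewrite /cf_per /cf_pre.
pose y n := iter n gauss w; have -> : w = y 0%N by [].
have per n : iter (n %% m) gauss w = iter n gauss w.
  by rewrite [in RHS](divn_eq n m) addnC iterD iter_periodic.
have dE n : preperiodic [::] (mkseq (fun j => digit (iter j gauss w)) m) n = digit (y n).
  by rewrite /preperiodic /= size_mkseq subn0 nth_mkseq ?ltn_mod // per.
apply: cf_eq => n; rewrite ?dE.
- by have [] := digit_itv (orb n).
- by have /andP[h0 h1] := orb n; rewrite !ltW.
- exact: (gauss_expand (orb n)).
Qed.

Lemma even_periodP w m : QG w ->
  even_period w m <-> [/\ (0 < m)%N, ~~ odd m & iter m gauss w = w].
Proof.
move=> wG; split => [[m0 mo [s [sm s0 wE]]]|[m0 mo pw]].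
  have sn : s != [::] by case: s sm {s0 wE} => // e; rewrite -e in m0.
  have [z01 pz] := cf_per_fix s0 sn; split => //.
  by rewrite wE -[in LHS]pz -sm iter_gauss_phi.
have orb := QG_orbit wG; split => //.
exists (mkseq (fun j => digit (iter j gauss w)) m); split.
- by rewrite size_mkseq.
- by apply/allP => d /mapP[j _ ->]; have [] := digit_itv (orb j).
- by rewrite gauss_cf_per.
Qed.

Lemma min_even_periodP w : QG w -> let m := min_even_period w in
  [/\ (0 < m)%N, ~~ odd m, iter m gauss w = w & forall m', (0 < m')%N -> ~~ odd m' ->
      iter m' gauss w = w -> (m <= m')%N].
Proof.
move=> wG m; have [_ _ [p p0 pw]] := wG.
have ex : exists n, `[< even_period w n >].
  exists (2 * p)%N; apply/asboolP/even_periodP => //; split.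
  - by rewrite muln_gt0.
  - by rewrite oddM.
  - exact: iter_periodic.
have [/even_periodP [] // h1 h2 h3 h4] : [set m | even_period w m /\
    forall m', even_period w m' -> (m <= m')%N] m.
  apply: xgetPex; exists (ex_minn ex); case: ex_minnP => n /asboolP hn hmin.
  by split => // m' hm'; apply: hmin; apply/asboolP.
by split => // m' h1' h2' h3'; apply: h4; apply/even_periodP.
Qed.

Definition gauss_prod m w : R := \prod_(j < m) (iter j gauss w)^-1.

(** Each Gauss step inverts a matrix (0, 1; 1, digit) of determinant -1, so even periods are those
    with a matrix in SL_2(Z). *)
Lemma gauss_prod_stab m w : (forall i, 0 < iter i gauss w < 1) -> exists a b c d : int,
  [/\ a * d - b * c = (-1) ^+ m, a%:~R * iter m gauss w + b%:~R = gauss_prod m w * w &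
      c%:~R * iter m gauss w + d%:~R = gauss_prod m w].
Proof.
elim: m w => [|m IH] w orb.
  exists 1, 0, 0, 1; rewrite /gauss_prod big_ord0 /= ?mulr0 ?subr0 ?mul1r ?mulr1 ?mul0r.
  by rewrite addr0 add0r.
have orb' i : 0 < iter i gauss (gauss w) < 1 by rewrite -iterSr.
have [a [b [c [d [D e1 e2]]]]] := IH (gauss w) orb'.
have P : gauss_prod m.+1 w = w^-1 * gauss_prod m (gauss w).
  rewrite /gauss_prod big_ord_recl; congr (_ * _); apply: eq_bigr => j _.
  by rewrite lift0 iterSr.
have w01 : 0 < w < 1 := orb 0%N; have ex := gauss_expand w01.
have w0 : w != 0 by case/andP: w01 => h _; rewrite gt_eqF.
have wV : w^-1 = (digit w)%:R + gauss w 
    by apply: (mulfI w0); rewrite ex mulfV.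
exists c, d, (a + (digit w)%:Z * c), (b + (digit w)%:Z * d); rewrite P iterSr; split.
- by rewrite exprS -D; ring.
- by rewrite e2 mulrAC mulVf // mul1r.
- by rewrite wV mulrDl [gauss w * _]mulrC -e1 -e2 !intrD !intrM; ring.
Qed.

Lemma gauss_prod_gt1 m w : (forall i, 0 < iter i gauss w < 1) -> (0 < m)%N -> 1 < gauss_prod m w.
Proof.
move=> orb; case: m => // m _; elim: m => [|m IH].
  by rewrite /gauss_prod big_ord_recl big_ord0 mulr1; have /andP[h0 h1] := orb 0%N; rewrite invf_gt1.
rewrite /gauss_prod big_ord_recr /= -/(gauss_prod m.+1 w).
have /andP[h0 h1] := orb m.+1; rewrite /= in h0 h1.
by rewrite -[ltLHS]mul1r ltr_pM // ?invf_gt1.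
Qed.

Lemma gauss_prod_le m m' w : (forall i, 0 < iter i gauss w < 1) -> (m <= m')%N ->
  gauss_prod m w <= gauss_prod m' w.
Proof.
move=> orb mm; rewrite -(subnK mm); elim: (m' - m)%N => [|n IH]; first by rewrite add0n.
apply: le_trans IH _; rewrite addSn /gauss_prod [leRHS]big_ord_recr /=.
have /andP[h0 h1] := orb (n + m)%N.
rewrite ler_peMr ?invf_ge1 ?(ltW h1) //.
by apply: prodr_ge0 => j _; rewrite invr_ge0; have /andP[h _] := orb j; exact: ltW.
Qed.

Lemma ln_gauss_prod m w : (forall i, 0 < iter i gauss w < 1) ->
  ln (gauss_prod m w) = - \sum_(0 <= j < m) ln (iter j gauss w).
Proof.
move=> orb; elim: m => [|m IH]; first by rewrite /gauss_prod big_ord0 ln1 big_geq // oppr0.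
rewrite /gauss_prod big_ord_recr /= -/(gauss_prod m w) big_nat_recr //= opprD -IH.
have /andP[h0 _] := orb m.
rewrite lnM ?posrE ?invr_gt0 // ?lnV ?posrE //.
by apply: prodr_gt0 => j _; rewrite invr_gt0; have /andP[h _] := orb j.
Qed.

Definition min_stab x l :=
  [/\ stab x l, 1 < l & forall l', stab x l' -> 1 < l' -> l <= l'].

(** [gauss_prod] increases with the period, and every eigenvalue l > 1 of the stabilizer is
    [gauss_prod] over some even period; the least even period therefore yields the least l. *)
Lemma lengthG_min w : QG w -> exists2 l, min_stab w l & lengthG w = 2 * ln l.
Proof.
move=> wG; have orb := QG_orbit wG; have [m0 mo pw mmin] := min_even_periodP wG.
set m := min_even_period w in m0 mo pw mmin.
exists (gauss_prod m w).
  split; last first.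
  - move=> l' S l1; have [m' [h1 h2 h3 <-]] := stab_gauss_period wG S l1.
    by apply: gauss_prod_le => //; exact: mmin.
  - exact: gauss_prod_gt1.
  have [a [b [c [d [D e1 e2]]]]] := gauss_prod_stab m orb.
  exists a, b, c, d; rewrite pw in e1 e2; split => //.
  by rewrite D -signr_odd (negbTE mo).
rewrite /lengthG -/m ln_gauss_prod // mulrN mulNr; congr (- (_ * _)).
(* [lengthG] sums over j = 1, ..., m while the product runs over j = 0, ..., m - 1; periodicity
   identifies the two ends. *)
rewrite big_nat_recr //= pw big_add1 /= [in RHS]big_ltn // addrC; congr (_ + _).
case: (m) m0 => // n _; by rewrite /= [RHS]big_add1.
Qed.

Lemma stab_iter x k l : (forall i, 0 < iter i farey x < 1) ->
  stab (iter k farey x) l <-> stab x l.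
Proof.
move=> orb; elim: k => [|k IH] //.
by rewrite iterS; split => [/stab_farey|] h; [apply/IH; apply: h|apply/stab_farey => //; apply/IH].
Qed.

(** [stab] is constant along Farey orbits, so the value does not depend on the w picked by
    [xget]. *)
Lemma length_min x : QF x -> exists2 l, min_stab x l & length x = 2 * ln l.
Proof.
move=> xF; have [w [k [wG xE]]] := QF_QG xF.
have key w' k' : QG w' -> x = iter k' farey w' -> forall l, stab w' l <-> stab x l.
  move=> wG' -> l; have [h1 h2] := stab_iter k' l (QF_orbit (QG_QF wG')); by split.
have : [set l | exists w k, [/\ QG w, x = iter k farey w & l = lengthG w]] (length x).
  by apply: xgetPex; exists (lengthG w), w, k.
move=> [w' [k' [wG' xE' ->]]]; have [l [l1 l2 l3] ->] := lengthG_min wG'.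
have K := key w' k' wG' xE'; exists l => //; split => //; first exact/K.
by move=> l' /K; exact: l3.
Qed.

End ContinuedFractions.

(** * Dual points as conjugate fixed points *)

Section Duals.
Variable R : realType.
Implicit Types x z w l : R.
Notation fixx := (fix_x (@mu R)).
Notation fixy := (fix_y (@mu R)).
Notation farey := (@farey R).
Notation gauss := (@gauss R).
Notation pos := (all (fun d => 0 < d)%N).

Lemma cf_pre1 e s : (0 < e)%N -> pos s -> s != [::] ->
  cf_pre R [:: e] s = (e%:R + cf_per R s)^-1.
Proof.
move=> e0 s0 sn; have [z01 pz] := cf_per_fix R s0 sn.
set z := cf_per R s in z01 pz *.
have orb n := phi_orbit n s0 sn z01 pz.
have e1 : 1 <= e%:R :> R by rewrite ler1n.
have /andP[z0 z1] := z01.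
apply: (cf_eq (y := fun n => if n is m.+1 then phi (drop (m %% size s) s) z else (e%:R + z)^-1)) => -[|n].
- by rewrite /preperiodic.
- by have [h1 h2 h3] := orb n; rewrite /preperiodic /= subn1.
- by rewrite invr_ge0 invf_le1; lra.
- by have [h1 /andP[/ltW -> /ltW]] := orb n.
- by rewrite /preperiodic /= mod0n drop0 pz mulVf // gt_eqF //; lra.
- by have [h1 h2 h3] := orb n; rewrite /preperiodic /= subn1.
Qed.

(** Let V = 1/x + k = a1 + Z, so that 1/V has a purely periodic expansion. The transposed matrix
    shows that -Y is the conjugate of V, hence -(Y + k) that of 1/x. The conjugate of 1/x is also -c
    x / b, and y = 1 / (1 + k + Y) = b / (b + c x) follows. *)
Lemma is_dual_fix a c d y : farey_matrix a c d -> is_dual (fixx a c d) y -> y = fixy a c d.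
Proof.
move=> F; have [b [b0 adE bd t3]] := farey_matrix_b F.
have [m0 m1 e1 e2] := fix_eigen R F adE.
have st := fix_stab R F adE.
have irr := stab_irrational st.
have x01 := fix_itv R F adE.
rewrite (fix_dual R F adE); set x := fixx a c d in e1 e2 st irr x01 *.
have {}irr : irrational x by apply: irr; rewrite invf_gt1.
have /andP[x0 x1] := x01.
case=> a1 [s [k [/= /andP[a0 s0] ka xE ->]]].
have rs0 : pos (rcons s a1) by rewrite all_rcons a0 s0.
have rsn : rcons s a1 != [::] by case: (s).
have vs0 : pos (rev (a1 :: s)) by rewrite all_rev /= a0 s0.
have vsn : rev (a1 :: s) != [::] by rewrite rev_cons; case: (rev s).
have [/andP[Z0 Z1] pZ] := cf_per_fix R rs0 rsn.
have [/andP[Y0 Y1] pY] := cf_per_fix R vs0 vsn.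
rewrite cf_pre1 ?subn_gt0 // in xE; rewrite cf_pre1 //.
set Z := cf_per R (rcons s a1) in xE Z0 Z1 pZ.
set Y := cf_per R _ in Y0 Y1 pY *.
have a1_1 : 1 <= a1%:R :> R by rewrite ler1n.
pose W := (a1%:R + Z)^-1.
have W0 : 0 < W by rewrite invr_gt0; lra.
have pW : phi s W = Z by rewrite -[RHS]pZ /phi foldr_rcons.
have := wmat_rev (a1 :: s); have := @wmat_act R _ W (_ : pos (a1 :: s)) (ltW W0).
have := wmat_pos (_ : pos (a1 :: s)) isT.
case E : (wmat (a1 :: s)) => [[[p q] r] u].
rewrite -{1}[a1 :: s]/(a1 :: s) /= a0 s0 => /(_ isT) [q0 r0 u0] /(_ isT) [_ eW] Er.
have := @wmat_act R _ Y vs0 (ltW Y0); rewrite Er pY => -[_ eY].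
rewrite pW in eW.
have V0 : 0 < a1%:R + Z by lra.
have eV : q%:R * (a1%:R + Z) ^+ 2 - (u%:R - p%:R) * (a1%:R + Z) - r%:R = 0.
  move: eW; rewrite /W => eW.
  have : (p%:R * (a1%:R + Z)^-1 + q%:R) * (a1%:R + Z) ^+ 2 =
    ((r%:R * (a1%:R + Z)^-1 + u%:R) * (a1%:R + Z)^-1) * (a1%:R + Z) ^+ 2 by rewrite eW.
  have -> : (p%:R * (a1%:R + Z)^-1 + q%:R) * (a1%:R + Z) ^+ 2 = p%:R * (a1%:R + Z) + q%:R * (a1%:R + Z) ^+ 2.
    by field; rewrite gt_eqF.
  have -> : ((r%:R * (a1%:R + Z)^-1 + u%:R) * (a1%:R + Z)^-1) * (a1%:R + Z) ^+ 2 = r%:R + u%:R * (a1%:R + Z).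
    by field; rewrite gt_eqF.
  lra.
(* Difference of the quadratic equations of V and of -Y, divided by V + Y > 0: it says that V and -Y
   are the two roots, with sum (u - p) / q. *)
have VY : q%:R * (a1%:R + Z - Y) = u%:R - p%:R.
  apply: (mulIf (_ : a1%:R + Z + Y != 0)); first by rewrite gt_eqF //; lra.
  lra.
pose X : R := a1%:R - k%:R + Z.
have xX : x = X^-1 by rewrite xE natrB // ltnW.
have ka1 : k%:R + 1 <= a1%:R :> R by rewrite natr1 ler_nat.
have X0 : 0 < X by rewrite /X; move: ka1 Z0; clear; lra.
have xX1 : x * X = 1 by rewrite xX mulVf // gt_eqF.
have eX : b%:R * X - (d%:R - a%:R) - c%:R * x = 0.
  have : (a%:R * x + b%:R - (c%:R * x + d%:R) * x) * X = 0 by rewrite e1 e2 subrr mul0r.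
  by move=> <-; ring: xX1.
(* Two quadratic equations for X = 1/x, combined so that X^2 cancels. Times x this is an integer
   linear relation, whose coefficients vanish by irrationality; the constant one compares the sums
   of the roots. *)
have eq0 : (b%:R * q%:R * k%:R ^+ 2 - b%:R * (u%:R - p%:R) * k%:R - b%:R * r%:R + q%:R * c%:R) * x
  + (2 * b%:R * q%:R * k%:R - b%:R * (u%:R - p%:R) + q%:R * (d%:R - a%:R)) = 0.
  have VX : a1%:R + Z = X + k%:R by rewrite /X; ring.
  rewrite VX in eV.
  have : b%:R * (q%:R * (X + k%:R) ^+ 2 - (u%:R - p%:R) * (X + k%:R) - r%:R) * x
    - q%:R * (b%:R * X - (d%:R - a%:R) - c%:R * x) * (X * x) = 0.
    by rewrite eV eX !mulr0 !mul0r subr0.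
  move=> <-; ring: xX1.
have [//|_ K] := @irrational_lin R x
   (2 * b%:Z * q%:Z * k%:Z - b%:Z * (u%:Z - p%:Z) + q%:Z * (d%:Z - a%:Z))
   (b%:Z * q%:Z * k%:Z ^+ 2 - b%:Z * (u%:Z - p%:Z) * k%:Z - b%:Z * r%:Z + q%:Z * c%:Z) irr.
  by rewrite -[RHS]eq0 !(intrD, intrM, intrB, rmorphXn, rmorphN) /=; ring.
have {}K : 2 * b%:R * q%:R * k%:R - b%:R * (u%:R - p%:R) + q%:R * (d%:R - a%:R) = 0 :> R.
  have := congr1 (fun z : int => z%:~R : R) K.
  by rewrite mulr0z !(intrD, intrM, intrB, rmorphXn, rmorphN) /= => <-; ring.
have bp : 0 < b%:R :> R by rewrite ltr0n.
have qp : 0 < q%:R :> R by rewrite ltr0n.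
have yE : b%:R * ((1 + k)%:R + Y) = b%:R + c%:R * x.
  apply: (mulfI (lt0r_neq0 qp)).
  have -> : Y = a1%:R + Z - (u%:R - p%:R) / q%:R.
    by rewrite -VY mulrAC mulfV ?gt_eqF // mul1r; ring.
  have -> : c%:R * x = b%:R * X - (d%:R - a%:R) by move: eX; clear; lra.
  have -> : q%:R * (b%:R * ((1 + k)%:R + (a1%:R + Z - (u%:R - p%:R) / q%:R))) =
    q%:R * (b%:R * ((1 + k)%:R + (a1%:R + Z))) - b%:R * (u%:R - p%:R).
    by field; rewrite gt_eqF.
  rewrite natrD /X; move: K; clear; lra.
have n0 : 0 < (1 + k)%:R + Y by rewrite ltr_wpDl.
rewrite -yE invfM mulrA mulfV ?gt_eqF // mul1r //.
Qed.

Lemma farey_below_digit w k : 0 < w < 1 -> (k < digit w)%N ->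
  iter k farey w = (w^-1 - k%:R)^-1.
Proof.
move=> w01; have [d0 /andP[dw wd]] := digit_itv w01.
elim: k => [|k IH] kd; first by rewrite subr0 invrK.
rewrite iterS IH; last exact: ltnW.
have k2 : k%:R + 2 <= (digit w)%:R :> R by rewrite -natrD ler_nat addn2.
have t2 : 2 <= w^-1 - k%:R by lra.
rewrite /Defs.farey lef_pV2 ?posrE ?t2; [|lra|lra].
rewrite -natr1; move: (w^-1) t2 => v t2; field; rewrite !gt_eqF //; lra.
Qed.

Lemma QG_gauss w : QG w -> QG (gauss w).
Proof.
move=> wG; have orb := QG_orbit wG; have [_ _ [n n0 pw]] := wG.
have /andP[h0 h1] := orb 1%N; rewrite /= in h0 h1.
split; [by rewrite !ltW|by rewrite gt_eqF|exists n => //].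
by rewrite -iterSr iterS pw.
Qed.

Lemma QF_digit x : QF x -> exists w k, [/\ QG w, (k < digit w)%N & x = (w^-1 - k%:R)^-1].
Proof.
move=> /QF_QG [w [k [wG ->]]] {x}.
elim/ltn_ind: k w wG => k IH w wG.
have w01 : 0 < w < 1 := QG_orbit wG 0%N.
have [kd|dk] := ltnP k (digit w).
  by exists w, k; split => //; apply: farey_below_digit.
have [dw _] := digit_itv w01; have [gE _ _ _ _] := gauss_farey w01.
rewrite -(subnK dk) iterD gE.
by apply: IH; [rewrite ltn_subrL dw (leq_trans dw)|exact: QG_gauss].
Qed.

Lemma is_dual_exists x : QF x -> exists y, is_dual x y.
Proof.
move=> /QF_digit [w [k [wG kd ->]]]; have orb := QG_orbit wG.
have w01 : 0 < w < 1 := orb 0%N.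
have [_ _ [[|m] // _ pw]] := wG.
pose f j := digit (iter j gauss (gauss w)).
have fm : f m = digit w by rewrite /f -iterSr pw.
have f0 j : (0 < f j)%N.
  by rewrite /f -iterSr; have [] := digit_itv (orb j.+1).
have s0 : pos (mkseq f m) by apply/allP => e /mapP[j _ ->].
have rE : rcons (mkseq f m) (digit w) = mkseq f m.+1 by rewrite mkseqS fm.
have [d0 _] := digit_itv w01.
exists (cf_pre R [:: (1 + k)%N] (rev (digit w :: mkseq f m))), (digit w), (mkseq f m), k.
split => //=; first by rewrite d0.
rewrite cf_pre1 ?subn_gt0 //; [|by rewrite all_rcons d0|by case: (mkseq f m)].
rewrite rE gauss_cf_per //.
- by rewrite gauss_digit // natrB ?(ltnW kd) //; congr (_^-1); ring.
- by move=> i; rewrite -iterSr; exact: orb.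
- by rewrite -iterSr iterS pw.
Qed.

Lemma dual_fix a c d : farey_matrix a c d -> dual (fixx a c d) = fixy a c d.
Proof.
move=> F; apply: is_dual_fix => //.
have : exists y, is_dual (fixx a c d) y by apply: is_dual_exists; exact: QF_fix.
exact: xgetPex.
Qed.

End Duals.

(** * Sums over periodic orbits *)

Definition matrices (N : nat) : seq (nat * nat * nat) :=
  [seq p <- [seq (a, cd.1, cd.2) |
      cd <- [seq (c, d) | c <- index_iota 1 (N ^ 2).+1, d <- index_iota 1 N.+1],
      a <- index_iota 1 cd.1.+1] |
    farey_matrix p.1.1 p.1.2 p.2 && (p.1.1 + p.2 <= N)%N].

Lemma matrices_uniq N : uniq (matrices N).
Proof.
apply: filter_uniq; apply: allpairs_uniq_dep.
- by apply: allpairs_uniq; rewrite ?iota_uniq // => -[? ?] [? ?] _ _ [-> ->].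
- by move=> ? _; rewrite iota_uniq.
- by move=> [[c d] a] [[c' d'] a'] _ _ /= [-> -> ->].
Qed.

Lemma mem_matrices N a c d :
  ((a, c, d) \in matrices N) = farey_matrix a c d && (a + d <= N)%N.
Proof.
rewrite mem_filter /=; apply/andP/idP => [[]//|h]; split => //.
case/andP: h => F t; have [b [b0 adE bd t3]] := farey_matrix_b F.
case/and5P: F => a0 ac d0 _ _.
apply/allpairsPdep; exists (c, d), a; split => //; last by rewrite mem_index_iota a0 ltnS.
apply/allpairsPdep; exists c, d; rewrite !mem_index_iota; split => //; last lia.
rewrite (leq_trans a0 ac) /= ltnS.
have cad : (c <= a * d)%N by rewrite adE; nia.
by rewrite (leq_trans cad) // -mulnn leq_mul; lia.
Qed.

Section OrbitSums.
Variable R : realType.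
Implicit Types x z w l : R.
Notation fixx := (fix_x (@mu R)).
Notation fixy := (fix_y (@mu R)).
Notation lam t := ((mu R t)^-1).

Lemma matrix_sum_matrices N (w : nat -> nat -> nat -> R) :
  matrix_sum N w = \sum_(p <- matrices N) w p.1.1 p.1.2 p.2.
Proof. by rewrite big_filter big_mkcond !big_allpairs_dep. Qed.

Lemma lam_trace a c d : farey_matrix a c d ->
  1 < lam (a + d) /\ lam (a + d) + (lam (a + d))^-1 = (a + d)%:R.
Proof.
move=> F; have [b [b0 adE bd t3]] := farey_matrix_b F.
have [m0 m1 E] := mu_eq R t3; rewrite invf_gt1 // invrK; split => //.
apply: (mulIf (lt0r_neq0 m0)); rewrite mulrDl mulVf ?gt_eqF // -expr2.
by apply/eqP; rewrite -subr_eq0 -E; apply/eqP; ring.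
Qed.

Lemma lam_gt2 a c d : farey_matrix a c d -> 2 < lam (a + d).
Proof.
move=> F; have [l1 lE] := lam_trace F; have t3 := fix_trace3 F.
have : 3 <= (a + d)%:R :> R by rewrite ler_nat.
have : (lam (a + d))^-1 < 1 by rewrite invf_lt1 //; lra.
lra.
Qed.

(** The eigenvalue is c x + d, so irrationality of x determines c and d; it also determines the
    trace, hence a. *)
Lemma fix_inj a c d a' c' d' : farey_matrix a c d -> farey_matrix a' c' d' ->
  fixx a c d = fixx a' c' d' -> lam (a + d) = lam (a' + d') -> (a, c, d) = (a', c', d').
Proof.
move=> F F' ex el.
have [b [b0 adE _ _]] := farey_matrix_b F; have [b' [_ adE' _ _]] := farey_matrix_b F'.
have [_ _ e1 e2] := fix_eigen R F adE; have [_ _ e1' e2'] := fix_eigen R F' adE'.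
have irr := stab_irrational (fix_stab R F adE) (lam_trace F).1.
have : (c%:Z - c'%:Z)%:~R * fixx a c d + (d%:Z - d'%:Z)%:~R = 0.
  have : c%:R * fixx a c d + d%:R = c'%:R * fixx a c d + d'%:R by rewrite e2 ex e2' el.
  by rewrite !intrB => h; lra.
move=> /(irrational_lin irr) [/eqP + /eqP]; rewrite !subr_eq0 !eqz_nat => /eqP cc /eqP dd.
have : (a + d)%:R = (a' + d')%:R :> R by rewrite -(lam_trace F).2 -(lam_trace F').2 el.
by move/eqP; rewrite eqr_nat dd eqn_add2r cc => /eqP ->.
Qed.

Lemma min_stab_uniq x l l' : min_stab x l -> min_stab x l' -> l = l'.
Proof.
by move=> [s1 g1 m1] [s2 g2 m2]; apply/eqP; rewrite eq_le m1 ?m2.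
Qed.

(** Matrices that are not proper powers: each point of Q_F is the fixed point of exactly one of
    them. *)
Definition primitive (p : nat * nat * nat) : bool :=
  `[< min_stab (fixx p.1.1 p.1.2 p.2) (lam (p.1.1 + p.2)) >].

Definition trace_bound (T : R) : nat := Num.truncn (expR (T / 2) + expR (- (T / 2))).

(** l + 1/l increases for l >= 1: the difference of its values at e^(T/2) and at l has the sign of
    e^(T/2) - l. *)
Lemma length_trace a c d (T : R) : 0 <= T -> farey_matrix a c d ->
  (2 * ln (lam (a + d)) <= T) = (a + d <= trace_bound T)%N.
Proof.
move=> T0 F; have [l1 lE] := lam_trace F.
have e1 : 1 <= expR (T / 2) by rewrite -expR0 ler_expR divr_ge0.
rewrite /trace_bound truncn_ge_nat ?addr_ge0 ?expR_ge0 // expRN -lE.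
move: l1; set l := lam _ => l1; have l0 : 0 < l by lra.
have e0 : 0 < expR (T / 2) by lra.
have -> : (2 * ln l <= T) = (l <= expR (T / 2)).
  by rewrite -[in RHS](lnK (_ : l \in Num.pos)) ?posrE // ler_expR; apply/idP/idP; lra.
rewrite -[RHS]subr_ge0.
have -> : expR (T / 2) + (expR (T / 2))^-1 - (l + l^-1) =
    (expR (T / 2) - l) * (1 - (expR (T / 2) * l)^-1).
  by field; rewrite !gt_eqF.
rewrite pmulr_lge0 ?subr_ge0 // subr_gt0 invf_lt1 ?mulr_gt0 //.
by rewrite (lt_le_trans l1) // ler_peMl //; lra.
Qed.

Lemma QFT_matrices (T : R) : 0 <= T ->
  QFT T = [set` [seq fixx p.1.1 p.1.2 p.2 | p <- matrices (trace_bound T) & primitive p]].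
Proof.
move=> T0; apply/seteqP; split => x /=.
  move=> [xF]; have [l lm ->] := length_min xF => lT.
  have [a0 [c0 [d0 [F0 x0]]]] := exists_matrix xF; have [ls l1 _] := lm.
  have [a [c [d [F xE lE]]]] := matrix_of_stab F0 x0 ls l1.
  apply/mapP; exists (a, c, d) => //; rewrite mem_filter mem_matrices /primitive /=.
  by rewrite -xE -lE F -(length_trace T0 F) -lE lT; apply/andP; split; first exact/asboolP.
move=> /mapP[[[a c] d]]; rewrite mem_filter mem_matrices /primitive /=.
move=> /andP[/asboolP lm /andP[F t]] ->; have xF := QF_fix R F; split => //.
by have [l lm' ->] := length_min xF; rewrite (min_stab_uniq lm' lm) (length_trace T0 F).
Qed.

Lemma primitive_uniq N :
  uniq [seq fixx p.1.1 p.1.2 p.2 | p <- matrices N & primitive p].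
Proof.
rewrite map_inj_in_uniq; first by apply: filter_uniq; exact: matrices_uniq.
move=> [[a c] d] [[a' c'] d']; rewrite mem_filter mem_matrices => /andP[/asboolP m /andP[F _]].
rewrite mem_filter mem_matrices => /andP[/asboolP m' /andP[F' _]] /= e.
by apply: fix_inj => //; apply: (min_stab_uniq m); rewrite /= e.
Qed.

(** Divide l by the largest power of l0 that does not exceed it: the quotient is in [1, l0) and
    again an eigenvalue, so it is 1 by minimality. The bound 2 < l0 serves to find a power above
    l. *)
Lemma stab_power x l0 l : min_stab x l0 -> 2 < l0 -> stab x l -> 1 < l ->
  exists k, l = l0 ^+ k.
Proof.
move=> [s0 l01 mn] l02 s l1; have l00 : 0 < l0 by lra.
have ex : exists n, l < l0 ^+ n.+1.
  exists (Num.truncn l); apply: lt_le_trans (truncnS_gt _) _.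
  apply: (@le_trans _ _ (2 ^+ (Num.truncn l).+1)); last by rewrite lerXn2r ?nnegrE ?ltW.
  by rewrite -natrX ler_nat ltnW // ltn_expl.
pose k := ex_minn ex; exists k.
have [lk kl] : l < l0 ^+ k.+1 /\ l0 ^+ k <= l.
  rewrite /k; case: ex_minnP => -[|n] h hm; first by rewrite expr0 ltW.
  by split => //; rewrite leNgt; apply/negP => /hm; rewrite ltnn.
have sk n : stab x (l * l0^-1 ^+ n).
  elim: n => [|n IH]; first by rewrite expr0 mulr1.
  by rewrite exprSr mulrA; apply: stabM => //; exact: stabV.
have p0 : 0 < l0 ^+ k by rewrite exprn_gt0.
have [h|h] := ltP 1 (l * l0^-1 ^+ k).
  by have := mn _ (sk k) h; rewrite exprVn ler_pdivlMr // -exprS leNgt lk.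
by apply/eqP; rewrite eq_le kl andbT; move: h; rewrite exprVn ler_pdivrMr // mul1r.
Qed.

(* A matrix that is a proper power is recovered from the entries a0, b0, d0 of
   its primitive root and the exponent. *)
Definition power_code (p : nat * nat * nat) (q : nat * nat * nat * nat) : Prop :=
  let: (a, c, d) := p in let: (a0, b0, d0, k) := q in
  exists c0, [/\ farey_matrix a0 c0 d0, (a0 * d0 = b0 * c0 + 1)%N,
    fixx a c d = fixx a0 c0 d0 & lam (a + d) = lam (a0 + d0) ^+ k].

Definition codes r : seq (nat * nat * nat * nat) :=
  [seq (ijm, k) | ijm <- [seq (ij, m) | ij <- [seq (i, j) | i <- iota 0 (r ^ 2).+1, j <- iota 0 (r ^ 2).+1],
     m <- iota 0 (r ^ 2).+1], k <- iota 0 (4 * r)].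

(** A proper power has l0^2 <= l0^k <= r^4, so l0 <= r^2 and a0, b0, d0 <= r^2, while c0, recovered
    from a0 d0 = b0 c0 + 1, stays out of the code. From 2^k <= r^4 one gets k < 4 r. *)
Lemma power_code_exists N r p : (N <= r ^ 4)%N -> p \in matrices N -> ~~ primitive p ->
  exists2 q, q \in codes r & power_code p q.
Proof.
case: p => [[a c] d] Nr; rewrite mem_matrices => /andP[F tN] np.
have [b [b0 adE bd t3]] := farey_matrix_b F; have [l1 lE] := lam_trace F.
have [l0 lm _] := length_min (QF_fix R F); have [s0 l01 _] := lm.
have [a0 [c0 [d0 [F0 xE l0E]]]] := matrix_of_stab F (erefl _) s0 l01.
have [b' [b'0 adE' bd' _]] := farey_matrix_b F0.
have l02 := lam_gt2 F0; rewrite -l0E in l02.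
have st := fix_stab R F adE.
have [k lk] := stab_power lm l02 st l1.
have [_ l0t] := lam_trace F0; rewrite -l0E in l0t.
exists (a0, b', d0, k); last by exists c0; rewrite -l0E.
have k2 : (1 < k)%N.
  case: k lk => [|[|k]] // lk; first by rewrite lk expr0 ltxx in l1.
  by move/asboolP: np; case; rewrite /= lk expr1.
have lr : lam (a + d) <= (r ^ 4)%:R.
  apply: (@le_trans _ _ N%:R); last by rewrite ler_nat.
  apply: (@le_trans _ _ (a + d)%:R); last by rewrite ler_nat.
  by rewrite -lE lerDl invr_ge0; lra.
have l0r : l0 <= (r ^ 2)%:R.
  have : l0 ^+ 2 <= (r ^ 2)%:R ^+ 2.
    rewrite -natrX -expnM; apply: le_trans lr; rewrite lk.
    by apply: ler_weXn2l => //; exact: ltW.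
  by rewrite ler_pXn2r ?nnegrE //; lra.
have t0r : (a0 + d0 <= r ^ 2)%N.
  rewrite -ltnS -(ltr_nat R) -l0t -natr1.
  by have : l0^-1 < 1 by [rewrite invf_lt1; lra]; lra.
have k4 : (k < 4 * r)%N.
  rewrite ltnNge; apply/negP => rk.
  have : ((2 ^ r) ^ 4 <= r ^ 4)%N.
    rewrite -(ler_nat R) -expnM mulnC; apply: le_trans lr.
    apply: (@le_trans _ _ ((2 ^ k)%:R)); first by rewrite ler_nat leq_exp2l.
    by rewrite lk natrX; apply: lerXn2r; rewrite ?nnegrE; lra.
  by rewrite leq_exp2r // leqNgt ltn_expl.
apply: allpairs_f; last by rewrite mem_iota.
have d0r : (d0 <= r ^ 2)%N := leq_trans (leq_addl _ _) t0r.
have a0r : (a0 <= r ^ 2)%N := leq_trans (leq_addr _ _) t0r.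
have b'r : (b' <= r ^ 2)%N := leq_trans (ltnW bd') d0r.
by do 2![apply: allpairs_f; last by rewrite mem_iota add0n ltnS]; rewrite mem_iota add0n ltnS.
Qed.

Lemma power_code_inj a c d a' c' d' q : farey_matrix a c d -> farey_matrix a' c' d' ->
  power_code (a, c, d) q -> power_code (a', c', d') q -> (a, c, d) = (a', c', d').
Proof.
case: q => [[[a0 b0] d0] k] F F' [c0 [F0 E0 x0 l0]] [c1 [F1 E1 x1 l1]].
have e : c0 = c1.
  apply/eqP; rewrite -(@eqn_pmul2l b0); first by apply/eqP; lia.
  by have /and5P[_ _ _ h _] := F0; rewrite E0 in h; lia.
by apply: fix_inj => //; rewrite ?x0 ?x1 ?l0 ?l1 ?e.
Qed.

(** There are O(r^7) codes, that is O(N^(7/4)) for the least r with N <= r^4, below the order N^2 of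
    the main term. *)
Lemma size_nonprimitive N r : (N <= r ^ 4)%N ->
  (size [seq p <- matrices N | ~~ primitive p] <= (r ^ 2).+1 ^ 3 * (4 * r))%N.
Proof.
move=> Nr; set s := [seq p <- matrices N | ~~ primitive p].
have H p : exists q, p \in s -> q \in codes r /\ power_code p q.
  have [|ps] := boolP (p \in s); last by exists (0, 0, 0, 0)%N.
  rewrite mem_filter => /andP[np pN].
  by have [q h1 h2] := power_code_exists Nr pN np; exists q.
have [g gP] := choice H.
have -> : ((r ^ 2).+1 ^ 3 * (4 * r) = size (codes r))%N.
  by rewrite !size_allpairs !size_iota; ring.
rewrite -(size_map g); apply: uniq_leq_size; last first.
  by move=> q /mapP[p ps ->]; have [] := gP p ps.
rewrite map_inj_in_uniq; first by apply: filter_uniq; exact: matrices_uniq.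
move=> [[a c] d] [[a' c'] d'] ps ps' e.
have [_ h] := gP _ ps; have [_ h'] := gP _ ps'; rewrite -e in h'.
move: ps; rewrite mem_filter mem_matrices => /andP[_ /andP[F _]].
move: ps'; rewrite mem_filter mem_matrices => /andP[_ /andP[F' _]].
exact: power_code_inj h h'.
Qed.

Lemma nonprimitive_small e : 0 < e -> exists N0, forall N, (N0 <= N)%N ->
  (size [seq p <- matrices N | ~~ primitive p])%:R <= e * N%:R ^+ 2 :> R.
Proof.
(* The least r satisfies r^4 <= 16 N once r >= 2. The codes number at most 32 r^7 and e N^2 >= e r^8
   / 256, whence the condition 32 * 256 <= e r. *)
move=> e0; pose m := (Num.truncn (32 * 256 / e)).+2.
exists (m ^ 4)%N => N mN.
have ex : exists r, (N <= r ^ 4)%N.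
  by exists N; rewrite -{1}[N]expn1; case: (posnP N) => [->//|h]; rewrite leq_pexp2l.
pose r := ex_minn ex; have [Nr rmin] : (N <= r ^ 4)%N /\ forall r', (N <= r' ^ 4)%N -> (r <= r')%N.
  by rewrite /r; case: ex_minnP.
apply: le_trans (_ : ((r ^ 2).+1 ^ 3 * (4 * r))%:R <= _).
  by rewrite ler_nat; exact: size_nonprimitive.
have mr : (m <= r)%N by rewrite -(@leq_exp2r _ _ 4) // (leq_trans mN).
have r2 : (2 <= r)%N by apply: leq_trans mr.
have rN : (r ^ 4 <= 16 * N)%N.
  have h : (r.-1 ^ 4 < N)%N by rewrite ltnNge; apply/negP => /rmin; rewrite -ltnS prednK ?ltnn // ltnW.
  apply: leq_trans (_ : (2 * r.-1) ^ 4 <= _)%N; first by rewrite leq_exp2r //; lia.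
  by rewrite expnMn leq_mul2l ltnW.
have er : 32 * 256 <= e * r%:R.
  rewrite [leRHS]mulrC -ler_pdivrMr //; apply: le_trans (ltW (truncnS_gt _)) _.
  by rewrite ler_nat; apply: leq_trans mr.
apply: (@le_trans _ _ (32 * r%:R ^+ 7)).
  rewrite -[32]/(32%:R) -natrX -natrM ler_nat.
  apply: leq_trans (_ : (2 * r ^ 2) ^ 3 * (4 * r) <= _)%N.
    rewrite leq_mul2r leq_exp2r //; apply/orP; right.
    by rewrite mul2n -addnn -[leqLHS]addn1 leq_add2l expn_gt0 (ltnW r2).
  by apply: eq_leq; ring.
apply: (@le_trans _ _ (e * (r%:R ^+ 4 / 16) ^+ 2)); last first.
  rewrite ler_pM2l // ler_pXn2r ?nnegrE ?divr_ge0 ?exprn_ge0 //.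
  by rewrite ler_pdivrMr // mulrC -[16]/(16%:R) -natrX -natrM ler_nat.
have -> : e * (r%:R ^+ 4 / 16) ^+ 2 = (e * r%:R / 256) * r%:R ^+ 7 by field.
apply: ler_wpM2r; first by rewrite exprn_ge0.
by rewrite ler_pdivlMr ?ltr0n; first exact: er.
Qed.

Lemma QFT_sum (F : R -> R -> R) (M T : R) : 0 <= T -> 0 <= M ->
  (forall x y : R, 0 <= x <= 1 -> 0 <= y <= 1 -> `|F x y| <= M) ->
  `|\sum_(x \in QFT T) F x (dual x) -
    matrix_sum (trace_bound T) (fun a c d => F (fixx a c d) (fixy a c d))| <=
  M * (size [seq p <- matrices (trace_bound T) | ~~ primitive p])%:R.
Proof.
move=> T0 M0 FM; set N := trace_bound T; rewrite QFT_matrices // -fsbig_seq; last exact: primitive_uniq.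
rewrite big_map big_filter matrix_sum_matrices [X in _ - X](bigID primitive) /= -/N.
set A := \sum_(p <- _ | _) F _ (dual _); set B := \sum_(p <- _ | primitive p) _.
have -> : A = B.
  rewrite /A /B [LHS]big_seq_cond [RHS]big_seq_cond; apply: eq_bigr => -[[a c] d] /andP[]; rewrite mem_matrices /=.
  by move=> /andP[F0 _] _; rewrite dual_fix.
rewrite opprD addrA subrr add0r normrN; apply: le_trans (ler_norm_sum _ _ _) _.
have -> : M * (size [seq p <- matrices N | ~~ primitive p])%:R =
    \sum_(p <- matrices N | ~~ primitive p) M.
  by rewrite big_const_seq iter_addr_0 size_filter mulr_natr.
rewrite [leLHS]big_seq_cond [leRHS]big_seq_cond; apply: ler_sum => -[[a c] d] /andP[]; rewrite mem_matrices /=.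
move=> /andP[F0 _] _; have [b [b0 adE _ _]] := farey_matrix_b F0.
have /andP[x0 x1] := fix_itv R F0 adE; rewrite (fix_dual R F0 adE); apply: FM.
  by rewrite !ltW.
have bp : 0 < b%:R :> R by rewrite ltr0n.
have cx : 0 <= c%:R * fixx a c d by rewrite mulr_ge0 // ltW.
by rewrite divr_ge0 ?ler_pdivrMr; lra.
Qed.

End OrbitSums.

(** * Riemann sums *)

Section RiemannSums.
Variable R : realType.
Notation leb := (@lebesgue_measure R).

Lemma div_truncn_le (A e : R) n : 0 < e -> (Num.truncn (A / e) < n)%N -> A / n%:R <= e.
Proof.
move=> e0 An; rewrite ler_pdivrMr ?ltr0n; last exact: leq_ltn_trans An.
rewrite mulrC -ler_pdivrMr //.
by apply: le_trans (ltW (truncnS_gt _)) _; rewrite ler_nat.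
Qed.

Lemma square_bounded (f : R * R -> R) : {within `[0, 1] `*` `[0, 1], continuous f} ->
  exists2 M, 0 <= M & forall x y : R, 0 <= x <= 1 -> 0 <= y <= 1 -> `|f (x, y)| <= M.
Proof.
move=> hf; have K : compact (`[(0 : R), 1] `*` `[(0 : R), 1]).
  by apply: compact_setX; exact: segment_compact.
have [M [_ HM]] := compact_bounded (continuous_compact hf K).
exists (`|M| + 1); first by rewrite addr_ge0.
move=> x y x01 y01; apply: HM; first by rewrite (le_lt_trans (ler_norm M)) // ltrDl.
by exists (x, y) => //; split; rewrite /= in_itv.
Qed.

(** The near-covering form of compactness makes the local radius, half that of a continuity ball,
    uniform in p. *)
Lemma square_uniform (f : R * R -> R) : {within `[0, 1] `*` `[0, 1], continuous f} ->
  forall e : R, 0 < e -> exists2 r : R, 0 < r & forall x y x' y' : R,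
  0 <= x <= 1 -> 0 <= y <= 1 -> 0 <= x' <= 1 -> 0 <= y' <= 1 ->
  `|x - x'| <= r -> `|y - y'| <= r -> `|f (x, y) - f (x', y')| <= e.
Proof.
move=> hf e e0; set S := `[(0 : R), 1] `*` `[(0 : R), 1].
have K : compact S by apply: compact_setX; exact: segment_compact.
move/compact_near_coveringP: K => K.
pose P (r : R) (p : R * R) := S p -> forall q : R * R, S q ->
  `|p.1 - q.1| <= r -> `|p.2 - q.2| <= r -> `|f p - f q| <= e.
have loc p : S p -> \forall p' \near p & r \near (0 : R)^'+, P r p'.
  move=> Sp; have e2 : 0 < e / 2 by rewrite divr_gt0.
  have /subspace_continuousP/(_ p Sp)/cvgrPdist_le/(_ _ e2) hp := hf.
  have /nbhs_ballP[d /= d0 hd] : nbhs p (fun q => S q -> `|f p - f q| <= e / 2) by exact: hp.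
  have d2 : 0 < d / 2 by rewrite divr_gt0.
  exists (ball p (d / 2), [set r : R | r < d / 2]).
    split; first exact: nbhsx_ballx.
    exact: nbhs_right_lt.
  move=> [p' r] [/= [b1 b2] rd] Sp' q Sq h1 h2.
  have f1 : `|f p - f p'| <= e / 2.
    apply: hd => //; split.
      by apply: (le_ball _ b1); lra.
    by apply: (le_ball _ b2); lra.
  have f2 : `|f p - f q| <= e / 2.
    apply: hd => //; rewrite [d]splitr; split.
      by apply: (ball_triangle b1); rewrite /ball /= (le_lt_trans h1).
    by apply: (ball_triangle b2); rewrite /ball /= (le_lt_trans h2).
  rewrite -(subrKA (f p)) addrC [e]splitr; apply: le_trans (ler_normD _ _) _.
  by rewrite lerD // distrC.
have H := K R (0 : R)^'+ P _ loc.
have [r [r0 Hr]] := filter_ex (filterI (nbhs_right_gt (0 : R)) (H _)).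
exists r => // x y x' y' x01 y01 x'01 y'01 h1 h2.
by apply: (Hr (x, y)) => //; split; rewrite /= in_itv.
Qed.

Lemma uniform_within_continuous (g : R -> R) :
  (forall e : R, 0 < e -> exists2 r : R, 0 < r & forall x x', 0 <= x <= 1 -> 0 <= x' <= 1 ->
    `|x - x'| <= r -> `|g x - g x'| <= e) -> {within `[0, 1], continuous g}.
Proof.
move=> H; apply/subspace_continuousP => x; rewrite /= in_itv /= => x01.
apply/cvgrPdist_le => e e0; have [r r0 Hr] := H e e0.
have : nbhs x (fun y => `[(0 : R), 1]%classic y -> `|g x - g y| <= e) => //.
apply/nbhs_ballP; exists r => // y xy; rewrite /= in_itv /= => y01; apply: Hr => //.
exact: ltW.
Qed.

Lemma integral_cell (g : R -> R) (a b v e : R) : a <= b ->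
  leb.-integrable `[a, b] (EFin \o g) ->
  (forall x, a <= x <= b -> `|g x - v| <= e) ->
  `|\int[leb]_(x in `[a, b]) g x - (b - a) * v| <= e * (b - a).
Proof.
move=> ab gi H.
have m : fine (leb `[a, b]) = b - a.
  rewrite lebesgue_measure_itv /= lte_fin; case: ltP => // h.
  by have -> : a = b; [apply/eqP; rewrite eq_le ab | rewrite subrr].
have ci w : leb.-integrable `[a, b] (EFin \o (fun=> w : R)).
  apply: continuous_compact_integrable; first exact: segment_compact.
  by apply: continuous_subspaceT => ?; exact: cvg_cst.
have -> : (b - a) * v = \int[leb]_(x in `[a, b]) v by rewrite Rintegral_cst // m mulrC.
rewrite -RintegralB //.
have di : leb.-integrable `[a, b] (EFin \o (fun x => g x - v)).
  exact: (integrableB _ gi (ci v)).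
apply: le_trans (le_normr_Rintegral _ di) _ => //.
rewrite -m -Rintegral_cst //; apply: le_Rintegral => //; exact: (integrable_norm di).
Qed.

Lemma integral_split (g : R -> R) (a b c : R) : a <= b <= c ->
  leb.-integrable `[a, c] (EFin \o g) ->
  \int[leb]_(x in `[a, c]) g x = \int[leb]_(x in `[a, b]) g x + \int[leb]_(x in `[b, c]) g x.
Proof.
move=> /andP[ab bc] gi.
have := @Rintegral_itvB R g (BLeft a) (BRight c) b gi; rewrite !bnd_simp => /(_ ab bc) h.
rewrite -[LHS](subrK (\int[leb]_(x in `[a, b]) g x)) addrC h; congr (_ + _).
rewrite Rintegral_itv_obnd_cbnd //; apply: integrableS gi => //.
by move=> x; rewrite /= !in_itv /= => /andP[h1 ->]; rewrite andbT (le_trans ab) // ltW.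
Qed.

Lemma integrable_sub (g : R -> R) (a b : R) : 0 <= a -> b <= 1 ->
  leb.-integrable `[0, 1] (EFin \o g) -> leb.-integrable `[a, b] (EFin \o g).
Proof.
move=> a0 b1; apply: integrableS => // x; rewrite /= !in_itv /= => /andP[h1 h2].
by rewrite (le_trans a0) // (le_trans h2).
Qed.

Lemma riemann_sum (g : R -> R) (t : nat -> R) (j0 j1 : nat) (e : R) :
  leb.-integrable `[0, 1] (EFin \o g) -> (j0 <= j1)%N ->
  0 <= t j0 -> t j1 <= 1 -> (forall j, t j <= t j.+1) ->
  (forall j x, (j0 <= j < j1)%N -> t j <= x <= t j.+1 -> `|g x - g (t j)| <= e) ->
  `|\int[leb]_(x in `[t j0, t j1]) g x - \sum_(j0 <= j < j1) (t j.+1 - t j) * g (t j)|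
    <= e * (t j1 - t j0).
Proof.
move=> gi j01 t0 + tm; have mono m n : (m <= n)%N -> t m <= t n.
  by move=> /subnK <-; elim: (n - m)%N => [|k IH]; rewrite ?add0n // addSn (le_trans IH).
rewrite -(subnK j01); elim: (j1 - j0)%N => [|k IH] t1 H.
  rewrite add0n big_geq // subr0 subrr mulr0 set_itv1 Rintegral_set1 normr0 //.
rewrite addSn in t1 H *.
have mk : t j0 <= t (k + j0)%N by apply: mono; rewrite leq_addl.
have tk : t (k + j0)%N <= 1 by apply: le_trans t1.
rewrite big_nat_recr ?leq_addl //= (@integral_split _ _ (t (k + j0)%N)) ?mk ?tm //; last first.
  exact: integrable_sub.
have h1 := IH tk (fun j x jj => H j x (ltac:(lia))).
have h2 : `|\int[leb]_(x in `[t (k + j0)%N, t (k + j0).+1]) g x -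
    (t (k + j0).+1 - t (k + j0)%N) * g (t (k + j0)%N)| <= e * (t (k + j0).+1 - t (k + j0)%N).
  apply: integral_cell => //; first by apply: integrable_sub => //; apply: le_trans mk.
  by move=> x; apply: H; lia.
rewrite opprD addrACA; apply: le_trans (ler_normD _ _) _.
have -> : t (k + j0).+1 - t j0 = (t (k + j0)%N - t j0) + (t (k + j0).+1 - t (k + j0)%N) by ring.
by rewrite mulrDr lerD.
Qed.

Lemma integral_trim (g : R -> R) (a b M : R) : 0 <= a <= b -> b <= 1 ->
  leb.-integrable `[0, 1] (EFin \o g) -> (forall x, 0 <= x <= 1 -> `|g x| <= M) ->
  `|\int[leb]_(x in `[0, 1]) g x - \int[leb]_(x in `[a, b]) g x| <= M * (a + (1 - b)).
Proof.
move=> /andP[a0 ab] b1 gi gM.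
rewrite (integral_split (_ : 0 <= a <= 1) gi) ?a0 ?(le_trans ab) //.
rewrite (integral_split (_ : a <= b <= 1)) ?ab //; last exact: integrable_sub.
have h1 : `|\int[leb]_(x in `[0, a]) g x - (a - 0) * 0| <= M * (a - 0).
  apply: integral_cell => //; first by apply: integrable_sub => //; apply: le_trans b1.
  by move=> x /andP[h1 h2]; rewrite subr0; apply: gM; rewrite h1 (le_trans h2) // (le_trans ab).
have h2 : `|\int[leb]_(x in `[b, 1]) g x - (1 - b) * 0| <= M * (1 - b).
  apply: integral_cell => //; first by apply: integrable_sub => //; apply: le_trans ab.
  by move=> x /andP[h2 h3]; rewrite subr0; apply: gM; rewrite h3 (le_trans _ h2) // (le_trans a0).
rewrite mulr0 !subr0 in h1; rewrite mulr0 subr0 in h2.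
set A := \int[leb]_(x in `[0, a]) _ in h1 *; set C := \int[leb]_(x in `[b, 1]) _ in h2 *.
set B := \int[leb]_(x in _) _.
have -> : A + (B + C) - B = A + C by ring.
by apply: le_trans (ler_normD _ _) _; rewrite mulrDr lerD.
Qed.

Variables (f : R -> R -> R) (M : R).
Hypothesis M0 : 0 <= M.
Hypothesis fM : forall x y : R, 0 <= x <= 1 -> 0 <= y <= 1 -> `|f x y| <= M.
Hypothesis fU : forall e : R, 0 < e -> exists2 r : R, 0 < r & forall x y x' y' : R,
  0 <= x <= 1 -> 0 <= y <= 1 -> 0 <= x' <= 1 -> 0 <= y' <= 1 ->
  `|x - x'| <= r -> `|y - y'| <= r -> `|f x y - f x' y'| <= e.

Let g y := \int[leb]_(x in `[0, 1]) f x y.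

Lemma section_integrable y : 0 <= y <= 1 -> leb.-integrable `[0, 1] (EFin \o f^~ y).
Proof.
move=> y01; apply: continuous_compact_integrable; first exact: segment_compact.
apply: uniform_within_continuous => e e0; have [r r0 H] := fU e0; exists r => // x x' x01 x01' h.
by apply: H => //; rewrite subrr normr0 ltW.
Qed.

Lemma section_uniform (e : R) : 0 < e -> exists2 r : R, 0 < r & forall y y' : R, 0 <= y <= 1 -> 0 <= y' <= 1 ->
    `|y - y'| <= r -> `|g y - g y'| <= e.
Proof.
move=> e0; have [r r0 H] := fU e0; exists r => // y y' y01 y01' h.
rewrite /g -RintegralB //; [|exact: section_integrable..].
have di : leb.-integrable `[0, 1] (EFin \o (fun x => f x y - f x y')).
  exact: (integrableB _ (section_integrable y01) (section_integrable y01')).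
have : `|\int[leb]_(x in `[0, 1]) (f x y - f x y') - (1 - 0) * 0| <= e * (1 - 0).
  by apply: integral_cell => // x x01; rewrite subr0; apply: H => //; rewrite subrr normr0 ltW.
by rewrite mulr0 !subr0 mulr1.
Qed.

Lemma section_bounded y : 0 <= y <= 1 -> `|g y| <= M.
Proof.
move=> y01; have : `|g y - (1 - 0) * 0| <= M * (1 - 0).
  apply: integral_cell => //; first exact: section_integrable.
  by move=> x x01; rewrite subr0; apply: fM.
by rewrite mulr0 !subr0 mulr1.
Qed.

(** With nodes y_j = j / (q + j) the sum over j is almost a Riemann sum of mesh w_j = y_(j+1) - y_j:
    the factor q / (q + j)^2 differs from w_j by w_j / (q + j). The errors, e / 4 each, are this
    replacement, the sums in x, the sum in y, and the trimming of y. *)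
Lemma cellsum_integral (e : R) : 0 < e -> exists K0 : nat, forall K, (K0 <= K)%N ->
  exists q0 : nat, forall q, (q0 <= q)%N ->
  `|\sum_(0 <= i < q) \sum_(q %/ K ^ 3 <= j < K * q)
      f (i%:R / q%:R) (j%:R / (q%:R + j%:R)) / (q%:R + j%:R) ^+ 2
    - \int[leb]_(y in `[0, 1]) \int[leb]_(x in `[0, 1]) f x y| <= e.
Proof.
move=> e0; have e4 : 0 < e / 4 by rewrite divr_gt0.
have [r r0 H] := fU e4; have [r' r'0 H'] := section_uniform e4.
have gi : leb.-integrable `[0, 1] (EFin \o g).
  apply: continuous_compact_integrable; first exact: segment_compact.
  by apply: uniform_within_continuous; exact: section_uniform.
exists (Num.truncn (2 * M / (e / 4))).+1 => K KK.
have K0 : (0 < K)%N by apply: leq_ltn_trans KK.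
have KM : 2 * M / K%:R <= e / 4.
  exact: div_truncn_le.
exists (maxn (Num.truncn (M / (e / 4))).+1 (maxn (Num.truncn r^-1).+1 (Num.truncn r'^-1).+1)) => q.
rewrite !geq_max => /and3P[q1 q2 q3].
have q0 : (0 < q)%N by apply: leq_ltn_trans q2.
have qp : 0 < q%:R :> R by rewrite ltr0n.
have qM : M / q%:R <= e / 4.
  exact: div_truncn_le.
have qr : q%:R^-1 <= r.
  rewrite -[r]invrK lef_pV2 ?posrE ?invr_gt0 //.
  by apply: le_trans (ltW (truncnS_gt _)) _; rewrite ler_nat.
have qr' : q%:R^-1 <= r'.
  rewrite -[r']invrK lef_pV2 ?posrE ?invr_gt0 //.
  by apply: le_trans (ltW (truncnS_gt _)) _; rewrite ler_nat.
pose y j : R := j%:R / (q%:R + j%:R); pose w j := y j.+1 - y j.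
pose j0 := (q %/ K ^ 3)%N; pose j1 := (K * q)%N.
have K31 : (0 < K ^ 3)%N by rewrite expn_gt0 K0.
have j01 : (j0 <= j1)%N.
  by apply: leq_trans (leq_div _ _) _; rewrite /j1 leq_pmull.
have qj j : 0 < q%:R + j%:R :> R by rewrite ltr_wpDr.
have y01 j : 0 <= y j <= 1.
  by rewrite /y divr_ge0 ?(ltW (qj _)) //= ler_pdivrMr // mul1r lerDr.
have wE j : w j = q%:R / (q%:R + j%:R) / (q%:R + j.+1%:R).
  have h1 := qj j; have h2 := qj j.+1; rewrite /w /y; move: h2; rewrite -natr1 => h2.
  by field; rewrite !gt_eqF.
have w0 j : 0 <= w j by rewrite wE !divr_ge0 // ltW.
have wq j : w j <= q%:R^-1.
  rewrite wE -[leRHS]mul1r -[X in _ <= X * _](mulfV (lt0r_neq0 qp)).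
  apply: ler_pM; rewrite ?divr_ge0 ?invr_ge0 ?(ltW (qj _)) //.
    by rewrite ler_wpM2l // lef_pV2 ?posrE // lerDl.
  by rewrite lef_pV2 ?posrE // lerDl.
have ws : \sum_(j0 <= j < j1) w j <= 1.
  rewrite telescope_sumr //; move: (y01 j0) (y01 j1); clear; lra.
pose S v := \sum_(0 <= i < q) q%:R^-1 * f (i%:R / q%:R) v.
have nodes i : (i <= q)%N -> 0 <= (i%:R / q%:R : R) <= 1.
  by move=> iq; rewrite divr_ge0 //= ler_pdivrMr // mul1r ler_nat.
have SM v : 0 <= v <= 1 -> `|S v| <= M.
  move=> v01; apply: le_trans (ler_norm_sum _ _ _) _.
  apply: (@le_trans _ _ (\sum_(0 <= i < q) q%:R^-1 * M)); last first.
    by rewrite sumr_const_nat subn0 -[leLHS]mulr_natl mulrA mulfV ?mul1r // gt_eqF.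
  rewrite !big_nat; apply: ler_sum => i /andP[_ iq].
  by rewrite normrM ger0_norm ?invr_ge0 // ler_wpM2l ?invr_ge0 // fM // nodes // ltnW.
have Sg v : 0 <= v <= 1 -> `|g v - S v| <= e / 4.
  move=> v01; have := @riemann_sum (f^~ v) (fun i => i%:R / q%:R) 0 q (e / 4).
  rewrite mul0r divff ?gt_eqF // subr0 mulr1; set B := \sum_(_ <= _ < _) _.
  have -> : B = S v.
    apply: eq_bigr => i _; congr (_ * _).
    by rewrite -mulrBl -natrB // subSnn mul1r.
  apply => //; first exact: section_integrable.
    by move=> j; rewrite ler_wpM2r ?invr_ge0 // ler_nat.
  move=> j x /andP[_ jq] /andP[x1 x2].
  have /andP[n1 n2] := nodes j (ltnW jq); have /andP[n3 n4] := nodes j.+1 jq.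
  apply: H => //; rewrite ?n1 ?n2 ?(le_trans n1 x1) ?(le_trans x2) // ?subrr ?normr0 ?(ltW r0) //.
  apply: le_trans qr; rewrite ger0_norm ?subr_ge0 // lerBlDr (le_trans x2) //.
  by rewrite -natr1 mulrDl mul1r addrC.
have e1 : `|\sum_(j0 <= j < j1) (q%:R / (q%:R + j%:R) ^+ 2 - w j) * S (y j)| <= e / 4.
  apply: le_trans (ler_norm_sum _ _ _) _.
  apply: (@le_trans _ _ (\sum_(j0 <= j < j1) w j * (M / q%:R))); last first.
    rewrite -mulr_suml; apply: le_trans qM; rewrite ler_piMl // divr_ge0 //.
  apply: ler_sum => j _; rewrite normrM.
  have -> : q%:R / (q%:R + j%:R) ^+ 2 - w j = w j / (q%:R + j%:R).
    have h1 := qj j; have h2 := qj j.+1; rewrite wE; move: h2; rewrite -natr1 => h2.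
    by field; rewrite !gt_eqF.
  rewrite normrM (ger0_norm (w0 j)) -mulrA ler_wpM2l // mulrC ler_pM // ?SM //.
  by rewrite ger0_norm ?invr_ge0 ?(ltW (qj _)) // lef_pV2 ?posrE // lerDl.
have e2 : `|\sum_(j0 <= j < j1) w j * (g (y j) - S (y j))| <= e / 4.
  apply: le_trans (ler_norm_sum _ _ _) _.
  apply: (@le_trans _ _ (\sum_(j0 <= j < j1) w j * (e / 4))); last first.
    by rewrite -mulr_suml ler_piMl // ltW.
  by apply: ler_sum => j _; rewrite normrM (ger0_norm (w0 j)) ler_wpM2l // Sg.
have e3 : `|\int[leb]_(v in `[y j0, y j1]) g v - \sum_(j0 <= j < j1) w j * g (y j)| <= e / 4.
  have h := @riemann_sum g y j0 j1 (e / 4) gi j01.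
  apply: le_trans (h _ _ _ _) _.
  - by have /andP[] := y01 j0.
  - by have /andP[] := y01 j1.
  - by move=> j; rewrite -subr_ge0; exact: w0.
  - move=> j x _ /andP[x1 x2]; have /andP[n1 n2] := y01 j; have /andP[n3 n4] := y01 j.+1.
    apply: H' => //; first by rewrite (le_trans n1 x1) (le_trans x2).
    by apply: le_trans qr'; apply: le_trans (wq j); rewrite ger0_norm ?subr_ge0 // lerB.
  - by rewrite ler_piMr ?(ltW e4) //; move: (y01 j0) (y01 j1); clear; lra.
have e5 : `|\int[leb]_(v in `[0, 1]) g v - \int[leb]_(v in `[y j0, y j1]) g v| <= e / 4.
  apply: le_trans (integral_trim (M := M) _ _ gi section_bounded) _.
  - have /andP[-> _] := y01 j0; rewrite /= -subr_ge0 -(telescope_sumr y j01).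
    by apply: sumr_ge0 => j _; exact: w0.
  - by have /andP[] := y01 j1.
  (* The part of [0, 1] outside [y j0, y j1] has length at most 2 / K, as j0 <= q / K^3 and j1 = K
     q. *)
  have y0K : y j0 <= K%:R^-1.
    rewrite /y ler_pdivrMr //; apply: (@le_trans _ _ (K%:R^-1 * q%:R)).
      rewrite mulrC ler_pdivlMr ?ltr0n // -natrM ler_nat.
      apply: leq_trans (leq_divM q (K ^ 3)); rewrite leq_mul2l.
      by rewrite -{1}[K]expn1 leq_pexp2l // orbT.
    by rewrite ler_wpM2l ?invr_ge0 // lerDl.
  have y1K : 1 - y j1 <= K%:R^-1.
    have -> : 1 - y j1 = q%:R / (q%:R + j1%:R) by rewrite /y; field; rewrite gt_eqF.
    rewrite ler_pdivrMr // mulrDr /j1 natrM mulKf ?gt_eqF ?ltr0n //.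
    by rewrite lerDr mulr_ge0 ?invr_ge0.
  by apply: le_trans KM; rewrite mulrAC [leRHS]mulrC ler_wpM2l //; move: y0K y1K; clear; lra.
have -> : \sum_(0 <= i < q) \sum_(j0 <= j < j1) f (i%:R / q%:R) (y j) / (q%:R + j%:R) ^+ 2 =
   \sum_(j0 <= j < j1) (q%:R / (q%:R + j%:R) ^+ 2) * S (y j).
  rewrite exchange_big /=; apply: eq_bigr => j _; rewrite /S mulr_sumr; apply: eq_bigr => i _.
  by rewrite mulrA [RHS]mulrC; congr (_ * _); rewrite mulrAC mulfV ?mul1r // gt_eqF.
have E1 : \sum_(j0 <= j < j1) (q%:R / (q%:R + j%:R) ^+ 2) * S (y j) =
   \sum_(j0 <= j < j1) (q%:R / (q%:R + j%:R) ^+ 2 - w j) * S (y j)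
   - \sum_(j0 <= j < j1) w j * (g (y j) - S (y j)) + \sum_(j0 <= j < j1) w j * g (y j).
  rewrite -sumrB -big_split /=; apply: eq_bigr => j _; ring.
rewrite E1 -/(g _).
move: e1 e2 e3 e5; rewrite !ler_norml.
set A := \sum_(_ <= _ < _) _; set B := \sum_(_ <= _ < _) _; set C := \sum_(_ <= _ < _) _.
set D := \int[leb]_(v in `[y j0, _]) _; set I := \int[leb]_(v in _) g v.
clear; lra.
Qed.

End RiemannSums.

(** * Convergence of the weighted averages *)

Lemma trace_bound_unbounded (R : realType) (N0 : nat) : exists2 T0 : R, 0 <= T0 &
  forall T, T0 <= T -> (N0 <= trace_bound T)%N.
Proof.
exists (2 * N0%:R) => [|T hT]; first by rewrite mulr_ge0.
rewrite /trace_bound truncn_ge_nat ?addr_ge0 ?expR_ge0 //.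
have := expR_ge1Dx (T / 2); have := expR_ge0 (- (T / 2)); lra.
Qed.

Lemma hweight_uniform (R : realType) (f : R -> R -> R) (M : R) : 0 <= M ->
  (forall x y : R, 0 <= x <= 1 -> 0 <= y <= 1 -> `|f x y| <= M) ->
  (forall e : R, 0 < e -> exists2 r : R, 0 < r & forall x y x' y' : R,
    0 <= x <= 1 -> 0 <= y <= 1 -> 0 <= x' <= 1 -> 0 <= y' <= 1 ->
    `|x - x'| <= r -> `|y - y'| <= r -> `|f x y - f x' y'| <= e) ->
  forall e : R, 0 < e -> exists2 r : R, 0 < r & forall x y x' y' : R,
    0 <= x <= 1 -> 0 <= y <= 1 -> 0 <= x' <= 1 -> 0 <= y' <= 1 ->
    `|x - x'| <= r -> `|y - y'| <= r ->
    `|hweight (x, y) * f x y - hweight (x', y') * f x' y'| <= e.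
Proof.
move=> M0 fM fU e e0; have e2 : 0 < e / 2 by rewrite divr_gt0.
have [r r0 H] := fU _ e2; have M1 : 0 < 8 * (M + 1) by lra.
(* When both increments are at most t = e / (8 (M + 1)), x + y - x y moves by at most 2 t and its
   square by at most 4 t, and 4 t (M + 1) = e / 2. *)
exists (Num.min r (e / (8 * (M + 1)))) => [|x y x' y' x01 y01 x'01 y'01].
  by rewrite lt_min r0 divr_gt0.
rewrite !le_min => /andP[h1 g1] /andP[h2 g2]; rewrite /hweight /=.
have fB := fM x y x01 y01; have fD := H x y x' y' x01 y01 x'01 y'01 h1 h2.
move: fB fD; set u := f x y; set v := f x' y' => fB fD.
set s := x + y - x * y; set s' := x' + y' - x' * y'.
have itv (p q : R) : 0 <= p <= 1 -> 0 <= q <= 1 -> 0 <= p + q - p * q <= 1.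
  move=> /andP[p0 p1] /andP[q0 q1].
  have : 0 <= (1 - p) * (1 - q) by rewrite mulr_ge0 ?subr_ge0.
  have : 0 <= p * (1 - q) by rewrite mulr_ge0 ?subr_ge0.
  by rewrite !mulrBr !mulrBl !mulr1; lra.
have s01 : 0 <= s <= 1 := itv x y x01 y01; have s'01 : 0 <= s' <= 1 := itv x' y' x'01 y'01.
set t := e / (8 * (M + 1)) in g1 g2.
have ss : `|s - s'| <= 2 * t.
  have -> : s - s' = (x - x') * (1 - y) + (y - y') * (1 - x') by rewrite /s /s'; ring.
  apply: le_trans (ler_normD _ _) _; rewrite !normrM [2 * t]mulr_natl mulr2n.
  apply: lerD.
    by apply: le_trans g1; rewrite ler_piMr // ler_norml; lra.
  by apply: le_trans g2; rewrite ler_piMr // ler_norml; lra.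
have hh : `|s ^+ 2 - s' ^+ 2| <= 4 * t.
  have -> : s ^+ 2 - s' ^+ 2 = (s - s') * (s + s') by ring.
  rewrite normrM; have : `|s + s'| <= 2 by rewrite ler_norml; lra.
  have n1 := normr_ge0 (s - s'); have n2 := normr_ge0 (s + s') => n3.
  apply: le_trans (ler_pM n1 n2 ss n3) _; lra.
have h's : `|s' ^+ 2| <= 1.
  by have /andP[a0 a1] := s'01; rewrite ger0_norm ?sqr_ge0 // expr_le1.
have -> : s ^+ 2 * u - s' ^+ 2 * v = (s ^+ 2 - s' ^+ 2) * u + s' ^+ 2 * (u - v) by ring.
apply: le_trans (ler_normD _ _) _; rewrite [e]splitr; apply: lerD; rewrite normrM; last first.
  by apply: le_trans fD; rewrite ler_piMl.
have t0 : 0 <= 4 * t by rewrite mulr_ge0 // divr_ge0 // ltW.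
apply: le_trans (ler_pM (normr_ge0 _) (normr_ge0 _) hh (le_trans fB (_ : M <= M + 1))) _; first lra.
suff -> : 4 * t * (M + 1) = e / 2 by [].
by rewrite /t; field; rewrite gt_eqF // ltr_wpDl.
Qed.

Section Equidistribution.
Variables (R : realType) (rho : R).
Hypothesis rho0 : 0 < rho.
Hypothesis totient_rho : forall e : R, 0 < e -> exists X0 : nat, forall X, (X0 <= X)%N ->
  `|(totient_sum X)%:R - rho * X%:R ^+ 2| <= e * X%:R ^+ 2.

(** One K and one q serve both [weighted_asymp] and [cellsum_integral]. The errors, e N^2 / 3 each,
    are the nonprimitive matrices, the cell approximation and the Riemann sum. *)
Lemma weighted_orbit_sum (f : R * R -> R) (e : R) :
  {within `[0, 1] `*` `[0, 1], continuous f} -> 0 < e ->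
  exists T0 : R, forall T, T0 <= T ->
  `|\sum_(x \in QFT T) hweight (x, dual x) * f (x, dual x) - rho * (trace_bound T)%:R ^+ 2 *
    \int[@lebesgue_measure R]_(y in `[0, 1]) \int[@lebesgue_measure R]_(x in `[0, 1]) f (x, y)|
  <= e * (trace_bound T)%:R ^+ 2.
Proof.
move=> hf e0; have [M M0 fM] := square_bounded hf; have fU := square_uniform hf.
have e3 : 0 < e / 3 by rewrite divr_gt0.
have er : 0 < e / 3 / rho by rewrite divr_gt0.
have eM : 0 < e / 3 / (M + 1) by rewrite divr_gt0 //; lra.
have hU := hweight_uniform (f := fun x y => f (x, y)) M0 fM fU.
have [K1 H1] := weighted_asymp rho0 totient_rho (f := fun x y => f (x, y)) (@mu_itv R) fM hU e3.
have [K2 H2] := cellsum_integral (f := fun x y => f (x, y)) M0 fM fU er.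
have [q1 {}H1] := H1 (maxn K1 K2) (leq_maxl _ _).
have [q2 {}H2] := H2 (maxn K1 K2) (leq_maxr _ _).
have [N1 {}H1] := H1 (maxn q1 q2) (leq_maxl _ _).
have {}H2 := H2 (maxn q1 q2) (leq_maxr _ _).
have [N2 H3] := nonprimitive_small eM.
have [T0 T00 H0] := trace_bound_unbounded R (maxn N1 N2).
exists T0 => T TT; have := H0 T TT; rewrite geq_max => /andP[n1 n2].
have {H1} H1 := H1 _ n1; have {H3} H3 := H3 _ n2.
have M1 : 0 <= M + 1 by rewrite addr_ge0.
have hM : forall x y : R, 0 <= x <= 1 -> 0 <= y <= 1 -> `|hweight (x, y) * f (x, y)| <= M + 1.
  move=> x y x01 y01; rewrite normrM.
  have h1 : `|hweight (x, y)| <= 1.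
    by have /andP[p0 p1] := weight_itv x01 y01; rewrite /hweight ger0_norm.
  by apply: le_trans (ler_piMl _ h1) _ => //; rewrite (le_trans (fM _ _ x01 y01)) // lerDl.
have H4 := @QFT_sum R (fun x y => hweight (x, y) * f (x, y)) (M + 1) T (le_trans T00 TT) M1 hM.
move: H1 H2 H3 H4; set N := trace_bound T.
set A := \sum_(x \in _) _; set B := matrix_sum _ _; set C := \sum_(0 <= i < _) _.
set I := \int[_]_(y in _) _; set n := (size _)%:R => H1 H2 H3 H4.
have {}H2 : `|rho * N%:R ^+ 2 * (C - I)| <= e / 3 * N%:R ^+ 2.
  rewrite normrM ger0_norm; last by rewrite mulr_ge0 ?sqr_ge0 // ltW.
  rewrite -[leRHS](_ : rho * N%:R ^+ 2 * (e / 3 / rho) = _); last by field; rewrite gt_eqF.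
  by rewrite ler_wpM2l // mulr_ge0 ?sqr_ge0 // ltW.
have {H3}H4 : `|A - B| <= e / 3 * N%:R ^+ 2.
  apply: le_trans H4 _; apply: le_trans (ler_wpM2l M1 H3) _.
  by rewrite le_eqVlt; apply/orP; left; apply/eqP; field; rewrite gt_eqF //; lra.
have -> : A - rho * N%:R ^+ 2 * I =
  (A - B) + (B - rho * N%:R ^+ 2 * C) + rho * N%:R ^+ 2 * (C - I) by ring.
apply: le_trans (ler_normD _ _) _; apply: le_trans (lerD (ler_normD _ _) (lexx _)) _.
lra.
Qed.

(** [weighted_orbit_sum] is applied to f and to the constant 1; the factor rho N^2 cancels in the
    quotient. *)
Lemma orbit_average (f : R * R -> R) : {within `[0, 1] `*` `[0, 1], continuous f} ->
  (\sum_(x \in QFT T) hweight (x, dual x) * f (x, dual x))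
    / (\sum_(x \in QFT T) hweight (x, dual x)) @[T --> +oo]
  --> \int[@lebesgue_measure R]_(y in `[0, 1])
        \int[@lebesgue_measure R]_(x in `[0, 1]) f (x, y).
Proof.
move=> hf; set I := \int[_]_(y in _) _.
have h1 : {within `[0, 1] `*` `[0, 1], continuous ((fun=> 1) : R * R -> R)}.
  by apply: continuous_subspaceT => ?; exact: cvg_cst.
have m : fine (@lebesgue_measure R `[0, 1]) = 1.
  by rewrite lebesgue_measure_itv /= lte_fin ltr01 oppr0 adde0.
have J : \int[@lebesgue_measure R]_(y in `[0, 1]) \int[@lebesgue_measure R]_(x in `[0, 1]) (1 : R) = 1.
  have cst (v : R) : \int[@lebesgue_measure R]_(x in `[0, 1]) v = v.
    by rewrite Rintegral_cst // m mulr1.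
  by rewrite !cst.
apply/cvgrPdist_le => e e0.
have I1 : 0 < 2 * (1 + `|I|) by have := normr_ge0 I; lra.
(* d <= rho / 2 keeps the denominator above rho N^2 / 2; the second term makes (1 + |I|) d at most e
   rho / 2. *)
pose d := Num.min (rho / 2) (e * rho / (2 * (1 + `|I|))).
have d0 : 0 < d by rewrite lt_min !divr_gt0 // mulr_gt0.
have [T1 H1] := weighted_orbit_sum hf d0; have [T2 H2] := weighted_orbit_sum h1 d0.
have [T3 T30 H3] := trace_bound_unbounded R 1.
exists (Num.max T1 (Num.max T2 T3)); split; first exact: num_real.
move=> T; rewrite !gt_max => /and3P[/ltW t1 /ltW t2 /ltW t3].
have := H1 T t1; have := H2 T t2; have n0 := H3 T t3.
rewrite -/I J mulr1.
under eq_fsbigr do rewrite mulr1.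
set A := \sum_(x \in _) _; set B := \sum_(x \in _) _; set N := (trace_bound T)%:R => hA hB.
have N0 : 0 < N ^+ 2 by rewrite exprn_gt0 // ltr0n.
have dr : d <= rho / 2 by rewrite ge_min lexx.
have de : d <= e * rho / (2 * (1 + `|I|)) by rewrite ge_min lexx orbT.
have Ap : rho / 2 * N ^+ 2 <= A.
  have := ler_wpM2r (ltW N0) dr; move: hA; rewrite ler_norml; clear; lra.
have A0 : 0 < A by apply: lt_le_trans Ap; rewrite mulr_gt0 // divr_gt0.
have -> : I - B / A = (I * (A - rho * N ^+ 2) - (B - rho * N ^+ 2 * I)) / A.
  by field; rewrite gt_eqF.
rewrite normrM normfV (gtr0_norm A0) ler_pdivrMr //.
apply: le_trans (ler_normB _ _) _; rewrite normrM.
have k1 := ler_wpM2l (normr_ge0 I) hA.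
apply: (@le_trans _ _ (e * (rho / 2 * N ^+ 2))); last by rewrite ler_pM2l.
apply: (@le_trans _ _ ((1 + `|I|) * d * N ^+ 2)); first by move: hA hB k1; clear; lra.
rewrite [leRHS]mulrA ler_wpM2r ?(ltW N0) //.
move: de; rewrite ler_pdivlMr // ; clear; lra.
Qed.

End Equidistribution.

Theorem corollary2p5 (R : realType) (f : R * R -> R)
    (hf : {within `[0, 1] `*` `[0, 1], continuous f}) :
  (\sum_(x \in QFT T) hweight (x, dual x) * f (x, dual x))
    / (\sum_(x \in QFT T) hweight (x, dual x)) @[T --> +oo]
  --> \int[@lebesgue_measure R]_(y in `[0, 1])
        \int[@lebesgue_measure R]_(x in `[0, 1]) f (x, y).
Proof.
by have [rho rho0 totient_rho] := totient_density R; exact: (orbit_average rho0 totient_rho hf).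
Qed.
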